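(* Let $\omega=(\omega_x)_{x\in\mathbb Z}$ be an i.i.d. random environment satisfying $\mathbb E[\log\rho_0]=0$, $\operatorname{Var}(\log\rho_0)>0$ (where $\rho_0=\frac{1-\omega_0}{\omega_0}$), and $\mathbb P(\varepsilon\le\omega_0\le 1-\varepsilon)=1$ for some $\varepsilon\in(0,\tfrac12)$. Let $(X_n,Y_n)_{n\ge 0}$ be a two-dimensional process such that, with respect to $P_\omega$, $(X_n)_{n\ge0}$ and $(Y_n)_{n\ge0}$ are independent, where $(X_n)_{n\ge0}$ is the random walk in the environment $\omega$ started at $0$, and $(Y_n)_{n\ge0}$ is a centered random walk on $\mathbb Z$ (i.e. with i.i.d. integer-valued centered increments, whose law does not depend on $\omega$) such that $Y_0=0$ and $(Y_n/A_n)_n$ converges in distribution to a $\beta$-stable distribution with $\beta\in(1,2]$, for some suitable normalization $(A_n)_n$ of positive real numbers. Then, for $\mathbb P$-a.e. environment $\omega$, $(X_n,Y_n)_{n\ge0}$ is recurrent.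
   Context: $\omega=(\omega_x)_{x\in\mathbb Z}$ is a sequence of i.i.d. random variables with values in $(0,1)$ defined on a probability space $(\Omega,\mathcal F,\mathbb P)$; $\mathbb E$ and $\operatorname{Var}$ refer to $\mathbb P$. Given $\omega$, the random walk in the environment $\omega$ started at $0$ is the Markov chain $(X_n)_{n\ge0}$ on $\mathbb Z$ with $P_\omega(X_0=0)=1$ and $P_\omega(X_{n+1}=x+1\mid X_n=x)=\omega_x=1-P_\omega(X_{n+1}=x-1\mid X_n=x)$. A $\beta$-stable distribution is understood to be non-degenerate. Recurrent means that, $P_\omega$-almost surely, the process returns to its starting point $(0,0)$ infinitely often. *)

(* Defs.v *)
From HB Require Import structures.
From mathcomp Require Import all_boot all_order all_algebra.
From mathcomp Require Import finmap.
From mathcomp Require Import all_classical all_reals all_analysis.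

Set Implicit Arguments.
Unset Strict Implicit.
Unset Printing Implicit Defensive.

Import Order.TTheory GRing.Theory Num.Theory.
Import numFieldNormedType.Exports.

Local Open Scope classical_set_scope.
Local Open Scope ring_scope.

HB.instance Definition _ := isPointed.Build int 0.

HB.instance Definition _ := @isMeasurable.Build default_measure_display
  int discrete_measurable (@discrete_measurable0 int)
  (@discrete_measurableC int) (@discrete_measurableU int).

Section Independence.
Context {d d' : measure_display} {T : measurableType d} {T' : measurableType d'}.
Context {R : realType}.
Implicit Type P : probability T R.

Definition mutually_independent (I : choiceType) P (X : I -> T -> T') : Prop :=
  forall (J : {fset I}) (B : I -> set T'), (forall i, measurable (B i)) ->
    P (\bigcap_(i in [set` J]) (X i @^-1` B i)) =
    (\prod_(i <- J) P (X i @^-1` B i))%E.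

Definition identically_distributed (I : Type) P (X : I -> T -> T') : Prop :=
  forall i j (B : set T'), measurable B -> P (X i @^-1` B) = P (X j @^-1` B).

Definition iid (I : choiceType) P (X : I -> T -> T') : Prop :=
  mutually_independent P X /\ identically_distributed P X.

Definition process_sigma_algebra (X : nat -> T -> T') : set (set T) :=
  <<s [set E | exists n (B : set T'), measurable B /\ E = X n @^-1` B] >>.

Definition independent_processes P (X Y : nat -> T -> T') : Prop :=
  forall E F : set T, process_sigma_algebra X E -> process_sigma_algebra Y F ->
    P (E `&` F) = (P E * P F)%E.

End Independence.

Section Walks.
Context {d : measure_display} {T : measurableType d} {R : realType}.
Implicit Type P : probability T R.

(* Elementary conditional probability; only meaningful when [0 < P F]. *)
Definition cond_prob P (E F : set T) : R := fine (P (E `&` F)) / fine (P F).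

Definition history (X : nat -> T -> int) (n : nat) (x : nat -> int) : set T :=
  [set t | forall i, (i <= n)%N -> X i t = x i].

Definition markov_chain P (X : nat -> T -> int) (x0 : int)
    (p : int -> int -> R) : Prop :=
  P [set t | X 0%N t = x0] = 1%E /\
  forall (n : nat) (x : nat -> int) (y : int),
    (0 < P (history X n x))%E ->
    cond_prob P [set t | X n.+1 t = y] (history X n x) = p (x n) y.

Definition env_kernel (e : int -> R) (x y : int) : R :=
  if y == x + 1 then e x else if y == x - 1 then 1 - e x else 0.

Definition walk_in_env P (X : nat -> T -> int) (e : int -> R) : Prop :=
  markov_chain P X 0 (env_kernel e).

Definition increment (Y : nat -> T -> int) (n : nat) (t : T) : int :=
  Y n.+1 t - Y n t.

Definition random_walk P (Y : nat -> T -> int) (mu : probability int R) : Prop :=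
  [/\ P [set t | Y 0%N t = 0] = 1%E,
      mutually_independent P (increment Y) &
      forall n (B : set int), P (increment Y n @^-1` B) = mu B].

Definition cvg_in_distribution P (Z : nat -> T -> R) (nu : probability R R)
    : Prop :=
  forall f : R -> R, continuous f -> (exists M, forall x, `|f x| <= M) ->
    (\int[P]_t (f (Z n t))%:E)%E @[n --> \oo] --> (\int[nu]_x (f x)%:E)%E.

Definition recurrent P (X Y : nat -> T -> int) : Prop :=
  {ae P, forall t, forall N : nat,
    exists n : nat, (N < n)%N /\ (X n t, Y n t) = (0, 0)}.

End Walks.

Definition centered (R : realType) (mu : probability int R) : Prop :=
  mu.-integrable [set: int] (fun k : int => (k%:~R : R)%:E) /\
  (\int[mu]_k (k%:~R : R)%:E = 0)%E.

(* For independent [Z1], [Z2] of law [nu] and all [a, b > 0], the variable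
   [a * Z1 + b * Z2] has the law of [c * Z1 + e], where
   [c ^ beta = a ^ beta + b ^ beta]. *)
Definition stable (R : realType) (beta : R) (nu : probability R R) : Prop :=
  (forall x : R, nu [set x] <> 1%E) /\
  forall a b : R, 0 < a -> 0 < b ->
    exists c e : R,
      [/\ 0 < c, c `^ beta = a `^ beta + b `^ beta &
       forall B : set R, measurable B ->
         (nu \x nu)%E [set z | B (a * z.1 + b * z.2)] =
         nu [set z | B (c * z + e)]].

Definition rho (R : realType) (p : R) : R := (1 - p) / p.

(* Main.v *)
Require Import Defs.
From HB Require Import structures.
From mathcomp Require Import all_boot all_order all_algebra.
From mathcomp Require Import finmap.
From mathcomp Require Import all_classical all_reals all_analysis.
From mathcomp Require Import measurable_realfun.
From mathcomp Require Import zify ring lra.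

Set Implicit Arguments.
Unset Strict Implicit.
Unset Printing Implicit Defensive.

Import Order.TTheory GRing.Theory Num.Theory.
Import numFieldNormedType.Exports.

Local Open Scope classical_set_scope.
Local Open Scope ring_scope.

(** For a quenched environment the two walks are independent, so
    P(X_n = Y_n = 0) = P(X_n = 0) P(Y_n = 0), and by a renewal argument it is
    enough that the series of these products diverges for almost every
    environment.

    Stability makes the modulus psi of the characteristic function of nu satisfy
    psi(a t) psi(b t) = psi(c t) with c^beta = a^beta + b^beta; comparing the
    walk at times n and n/2 then gives A_n = O(n^a) for every a > 1/beta.  Since
    beta > 1 one may take a < 1, and as the even-time Green function of Y is
    maximal at 0, sum_(n < N) P(Y_2n = 0) >= c N^(1-a).

    The potential of the environment is a centered random walk on each side of
    the origin.  By a gambler's ruin estimate and the second Borel-Cantelli lemma,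
    applied to disjoint blocks, there are almost surely infinitely many scales h
    at which on both sides the potential reaches height about h before going below
    -2 gamma h, within a distance polynomial in h.  At such a scale X is confined
    to the valley for e^(h/2)/4 steps, so reversibility and the Cauchy-Schwarz
    inequality bound P(X_2n = 0) below by e^(-2 gamma h)/poly(h) for these n.
    For gamma = (1-a)/8 they contribute at least e^((1-a) h/4)/poly(h) to the
    series. *)

(** * Bounded random variables and independent sigma-algebras *)

(** Convergence in distribution says nothing about a single probability P(Y_2n = 0), which vanishes
    for many n when the increments are periodic. Hence only sums over time are estimated: tightness
    puts half of the mass of Y_2n, n < N, in a window of width of order N^a, and the maximum
    principle for the Green function moves this mass to the origin. The return probability of X
    oscillates with the shape of the valley reached so far, so it is bounded below at scattered
    scales only. This suffices, because a single good scale h, large in terms of M, already makes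
    the partial sum exceed M: the e^(h/2) available times yield a gain of exponent (1-a)/2, and
    gamma is chosen so that the cost 2 gamma is half of it. Staying above -gamma h while climbing to
    h costs a factor of order gamma in probability, the same at every scale, as Borel-Cantelli
    requires. The floor is -2 gamma h because one gamma h is allowed inside the block and another is
    reserved for the earlier blocks, about which only the bound on the increments of the potential
    is used. *)

Section bounded_measurable.
Context {d : measure_display} {T : measurableType d} {R : realType}.
Implicit Types (U V : T -> R) (A : set T).

(** The expectations computed below are those of indicators, sines, cosines and truncated
    logarithms; this class is closed under the operations performed on them and settles all
    integrability conditions. *)
Definition bounded_mfun U :=
  measurable_fun [set: T] U /\ exists M, forall x, `|U x| <= M.

Lemma bounded_mfun_cst (r : R) : bounded_mfun (fun=> r).
Proof. by split; [exact: measurable_cst|exists `|r|]. Qed.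

Lemma bounded_mfunD U V :
  bounded_mfun U -> bounded_mfun V -> bounded_mfun (fun x => U x + V x).
Proof.
move=> [mU [M hM]] [mV [N hN]]; split; first exact: measurable_funD.
by exists (M + N) => x; rewrite (le_trans (ler_normD _ _))// lerD.
Qed.

Lemma bounded_mfunN U : bounded_mfun U -> bounded_mfun (fun x => - U x).
Proof.
move=> [mU [M hM]]; split; first exact: measurableT_comp.
by exists M => x; rewrite normrN.
Qed.

Lemma bounded_mfunB U V :
  bounded_mfun U -> bounded_mfun V -> bounded_mfun (fun x => U x - V x).
Proof. by move=> mU mV; apply: bounded_mfunD => //; exact: bounded_mfunN. Qed.

Lemma bounded_mfunM U V :
  bounded_mfun U -> bounded_mfun V -> bounded_mfun (fun x => U x * V x).
Proof.
move=> [mU [M hM]] [mV [N hN]]; split; first exact: measurable_funM.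
by exists (M * N) => x; rewrite normrM ler_pM.
Qed.

Lemma bounded_mfun_sum (I : Type) (s : seq I) (U : I -> T -> R) :
  (forall i, bounded_mfun (U i)) -> bounded_mfun (fun x => \sum_(i <- s) U i x).
Proof.
move=> mU; elim: s => [|i s IH].
  rewrite (_ : (fun=> _) = fun=> 0); first exact: bounded_mfun_cst.
  by apply/funext => x; rewrite big_nil.
rewrite (_ : (fun=> _) = fun x => U i x + \sum_(j <- s) U j x).
  exact: bounded_mfunD.
by apply/funext => x; rewrite big_cons.
Qed.

Lemma bounded_mfun_indic A : measurable A -> bounded_mfun (\1_A : T -> R).
Proof.
move=> mA; split; first exact: measurable_indic.
by exists 1 => x; rewrite indicE; case: (x \in A); rewrite !(normr1, normr0).
Qed.

Lemma bounded_mfun_integrable (P : probability T R) U :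
  bounded_mfun U -> P.-integrable [set: T] (EFin \o U).
Proof.
move=> [mU [M hM]]; apply: measurable_bounded_integrable => //.
  by rewrite (@le_lt_trans _ _ 1%E) ?ltry// probability_le1.
exists M; split; first exact: num_real.
by move=> N MN x _ /=; rewrite (le_trans (hM x))// ltW.
Qed.

End bounded_measurable.

Lemma bounded_mfun_comp d d' (T : measurableType d) (T' : measurableType d')
    (R : realType) (U : T' -> R) (X : T -> T') :
  bounded_mfun U -> measurable_fun [set: T] X ->
  bounded_mfun (fun x => U (X x)).
Proof.
by move=> [mU [M hM]] mX; split; [exact: measurableT_comp|exists M => x].
Qed.

Section bounded_expectation.
Context {d : measure_display} {T : measurableType d} {R : realType}.
Variable P : probability T R.
Implicit Types (U V : T -> R) (A : set T).

Lemma meanD U V : bounded_mfun U -> bounded_mfun V ->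
  \int[P]_x (U x + V x) = \int[P]_x U x + \int[P]_x V x.
Proof. by move=> mU mV; apply: RintegralD => //; exact: bounded_mfun_integrable. Qed.

Lemma meanB U V : bounded_mfun U -> bounded_mfun V ->
  \int[P]_x (U x - V x) = \int[P]_x U x - \int[P]_x V x.
Proof. by move=> mU mV; apply: RintegralB => //; exact: bounded_mfun_integrable. Qed.

Lemma meanZl (r : R) U : bounded_mfun U ->
  \int[P]_x (r * U x) = r * \int[P]_x U x.
Proof. by move=> mU; apply: RintegralZl => //; exact: bounded_mfun_integrable. Qed.

Lemma mean_cst (r : R) : \int[P]_x r = r.
Proof. by rewrite Rintegral_cst//= probability_setT mulr1. Qed.

Lemma le_mean U V : bounded_mfun U -> bounded_mfun V ->
  (forall x, U x <= V x) -> \int[P]_x U x <= \int[P]_x V x.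
Proof. by move=> mU mV UV; apply: le_Rintegral => //; exact: bounded_mfun_integrable. Qed.

Lemma mean_sum (I : Type) (s : seq I) (U : I -> T -> R) :
  (forall i, bounded_mfun (U i)) ->
  \int[P]_x (\sum_(i <- s) U i x) = \sum_(i <- s) \int[P]_x U i x.
Proof.
move=> mU; elim: s => [|i s IH].
  by under eq_Rintegral do rewrite big_nil; rewrite big_nil mean_cst.
under eq_Rintegral do rewrite big_cons.
by rewrite meanD ?big_cons ?IH//; exact: bounded_mfun_sum.
Qed.

Lemma mean_indic A : measurable A -> \int[P]_x \1_A x = fine (P A).
Proof. by move=> mA; rewrite /Rintegral integral_indic// setIT. Qed.

Lemma EFin_mean U : bounded_mfun U ->
  (\int[P]_x U x)%:E = (\int[P]_x (U x)%:E)%E.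
Proof.
move=> mU; rewrite /Rintegral fineK//; apply: integrable_fin_num => //.
exact: bounded_mfun_integrable.
Qed.

Lemma le_norm_mean U M : bounded_mfun U -> (forall x, `|U x| <= M) ->
  `|\int[P]_x U x| <= M.
Proof.
move=> mU hM; rewrite -[leRHS]mean_cst.
rewrite ler_norml; apply/andP; split.
  rewrite -mulN1r -meanZl; last exact: bounded_mfun_cst.
  apply: le_mean => //; first exact: bounded_mfun_cst.
  by move=> x; move: (hM x); rewrite mulN1r ler_norml => /andP[].
apply: le_mean => //; first exact: bounded_mfun_cst.
by move=> x; move: (hM x); rewrite ler_norml => /andP[].
Qed.

Lemma fin_prob A : measurable A -> P A \is a fin_num.
Proof. exact: fin_num_measure. Qed.

Lemma fineK_prob A : measurable A -> (fine (P A))%:E = P A.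
Proof. by move=> mA; rewrite fineK//; exact: fin_prob. Qed.

Lemma fine_prob_ge0 A : 0 <= fine (P A).
Proof. exact: fine_ge0. Qed.

Lemma fine_prob_le1 A : measurable A -> fine (P A) <= 1.
Proof. by move=> mA; rewrite -lee_fin fineK_prob// probability_le1. Qed.

Lemma le_fine_prob A B : measurable A -> measurable B -> A `<=` B ->
  fine (P A) <= fine (P B).
Proof. by move=> mA mB AB; rewrite -lee_fin !fineK_prob// le_measure ?inE. Qed.

Lemma fine_probC A : measurable A -> fine (P (~` A)) = 1 - fine (P A).
Proof.
move=> mA; rewrite probability_setC// fineB// ?fin_prob//.
Qed.

Lemma prob1_setC A : measurable A -> P A = 1%E -> P (~` A) = 0%E.
Proof. by move=> mA PA; rewrite probability_setC// PA subee. Qed.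

Lemma prob1_setIr A B : measurable A -> measurable B -> P A = 1%E ->
  P (A `&` B) = P B.
Proof.
move=> mA mB PA.
have mAc := measurableC mA.
apply/eqP; rewrite eq_le; apply/andP; split.
  apply: le_measure; rewrite ?inE//; first exact: measurableI.
have -> : B = (A `&` B) `|` (~` A `&` B).
  by rewrite -setIUl setUv setTI.
rewrite (le_trans (measureU2 _ _ _))//; [exact: measurableI|exact: measurableI|].
rewrite setIUr setIA setIid setIA setICr set0I setU0.
rewrite [X in (_ + X <= _)%E](_ : _ = 0%E) ?adde0//.
apply/eqP; rewrite eq_le measure_ge0 andbT -(prob1_setC mA PA).
by apply: le_measure; rewrite ?inE//; exact: measurableI.
Qed.

End bounded_expectation.

Section independent_pair.
Context d d1 d2 (T : measurableType d) (T1 : measurableType d1)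
  (T2 : measurableType d2) (R : realType) (P : probability T R).
Variables (U : T -> T1) (V : T -> T2).
Hypotheses (mU : measurable_fun [set: T] U) (mV : measurable_fun [set: T] V).
Hypothesis UV : forall A B, measurable A -> measurable B ->
  P (U @^-1` A `&` V @^-1` B) = (P (U @^-1` A) * P (V @^-1` B))%E.

Lemma bounded_mfun_mean_pair (f : T1 * T2 -> R) : bounded_mfun f ->
  bounded_mfun (fun x => \int[P]_s f (x, V s)).
Proof.
move=> bf.
pose V' : {mfun T >-> T2} := HB.pack V (isMeasurableFun.Build _ _ _ _ _ mV).
have mf1 x : bounded_mfun (fun y => f (x, y)).
  by apply: bounded_mfun_comp => //; exact: pair1_measurable.
split.
  apply/measurable_EFinP.
  have -> : EFin \o (fun x => \int[P]_s f (x, V s)) =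
      fubini_F (distribution P V') (fun z => (f z)%:E).
    apply/funext => x; rewrite /fubini_F/= EFin_mean; last first.
      exact: (@bounded_mfun_comp _ _ _ _ _ (fun y => f (x, y)) V).
    rewrite integral_distribution//.
      by apply/measurable_EFinP; case: (mf1 x).
    apply: bounded_mfun_integrable.
    exact: (@bounded_mfun_comp _ _ _ _ _ (fun y => f (x, y)) V).
  (* A Dirac mass serves as the first marginal, since only the inner integral is at stake. *)
  apply: (@measurable_fubini_F _ _ _ _ _ (dirac point)).
  exact: (@bounded_mfun_integrable _ _ _ (dirac point \x distribution P V')%E).
have [M hM] := bf.2; exists M => x; apply: le_norm_mean => //.
exact: (@bounded_mfun_comp _ _ _ _ _ (fun y => f (x, y)) V).
Qed.

(** Independence on rectangles identifies the law of the pair with the product of the marginals, by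
    uniqueness of product measures; the rest is Fubini. *)
Lemma mean_independent_pair (f : T1 * T2 -> R) : bounded_mfun f ->
  \int[P]_t f (U t, V t) = \int[P]_t \int[P]_s f (U t, V s).
Proof.
move=> bf.
pose U' : {mfun T >-> T1} := HB.pack U (isMeasurableFun.Build _ _ _ _ _ mU).
pose V' : {mfun T >-> T2} := HB.pack V (isMeasurableFun.Build _ _ _ _ _ mV).
have mUV : measurable_fun [set: T] (fun t => (U t, V t)).
  exact/measurable_fun_pair.
pose W : {mfun T >-> (T1 * T2)%type} :=
  HB.pack (fun t => (U t, V t)) (isMeasurableFun.Build _ _ _ _ _ mUV).
have mf1 t : bounded_mfun (fun y => f (t, y)).
  by apply: bounded_mfun_comp => //; exact: pair1_measurable.
rewrite /Rintegral.
have -> : (\int[P]_x (f (U x, V x))%:E)%E = (\int[distribution P W]_z (f z)%:E)%E.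
  rewrite integral_distribution//.
    by apply/measurable_EFinP; case: bf.
  by apply: bounded_mfun_integrable; exact: bounded_mfun_comp.
have -> : (\int[distribution P W]_z (f z)%:E =
    \int[distribution P U' \x distribution P V']_z (f z)%:E)%E.
  apply: eq_measure_integral => A mA _; apply/esym/product_measure_unique => //.
rewrite -integral12_prod_meas1; last first.
  exact: (@bounded_mfun_integrable _ _ _ (distribution P U' \x distribution P V')%E).
have FE : fubini_F (distribution P V') (fun z => (f z)%:E) =
    EFin \o (fun x => \int[P]_s f (x, V s)).
  apply/funext => x; rewrite /fubini_F/= EFin_mean; last first.
    exact: (@bounded_mfun_comp _ _ _ _ _ (fun y => f (x, y)) V).
  rewrite integral_distribution//.
    by apply/measurable_EFinP; case: (mf1 x).
  apply: bounded_mfun_integrable.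
  exact: (@bounded_mfun_comp _ _ _ _ _ (fun y => f (x, y)) V).
have bF := bounded_mfun_mean_pair bf.
rewrite FE integral_distribution//.
  by apply/measurable_EFinP; case: bF.
by apply: bounded_mfun_integrable; exact: bounded_mfun_comp bF mU.
Qed.

End independent_pair.

Lemma mean_independentM d (T : measurableType d) (R : realType)
    (P : probability T R) (U V : T -> R) :
  bounded_mfun U -> bounded_mfun V ->
  (forall A B, measurable A -> measurable B ->
    P (U @^-1` A `&` V @^-1` B) = (P (U @^-1` A) * P (V @^-1` B))%E) ->
  \int[P]_t (U t * V t) = \int[P]_t U t * \int[P]_t V t.
Proof.
move=> bU bV UV.
have [M hM] := bU.2; have [N hN] := bV.2.
have M0 : 0 <= M := le_trans (normr_ge0 _) (hM point).
have N0 : 0 <= N := le_trans (normr_ge0 _) (hN point).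
(* The product is unbounded on the plane, so each coordinate is clamped at a level that the
   variables never exceed. *)
pose cl (K x : R) := Num.max (- K) (Num.min K x).
have clE K x : `|x| <= K -> cl K x = x.
  rewrite ler_norml => /andP[h1 h2]; rewrite /cl.
  by rewrite (min_idPr h2) (max_idPr h1).
have mcl K : measurable_fun [set: R] (cl K).
  by apply: measurable_maxr => //; exact: measurable_minr.
have clb K x : 0 <= K -> `|cl K x| <= K.
  by move=> K0; rewrite ler_norml /cl le_max lexx/= ge_max ge_min lexx/= andbT; lra.
pose f (z : R * R) := cl M z.1 * cl N z.2.
have bf : bounded_mfun f.
  apply: bounded_mfunM; split.
  - by apply: measurableT_comp => //; exact: measurable_fst.
  - by exists M => x; exact: clb.
  - by apply: measurableT_comp => //; exact: measurable_snd.
  - by exists N => x; exact: clb.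
have -> : \int[P]_t (U t * V t) = \int[P]_t f (U t, V t).
  by apply: eq_Rintegral => t _; rewrite /f/= !clE.
rewrite (mean_independent_pair bU.1 bV.1 UV bf).
transitivity (\int[P]_t (\int[P]_s V s * U t)).
  apply: eq_Rintegral => t _; rewrite mulrC -meanZl//.
  by apply: eq_Rintegral => s _; rewrite /f/= !clE.
by rewrite meanZl// mulrC.
Qed.

(** Both sides, as functions of [E], are finite measures that agree on the pi-system [G]. *)
Lemma g_sigma_algebra_independent d (T : measurableType d) (R : realType)
    (P : probability T R) (G : set (set T)) (F : set T) :
  G `<=` measurable -> setI_closed G -> G setT -> measurable F ->
  (forall E, G E -> P (E `&` F) = (P E * P F)%E) ->
  forall E, <<s G >> E -> P (E `&` F) = (P E * P F)%E.
Proof.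
move=> Gm GI GT mF GF E sE.
have PF0 : 0 <= fine (P F) by exact: fine_prob_ge0.
pose m1 : {measure set T -> \bar R} := mrestr P mF.
pose m2 : {measure set T -> \bar R} := mscale (NngNum PF0) P.
have m2E A : m2 A = (P A * P F)%E.
  by rewrite /m2 /= /mscale/= fineK_prob// muleC.
rewrite -m2E; apply: (@g_sigma_algebra_measure_unique _ _ _ G Gm (fun=> setT)
  _ _ m1 m2) => //.
- by apply/seteqP; split => // x _; exists 0%N.
- by move=> A GA; rewrite m2E -GF.
- by move=> _; rewrite /m1/= /mrestr setTI ltey_eq fin_prob.
Qed.

(** * Sigma-algebras of disjoint sets of coordinates *)

Section independent_sigma_algebras.
Context d d' (T : measurableType d) (T' : measurableType d') (R : realType).
Variables (I : choiceType) (P : probability T R) (X : I -> T -> T').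
Hypothesis mX : forall i, measurable_fun [set: T] (X i).
Hypothesis indX : mutually_independent P X.
Implicit Types (J K : set I).

Definition events_in J : set (set T) :=
  [set E | exists i (B : set T'), [/\ J i, measurable B & E = X i @^-1` B]].

(** [events_in J] is in general not stable under intersection; the finite cylinders form a pi-system
    generating the same sigma-algebra. *)
Let cylinder J : set (set T) :=
  [set E | exists (D : {fset I}) (B : I -> set T'),
    [/\ [set` D] `<=` J, (forall i, measurable (B i)) &
        E = \bigcap_(i in [set` D]) (X i @^-1` B i)]].

Let cylinder_measurable J : cylinder J `<=` measurable.
Proof.
move=> E [D [B [_ mB ->]]].
apply: fin_bigcap_measurable; first exact: finite_fset.
by move=> i _; rewrite -[X in measurable X]setTI; exact: mX.
Qed.

Lemma events_in_measurable J : events_in J `<=` measurable.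
Proof.
move=> E [i [B [_ mB ->]]].
by rewrite -[X in measurable X]setTI; exact: mX.
Qed.

Let cylinderT J : cylinder J setT.
Proof.
exists fset0, (fun=> setT); split => //.
by apply/seteqP; split => // x _ i /=.
Qed.

Let cylinderI J : setI_closed (cylinder J).
Proof.
move=> _ _ [D [B [DJ mB ->]]] [D' [B' [DJ' mB' ->]]].
exists (D `|` D')%fset,
  (fun i => (if i \in D then B i else setT) `&` (if i \in D' then B' i else setT)).
split.
- move=> i /=; rewrite in_fsetU => /orP[]; [exact: DJ|exact: DJ'].
- by move=> i; apply: measurableI; case: ifP.
- apply/seteqP; split => x /=.
    move=> [h h'] i /= _; split; case: ifP => // iD; [exact: h|exact: h'].
  move=> h; split => i /= iD.
    have /= := h i; rewrite in_fsetU iD => /(_ isT)[].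
    by [].
  have /= := h i; rewrite in_fsetU iD orbT => /(_ isT)[_].
  by [].
Qed.

Let cylinder_independent J K E F : J `&` K = set0 ->
  cylinder J E -> cylinder K F -> P (E `&` F) = (P E * P F)%E.
Proof.
move=> JK [D [B [DJ mB ->]]] [D' [B' [DJ' mB' ->]]].
have dDD' i : i \in D -> i \in D' -> False.
  move=> iD iD'; have : (J `&` K) i by split; [exact: DJ|exact: DJ'].
  by rewrite JK.
(* Since [D] and [D'] are disjoint, one family of sets describes both cylinders, and independence
   applies to the union of the index sets. *)
pose B'' i := if i \in D then B i else B' i.
have mB'' i : measurable (B'' i) by rewrite /B''; case: ifP.
have eD : \bigcap_(i in [set` D]) (X i @^-1` B i) =
    \bigcap_(i in [set` D]) (X i @^-1` B'' i).
  by apply: eq_bigcapr => i /= iD; rewrite /B'' iD.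
have eD' : \bigcap_(i in [set` D']) (X i @^-1` B' i) =
    \bigcap_(i in [set` D']) (X i @^-1` B'' i).
  apply: eq_bigcapr => i /= iD'; rewrite /B''.
  by case: ifP => // /dDD'/(_ iD').
rewrite eD eD'.
have -> : \bigcap_(i in [set` D]) (X i @^-1` B'' i) `&`
    \bigcap_(i in [set` D']) (X i @^-1` B'' i) =
    \bigcap_(i in [set` (D `|` D')%fset]) (X i @^-1` B'' i).
  apply/seteqP; split => x /=.
    move=> [h h'] i /=; rewrite in_fsetU => /orP[iD|iD']; [exact: h|exact: h'].
  by move=> h; split => i /= iD; apply: h; rewrite /= in_fsetU iD ?orbT.
rewrite !indX//.
rewrite (big_fsetID _ (mem D)).
congr (_ * _)%E; apply: eq_fbigl => i; rewrite !inE/=.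
  by case: (i \in D) => //=; rewrite andbF.
case iD: (i \in D) => //=; rewrite ?andbT ?andbF//.
by apply/esym/negP => /dDD'; rewrite iD; exact.
Qed.

Let events_in_cylinder J : events_in J `<=` cylinder J.
Proof.
move=> _ [i [B [Ji mB ->]]]; exists [fset i]%fset, (fun=> B); split => //.
  by move=> j /=; rewrite inE => /eqP ->.
apply/seteqP; split => x /=.
  by move=> h j /=; rewrite inE => /eqP ->.
by apply; rewrite /= inE.
Qed.

Lemma independent_sigma_algebras J K E F : J `&` K = set0 ->
  <<s events_in J >> E -> <<s events_in K >> F ->
  P (E `&` F) = (P E * P F)%E.
Proof.
move=> JK sE sF.
have {}sE := sub_sigma_algebra2 (@events_in_cylinder J) sE.
have {}sF := sub_sigma_algebra2 (@events_in_cylinder K) sF.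
have mE : measurable E.
  by apply: (smallest_sub _ (@cylinder_measurable J)) sE;
    exact: sigma_algebra_measurable.
have mF : measurable F.
  by apply: (smallest_sub _ (@cylinder_measurable K)) sF;
    exact: sigma_algebra_measurable.
apply: (g_sigma_algebra_independent (@cylinder_measurable J) (@cylinderI J)
  (@cylinderT J) mF _ sE) => E' cE'.
rewrite setIC muleC.
apply: (g_sigma_algebra_independent (@cylinder_measurable K) (@cylinderI K)
  (@cylinderT K) (cylinder_measurable cE') _ sF) => F' cF'.
by rewrite setIC muleC; exact: cylinder_independent JK cE' cF'.
Qed.

Lemma sigma_events_in_measurable J : <<s events_in J >> `<=` measurable.
Proof.
apply: (smallest_sub _ (@events_in_measurable J)).
exact: sigma_algebra_measurable.
Qed.

Lemma measurable_fun_events_in J i : J i ->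
  measurable_fun [set: g_sigma_algebraType (events_in J)] (X i).
Proof.
move=> Ji _ B mB; rewrite setTI; apply: sub_sigma_algebra.
by exists i, B.
Qed.

Lemma measurable_fun_of_events_in d2 (T2 : measurableType d2) J (U : T -> T2) :
  measurable_fun [set: g_sigma_algebraType (events_in J)] U ->
  measurable_fun [set: T] U.
Proof.
by move=> mU _ B mB; apply: (@sigma_events_in_measurable J); exact: mU.
Qed.

Lemma independent_functions d1 d2 (T1 : measurableType d1)
    (T2 : measurableType d2) J K (U : T -> T1) (V : T -> T2) :
  J `&` K = set0 ->
  measurable_fun [set: g_sigma_algebraType (events_in J)] U ->
  measurable_fun [set: g_sigma_algebraType (events_in K)] V ->
  forall A B, measurable A -> measurable B ->
    P (U @^-1` A `&` V @^-1` B) = (P (U @^-1` A) * P (V @^-1` B))%E.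
Proof.
move=> JK mU mV A B mA mB; apply: independent_sigma_algebras JK _ _.
  by have := mU measurableT A mA; rewrite setTI.
by have := mV measurableT B mB; rewrite setTI.
Qed.

End independent_sigma_algebras.

(** * Recurrence from a divergent series *)

Section countable_conditioning.
Context d (T : measurableType d) (R : realType) (P : probability T R).

(** A proportionality known on atoms extends to every [B] by countable additivity. It is applied
    with [S] a type of finite paths, so that the Markov property need only be checked path by
    path. *)
Lemma eq_prob_countable (S : countType) (W W' : T -> S) (D D' : set T)
    (c : R) : 0 <= c -> measurable D -> measurable D' ->
  (forall s, measurable (W @^-1` [set s])) ->
  (forall s, measurable (W' @^-1` [set s])) ->
  (forall s, P (D `&` W @^-1` [set s]) = (c%:E * P (D' `&` W' @^-1` [set s]))%E) ->
  forall B, P (D `&` W @^-1` B) = (c%:E * P (D' `&` W' @^-1` B))%E.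
Proof.
move=> c0 mD mD' mW mW' WW' B.
pose F (V : T -> S) k := V @^-1` (B `&` [set s | choice.pickle s = k]).
have mF V : (forall s, measurable (V @^-1` [set s])) ->
    forall k, measurable (F V k).
  move=> mV k; have [[s [Bs sk]]|no] := pselect (exists s, B s /\ choice.pickle s = k).
    rewrite (_ : F V k = V @^-1` [set s])//.
    apply/seteqP; split => t /=; rewrite /F/=.
      by move=> [_ h]; apply: (@pcan_inj _ _ _ _ (@choice.pickleK S)); rewrite h sk.
    by move=> ->.
  rewrite (_ : F V k = set0)//.
  by apply/seteqP; split => t //= [h1 h2]; case: no; exists (V t).
have FE V : V @^-1` B = \bigcup_k F V k.
  apply/seteqP; split => t /=; first by move=> Bt; exists (choice.pickle (V t)).
  by move=> [k _ []].
have tF V D1 : trivIset setT (fun k => D1 `&` F V k).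
  by move=> i j _ _ [t [[_ [_ /= <-]] [_ [_ /= <-]]]].
have main V D1 : measurable D1 -> (forall s, measurable (V @^-1` [set s])) ->
    P (D1 `&` V @^-1` B) = (\sum_(0 <= k <oo) P (D1 `&` F V k))%E.
  move=> mD1 mV; rewrite FE setI_bigcupr measure_bigcup//.
    by apply: eq_eseriesl => k; rewrite in_setT.
  by move=> k _; apply: measurableI => //; exact: mF.
rewrite !main// -nneseriesZl//; apply: eq_eseriesr => k _.
have [[s [Bs sk]]|no] := pselect (exists s, B s /\ choice.pickle s = k).
  have E V : F V k = V @^-1` [set s].
    apply/seteqP; split => t /=; rewrite /F/=.
      by move=> [_ h]; apply: (@pcan_inj _ _ _ _ (@choice.pickleK S)); rewrite h sk.
    by move=> ->.
  by rewrite !E.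
have E V : F V k = set0.
  by apply/seteqP; split => t //= [h1 h2]; case: no; exists (V t).
by rewrite !E !setI0 measure0 mule0.
Qed.

Lemma measurable_path (S : Type) (X : nat -> T -> S) (s : seq S) (r : seq nat) :
  (forall n x, measurable (X n @^-1` [set x])) ->
  measurable [set t | [seq X j t | j <- r] = s].
Proof.
move=> mX; elim: r s => [|j r IH] [|x s] /=.
- by rewrite (_ : mkset _ = setT)//; apply/seteqP; split.
- by rewrite (_ : mkset _ = set0)//; apply/seteqP; split.
- by rewrite (_ : mkset _ = set0)//; apply/seteqP; split.
- rewrite (_ : mkset _ =
    X j @^-1` [set x] `&` [set t | [seq X i t | i <- r] = s]).
    exact: measurableI.
  by apply/seteqP; split => t /= [-> ->].
Qed.

(** The Markov property in product form: it makes sense for histories of probability zero too, and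
    it covers both coordinates of the process. *)
Definition path_law (X : nat -> T -> int) (p : int -> int -> R) :=
  P [set t | X 0%N t = 0] = 1%E /\
  forall n x, P (history X n.+1 x) =
    (P (history X n x) * (p (x n) (x n.+1))%:E)%E.

Section path_law_shift.
Variables (X : nat -> T -> int) (p : int -> int -> R).
Hypothesis mX : forall n, measurable_fun [set: T] (X n).
Hypothesis p_ge0 : forall x y, 0 <= p x y.
Hypothesis Xp : path_law X p.

Lemma measurable_fiber n x : measurable (X n @^-1` [set x]).
Proof. by rewrite -[X in measurable X]setTI; exact: mX. Qed.

Lemma measurable_history n x : measurable (history X n x).
Proof.
rewrite (_ : history X n x =
  [set t | [seq X j t | j <- iota 0 n.+1] = [seq x j | j <- iota 0 n.+1]]).
  by apply: measurable_path; exact: measurable_fiber.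
apply/seteqP; split => t; rewrite [X in _ -> X]/mkset.
  by move=> h; apply/eq_in_map => j; rewrite mem_iota => /andP[_ jn]; exact: h.
move=> h i iln; move/eq_in_map: h; apply.
by rewrite mem_iota.
Qed.

Lemma path_law_history n m x :
  P (history X (n + m) x) =
  (P (history X n x) * (\prod_(j < m) p (x (n + j)%N) (x (n + j).+1))%:E)%E.
Proof.
elim: m => [|m IH]; first by rewrite addn0 big_ord0 mule1.
by rewrite addnS Xp.2 IH big_ord_recr/= EFinM muleA.
Qed.

Lemma measurable_shifted_history n m x :
  measurable [set t | forall j, (j <= m)%N -> X (n + j)%N t = x j].
Proof.
rewrite (_ : mkset _ = \bigcap_(j in [set j | (j <= m)%N]) X (n + j)%N @^-1` [set x j]).
  by apply: bigcap_measurableType => j _; exact: measurable_fiber.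
by apply/seteqP; split => t /=.
Qed.

(* Summing over the possible values of the first [n] positions. *)
Lemma path_law_shift n m x :
  P [set t | forall j, (j <= m)%N -> X (n + j)%N t = x j] =
  (P [set t | X n t = x 0%N] * (\prod_(j < m) p (x j) (x j.+1))%:E)%E.
Proof.
rewrite muleC.
pose W t := [seq X j t | j <- iota 0 n].
pose D := [set t | forall j, (j <= m)%N -> X (n + j)%N t = x j].
pose D' := [set t | X n t = x 0%N].
rewrite -[mkset _](setIT D) -[X in (_ * P X)%E](setIT D').
rewrite -(preimage_setT W); apply: eq_prob_countable => //.
- exact: prodr_ge0.
- exact: measurable_shifted_history.
- exact: measurable_fiber.
- by move=> s; apply: measurable_path; exact: measurable_fiber.
- by move=> s; apply: measurable_path; exact: measurable_fiber.
move=> s; have [sn|sn] := eqVneq (size s) n; last first.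
  have E : W @^-1` [set s] = set0.
    apply/seteqP; split => t //= h; move: sn; rewrite -h size_map size_iota.
    by rewrite eqxx.
  by rewrite E !setI0 measure0 mule0.
(* The past [s] followed by the future [x], read as one trajectory from time 0. *)
pose y i := if (i < n)%N then nth 0 s i else x (i - n)%N.
have WE t : W t = s <-> forall i, (i < n)%N -> X i t = y i.
  split => [h i iln|h].
    rewrite /y iln -h (nth_map 0%N) ?size_iota// nth_iota//.
  apply: (@eq_from_nth _ 0); first by rewrite size_map size_iota sn.
  move=> i; rewrite size_map size_iota => iln.
  by rewrite (nth_map 0%N) ?size_iota// nth_iota// h// /y iln.
have -> : D `&` W @^-1` [set s] = history X (n + m) y.
  apply/seteqP; split => t /=.
    move=> [h /WE h'] i inm; have [iln|nli] := ltnP i n; first exact: h'.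
    rewrite -{1}(subnKC nli) h; first by rewrite /y ltnNge nli.
    by rewrite leq_subLR.
  move=> h; split => [j jm|].
    rewrite h ?leq_add2l// /y ltnNge leq_addr/=; congr x; lia.
  by apply/WE => i iln; apply: h; lia.
have -> : D' `&` W @^-1` [set s] = history X n y.
  apply/seteqP; split => t /=.
    move=> [h /WE h'] i; rewrite leq_eqVlt => /predU1P[->|]; last exact: h'.
    by rewrite h /y ltnn subnn.
  move=> h; split; first by rewrite /D' /= h// /y ltnn subnn.
  by apply/WE => i iln; apply: h; lia.
rewrite path_law_history muleC; congr (_%:E * _)%E.
apply: eq_bigr => j _; rewrite /y !ltnNge leq_addr leqW ?leq_addr//=.
by congr (p (x _) (x _)); lia.
Qed.

Lemma path_law_step n x y :
  P [set t | X n t = x /\ X n.+1 t = y] = (P [set t | X n t = x] * (p x y)%:E)%E.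
Proof.
have := path_law_shift n 1 (fun j => if j is 0%N then x else y).
rewrite big_ord1/= => <-; congr (P _); apply/seteqP; split => t /=.
  by move=> [h h'] [|[|]]//; rewrite ?addn0 ?addn1.
by move=> h; have := h 0%N; have := h 1%N; rewrite addn0 addn1; auto.
Qed.

End path_law_shift.
End countable_conditioning.

(** * Renewal argument at the origin *)

Section recurrence_criterion.
Context d (T : measurableType d) (R : realType) (P : probability T R).
Variables (X Y : nat -> T -> int) (p q : int -> int -> R).
Hypothesis mX : forall n, measurable_fun [set: T] (X n).
Hypothesis mY : forall n, measurable_fun [set: T] (Y n).
Hypothesis p_ge0 : forall x y, 0 <= p x y.
Hypothesis q_ge0 : forall x y, 0 <= q x y.
Hypothesis Xp : path_law P X p.
Hypothesis Yq : path_law P Y q.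
Hypothesis XY : independent_processes P X Y.

Let process_event (Z : nat -> T -> int) n m x :
  process_sigma_algebra Z [set t | forall j, (j <= m)%N -> Z (n + j)%N t = x j].
Proof.
rewrite (_ : mkset _ = \bigcap_(j in [set j | (j <= m)%N]) Z (n + j)%N @^-1` [set x j]).
  apply: (@bigcap_measurableType _ (g_sigma_algebraType
    [set E | exists n (B : set int), measurable B /\ E = Z n @^-1` B])) => j _.
  by apply: sub_sigma_algebra; exists (n + j)%N, [set x j].
by apply/seteqP; split => t /=.
Qed.

Let mfib (Z : nat -> T -> int) n x : (forall n, measurable_fun [set: T] (Z n)) ->
  measurable [set t : T | Z n t = x].
Proof. by move=> mZ; exact: measurable_fiber. Qed.

Let at0 n := [set t | X n t = 0] `&` [set t | Y n t = 0].
Let no_return n m :=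
  [set t | forall j, (0 < j <= m)%N -> (X (n + j)%N t, Y (n + j)%N t) <> (0, 0)].

Let measurable_at0 n : measurable (at0 n).
Proof. by apply: measurableI; exact: mfib. Qed.

Let measurable_no_return n m : measurable (no_return n m).
Proof.
rewrite (_ : no_return n m =
    \bigcap_(j in [set j | (0 < j <= m)%N]) ~` at0 (n + j)%N).
  by apply: bigcap_measurableType => j _; exact: measurableC.
apply/seteqP; split => t /= h j jm; have := h j jm => /= {}h h'; apply: h.
  by case: h' => /= -> ->.
by case: h' => h1 h2; split.
Qed.

Let prob_at0 n : P (at0 n) = (P [set t | X n t = 0%R] * P [set t | Y n t = 0%R])%E.
Proof.
have pe (Z : nat -> T -> int) : [set t | forall j, (j <= 0)%N -> Z (n + j)%N t = 0] =
    [set t | Z n t = 0].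
  apply/seteqP; split => t /=; first by move/(_ 0%N isT); rewrite addn0.
  by move=> h j; rewrite leqn0 => /eqP ->; rewrite addn0.
rewrite /at0 -(pe X) -(pe Y); apply: XY.
  exact: (@process_event X n 0%N (fun=> 0)).
exact: (@process_event Y n 0%N (fun=> 0)).
Qed.

(** Markov property of the pair at a visit to the origin. It is obtained without a kernel for the
    pair: independence factors the probability of each finite trajectory into two path laws, and the
    transition factors are the same at times [n] and 0. *)
Lemma prob_no_return n m :
  P (at0 n `&` no_return n m) = ((fine (P (at0 n)))%:E * P (no_return 0 m))%E.
Proof.
pose W k t := [seq (X j t, Y j t) | j <- iota k m.+1].
pose B : set (seq (int * int)) :=
  [set s | forall j, (0 < j <= m)%N -> nth (0, 0) s j <> (0, 0)].
have WB k : no_return k m = W k @^-1` B.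
  have nthW t j : (j <= m)%N ->
      nth (0, 0) (W k t) j = (X (k + j)%N t, Y (k + j)%N t).
    by move=> jm; rewrite (nth_map 0%N) ?size_iota// nth_iota.
  by apply/seteqP; split => t /= h j jm; have := h j jm; rewrite nthW//; lia.
have mW k s : measurable (W k @^-1` [set s]).
  apply: (measurable_path (X := fun j t => (X j t, Y j t))) => j [x y].
  rewrite (_ : _ @^-1` _ = [set t | X j t = x] `&` [set t | Y j t = y]).
    by apply: measurableI; exact: mfib.
  by apply/seteqP; split => t /=; [case=> -> -> |case=> /= -> ->].
rewrite !WB -[X in (_ * P X)%E](setTI (W 0%N @^-1` B)).
apply: eq_prob_countable => // [|s]; first exact: fine_prob_ge0.
have [sm|sm] := eqVneq (size s) m.+1; last first.
  have E k : W k @^-1` [set s] = set0.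
    apply/seteqP; split => t //= h; move: sm; rewrite -h size_map size_iota.
    by rewrite eqxx.
  by rewrite !E !setI0 measure0 mule0.
pose x j := (nth (0, 0) s j).1; pose y j := (nth (0, 0) s j).2.
have WE k : W k @^-1` [set s] =
    [set t | forall j, (j <= m)%N -> X (k + j)%N t = x j] `&`
    [set t | forall j, (j <= m)%N -> Y (k + j)%N t = y j].
  apply/seteqP; split => t /=.
    move=> h; split => j jm; rewrite /x /y -h (nth_map 0%N) ?size_iota//;
      by rewrite nth_iota.
  move=> [h h']; apply: (@eq_from_nth _ (0, 0)).
    by rewrite size_map size_iota.
  move=> j; rewrite size_map size_iota => jm.
  rewrite (nth_map 0%N) ?size_iota// nth_iota// h// h'//.
  by rewrite /x /y -surjective_pairing.
have P_WE k : P (W k @^-1` [set s]) =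
    (P [set t | X k t = x 0%N] * P [set t | Y k t = y 0%N] *
     ((\prod_(j < m) p (x j) (x j.+1)) * \prod_(j < m) q (y j) (y j.+1))%:E)%E.
  rewrite WE XY; [|exact: process_event|exact: process_event].
  by rewrite (path_law_shift mX p_ge0 Xp) (path_law_shift mY q_ge0 Yq) EFinM muleACA.
have null (Z : nat -> T -> int) r z : (forall n, measurable_fun [set: T] (Z n)) ->
    path_law P Z r -> z != 0 -> P [set t | Z 0%N t = z] = 0%E.
  move=> mZ Zr z0; apply/eqP; rewrite eq_le measure_ge0 andbT.
  rewrite -(prob1_setC (mfib 0 0 mZ) Zr.1); apply: le_measure; rewrite ?inE.
  - exact: mfib.
  - by apply: measurableC; exact: mfib.
  - by move=> t /= h h'; move: z0; rewrite -h h' eqxx.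
(* Trajectories that do not begin at the origin contribute 0 on both sides. *)
have [xy0|xy0] := boolP ((x 0%N == 0) && (y 0%N == 0)); last first.
  rewrite setTI P_WE.
  have -> : (P [set t | X 0%N t = x 0%N] * P [set t | Y 0%N t = y 0%N] = 0)%E.
    move: xy0; rewrite negb_and => /orP[h|h].
      by rewrite (null X p)// mul0e.
    by rewrite (null Y q)// mule0.
  rewrite mul0e mule0 (_ : _ `&` _ = set0) ?measure0//.
  rewrite WE; apply/seteqP; split => t // -[[/= h1 h2] [/= /(_ 0%N isT) h3 /(_ 0%N isT) h4]].
  by move: xy0; rewrite -h3 -h4 addn0 h1 h2 eqxx.
move: xy0 => /andP[/eqP x0 /eqP y0].
rewrite setTI (setIidr _); last first.
  move=> t; rewrite WE => -[/= /(_ 0%N isT) h3 /(_ 0%N isT) h4].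
  by split => /=; [rewrite -x0 -h3 addn0|rewrite -y0 -h4 addn0].
rewrite !P_WE x0 y0 Xp.1 Yq.1 !mul1e.
by rewrite -prob_at0 fineK_prob.
Qed.

(* At each time at most one of the events "at the origin at time [n], no return
   during the following [M] steps", [n < M], occurs. *)
Lemma no_return_le (M : nat) :
  (\sum_(n < M) fine (P (at0 n))) * fine (P (no_return 0 M)) <= 1.
Proof.
rewrite big_distrl/= -lee_fin -sumEFin.
rewrite (eq_bigr (fun n : 'I_M => P (at0 n `&` no_return n M))); last first.
  by move=> n _; rewrite prob_no_return EFinM fineK_prob// (fineK_prob P (measurable_no_return 0 M)).
rewrite -(@measure_bigsetU_ord _ _ _ P M xpredT
  (fun n => at0 n `&` no_return n M)).
- by apply: probability_le1; apply: bigsetU_measurable => n _; exact: measurableI.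
- by move=> n; exact: measurableI.
have tF (i j : 'I_M) t : (i < j)%N -> no_return i M t -> at0 j t -> False.
  move=> ij h [/= hX hY]; apply: (h (j - i)%N).
    by have := ltn_ord j; lia.
  by rewrite subnKC ?(ltnW ij)// hX hY.
move=> i j _ _ [t [[h1 h2] [h3 h4]]]; apply/val_inj/eqP.
by case: ltngtP => // ij; [case: (tF _ _ _ ij h2 h3)|case: (tF _ _ _ ij h4 h1)].
Qed.

Lemma recurrent_of_divergent_series :
  (forall M : R, exists N : nat,
    M <= \sum_(n < N) fine (P [set t | X n t = 0]) * fine (P [set t | Y n t = 0])) ->
  recurrent P X Y.
Proof.
move=> div.
(* [E n]: the last visit to the origin is at time [n]. Its probability is at most that of no return
   within [N] steps, for every [N]. *)
pose E n := \bigcap_m (at0 n `&` no_return n m).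
have mE n : measurable (E n).
  by apply: bigcapT_measurable => m; exact: measurableI.
have PE n : P (E n) = 0%E.
  rewrite -fineK_prob//; congr (_%:E); apply/eqP; rewrite eq_le fine_prob_ge0 andbT.
  rewrite leNgt; apply/negP => e0.
  (* An expected number of visits this large would make the left side of [no_return_le] at least
     2. *)
  have [N hN] := div (2 / fine (P (E n))).
  have leE : fine (P (E n)) <= fine (P (no_return 0 N)).
    apply: (@le_trans _ _ (fine (P (at0 n `&` no_return n N)))).
      apply: le_fine_prob => //; first exact: measurableI.
      by move=> t; exact.
    rewrite prob_no_return fineM//; last exact: fin_prob.
    by rewrite /= ler_piMl ?fine_prob_ge0 ?fine_prob_le1.
  have := no_return_le N.
  have at0E k : fine (P (at0 k)) =
      fine (P [set t | X k t = 0]) * fine (P [set t | Y k t = 0]).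
    by rewrite prob_at0 fineM//; apply: fin_prob; exact: mfib.
  under eq_bigr do rewrite at0E.
  move=> le1; have : 2 / fine (P (E n)) * fine (P (E n)) <= 1.
    by apply: le_trans le1; apply: ler_pM => //; rewrite ?divr_ge0// ltW.
  by rewrite divfK ?gt_eqF//; lra.
have mat0 := measurable_at0 0.
have nat0 : P (~` at0 0) = 0%E.
  by apply: prob1_setC => //; rewrite prob_at0 Xp.1 Yq.1 mule1.
(* The origin is visited at time 0 almost surely, so a trajectory with finitely many visits has a
   last one. *)
apply: (@negligibleS _ _ _ _ (~` at0 0 `|` \bigcup_n E n)); last first.
  apply: negligibleU; first by apply/negligibleP => //; exact: measurableC.
  by apply: negligible_bigcup => n; exact: ((negligibleP P (mE n)).2 (PE n)).
move=> t /= h; have [t0|] := pselect (at0 0 t); last by left.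
right.
have [N hN] : exists N, forall n, (N < n)%N -> ~ at0 n t.
  apply: contrapT => h2; apply: h => N; apply: contrapT => h3.
  apply: h2; exists N => n Nn [/= a b]; apply: h3; exists n.
  by rewrite a b.
have [k tk hk] : exists2 k, at0 k t & forall n, (k < n)%N -> ~ at0 n t.
  elim: N hN => [|N IH] hN; first by exists 0%N.
  have [?|nt] := pselect (at0 N.+1 t); first by exists N.+1.
  apply: IH => n; rewrite leq_eqVlt => /predU1P[<-//|]; exact: hN.
exists k => // m _; split => // j /andP[j0 _] [a b].
by apply: (hk (k + j)%N); [lia|split].
Qed.

End recurrence_criterion.

(** * Reversible walks killed outside a valley *)

Section killed_walk.
Context (R : realType).
Variables (e c : int -> R) (I : seq int).
Hypothesis e01 : forall x, 0 < e x < 1.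
Hypothesis c_gt0 : forall x, 0 < c x.
Hypothesis ec : forall x, e x * c (x - 1) = (1 - e x) * c x.
Hypothesis uniqI : uniq I.

(* [c x] is the conductance of the edge {x, x + 1}. *)
Definition vertex_weight x := c x + c (x - 1).

Lemma vertex_weight_gt0 x : 0 < vertex_weight x.
Proof. by rewrite addr_gt0. Qed.

Lemma vertex_weight_right x : vertex_weight x * e x = c x.
Proof. by rewrite mulrDl (mulrC (c (x - 1))) ec; ring. Qed.

Lemma vertex_weight_left x : vertex_weight x * (1 - e x) = c (x - 1).
Proof. by rewrite mulrBr mulr1 vertex_weight_right /vertex_weight; ring. Qed.

(** Transition kernel of the walk killed on leaving [I]. Being a finite recursion it obeys algebraic
    identities over [I], and it bounds the transition probabilities of the walk from below. *)
Fixpoint killed n (x y : int) : R :=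
  if x \in I then
    if n is n'.+1 then e x * killed n' (x + 1) y + (1 - e x) * killed n' (x - 1) y
    else (x == y)%:R
  else 0.

Lemma killed_out n x y : x \notin I -> killed n x y = 0.
Proof. by case: n => [|n] /= /negbTE ->. Qed.

Lemma killed_ge0 n x y : 0 <= killed n x y.
Proof.
elim: n x => [|n IH] x /=; case: ifP => // _.
have /andP[e0 e1] := e01 x.
by rewrite addr_ge0// mulr_ge0// ?subr_ge0 ltW.
Qed.

Lemma killed_add n m x y :
  killed (n + m) x y = \sum_(z <- I) killed n x z * killed m z y.
Proof.
elim: n x => [|n IH] x; rewrite [in LHS]/=; under eq_bigr do rewrite /=;
  have [xI|xI] := boolP (x \in I).
- rewrite (bigD1_seq x)//= eqxx mul1r big1 ?addr0// => z zx.
  by rewrite eq_sym (negbTE zx) mul0r.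
- by rewrite killed_out// big1// => z _; rewrite mul0r.
- rewrite !IH !mulr_sumr -big_split/=; apply: eq_bigr => z _.
  by ring.
- by rewrite big1// => z _; rewrite mul0r.
Qed.

Lemma killed1 x y : killed 1 x y = if (x \in I) && (y \in I) then
  e x * (x + 1 == y)%:R + (1 - e x) * (x - 1 == y)%:R else 0.
Proof.
have H z : killed 0 z y = if y \in I then (z == y)%:R else 0.
  by rewrite /=; have [->|] := eqVneq z y; rewrite ?if_same.
rewrite -[LHS]/(if x \in I then
  e x * killed 0 (x + 1) y + (1 - e x) * killed 0 (x - 1) y else 0) !H.
by case: (x \in I) => //; case: (y \in I); rewrite ?mulr0 ?addr0.
Qed.

Lemma killed1_reversible x y :
  vertex_weight x * killed 1 x y = vertex_weight y * killed 1 y x.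
Proof.
rewrite !killed1 andbC; case: ifP => _; last by rewrite !mulr0.
rewrite !mulrDr !mulrA !vertex_weight_right !vertex_weight_left.
have [<-|h1] := eqVneq (x + 1) y.
  rewrite (_ : (x + 1 + 1 == x) = false); last by apply/negP => /eqP; lia.
  rewrite (_ : (x - 1 == x + 1) = false); last by apply/negP => /eqP; lia.
  by rewrite addrK eqxx (_ : true%:R = 1 :> R)// (_ : false%:R = 0 :> R)//; ring.
have [<-|h2] := eqVneq (x - 1) y.
  rewrite (_ : (x - 1 - 1 == x) = false); last by apply/negP => /eqP; lia.
  by rewrite subrK eqxx (_ : true%:R = 1 :> R)// (_ : false%:R = 0 :> R)//; ring.
rewrite (_ : (y + 1 == x) = false); last by apply/negP => /eqP h; move/eqP: h2; lia.
rewrite (_ : (y - 1 == x) = false); last by apply/negP => /eqP h; move/eqP: h1; lia.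
by rewrite (_ : false%:R = 0 :> R)//; ring.
Qed.

Lemma killed_reversible n x y :
  vertex_weight x * killed n x y = vertex_weight y * killed n y x.
Proof.
elim: n x y => [|n IH] x y.
  rewrite /= (eq_sym y); have [<-//|xy] := eqVneq x y.
  by rewrite !if_same !mulr0.
(* The single step is split off in front on the left and at the end on the right; reversing it and
   then the other [n] steps matches the terms. *)
rewrite -[in LHS]add1n -[in RHS]addn1 !killed_add !mulr_sumr; apply: eq_bigr => z _.
by rewrite mulrA killed1_reversible mulrAC IH mulrAC -mulrA mulrC; ring.
Qed.

(* Cauchy-Schwarz, written as the nonnegativity of the weighted variance of
   [killed n x z / vertex_weight z]. *)
Lemma killed_return n x : x \in I ->
  vertex_weight x * (\sum_(z <- I) killed n x z) ^+ 2 / (\sum_(z <- I) vertex_weight z)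
  <= killed (n + n) x x.
Proof.
move=> xI.
set S := \sum_(z <- I) killed n x z; set W := \sum_(z <- I) vertex_weight z.
have W0 : 0 < W.
  rewrite /W (bigD1_seq x)//= ltr_pwDl ?vertex_weight_gt0//.
  by apply: sumr_ge0 => z _; exact/ltW/vertex_weight_gt0.
have -> : killed (n + n) x x =
    vertex_weight x * \sum_(z <- I) killed n x z ^+ 2 / vertex_weight z.
  rewrite killed_add mulr_sumr; apply: eq_bigr => z _.
  have wz : vertex_weight z != 0 by rewrite gt_eqF// vertex_weight_gt0.
  apply: (mulfI wz).
  by rewrite mulrCA killed_reversible; field.
rewrite -mulrA ler_pM2l ?vertex_weight_gt0//.
have : 0 <= \sum_(z <- I) vertex_weight z * (killed n x z / vertex_weight z - S / W) ^+ 2.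
  by apply: sumr_ge0 => z _; rewrite mulr_ge0 ?sqr_ge0// ltW// vertex_weight_gt0.
have -> : \sum_(z <- I) vertex_weight z * (killed n x z / vertex_weight z - S / W) ^+ 2 =
    \sum_(z <- I) (killed n x z ^+ 2 / vertex_weight z +
      (- (2 * (S / W)) * killed n x z + (S / W) ^+ 2 * vertex_weight z)).
  apply: eq_bigr => z _.
  by have wz : vertex_weight z != 0 by [rewrite gt_eqF// vertex_weight_gt0]; field;
    rewrite wz gt_eqF.
rewrite big_split/= big_split/= -!mulr_sumr -/S -/W.
rewrite (_ : - (2 * (S / W)) * S + (S / W) ^+ 2 * W = - (S ^+ 2 / W)).
  by rewrite subr_ge0.
by field; rewrite gt_eqF.
Qed.

(** Supermartingale bound: the mean of [u] grows by at most [delta] per step and [u] is at least 1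
    outside [I], so the exit probability within [n] steps is at most [u x + n%:R * delta]. *)
Lemma killed_survival (u : int -> R) (delta : R) :
  (forall x, 0 <= u x) -> (forall x, x \notin I -> 1 <= u x) -> 0 <= delta ->
  (forall x, e x * u (x + 1) + (1 - e x) * u (x - 1) <= u x + delta) ->
  forall n x, 1 - u x - n%:R * delta <= \sum_(z <- I) killed n x z.
Proof.
move=> u0 u1 d0 hu; elim=> [|n IH] x.
  rewrite mul0r subr0; have [xI|xI] := boolP (x \in I).
    rewrite (bigD1_seq x)//= xI eqxx.
    rewrite -[leRHS]addr0 lerBlDr addr0 -addrA lerDl addr_ge0//; exact: sumr_ge0.
  rewrite big1 ?subr_le0 ?u1// => z _; exact: (@killed_out 0).
have [xI|xI] := boolP (x \in I); last first.
  rewrite big1; last by move=> z _; exact: killed_out.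
  have := u1 _ xI; have : 0 <= n.+1%:R * delta by rewrite mulr_ge0.
  lra.
have -> : \sum_(z <- I) killed n.+1 x z =
    e x * \sum_(z <- I) killed n (x + 1) z + (1 - e x) * \sum_(z <- I) killed n (x - 1) z.
  by rewrite !mulr_sumr -big_split/=; apply: eq_bigr => z _; rewrite xI.
have /andP[e0 e1] := e01 x.
have h1 := ler_wpM2l (ltW e0) (IH (x + 1)).
have e1' : 0 <= 1 - e x by rewrite subr_ge0 ltW.
have h2 := ler_wpM2l e1' (IH (x - 1)).
apply: le_trans (lerD h1 h2).
have := hu x; rewrite -[in n.+1%:R]addn1 natrD.
by set A := u (x + 1); set B := u (x - 1); nra.
Qed.

End killed_walk.

(** * Confinement between two barriers *)

Section valley.
Context (R : realType).
Variables (e c : int -> R) (a b : nat).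
Hypothesis e01 : forall x, 0 < e x < 1.
Hypothesis c_gt0 : forall x, 0 < c x.
Hypothesis ec : forall x, e x * c (x - 1) = (1 - e x) * c x.

(** The interval from [- a] to [b]; recall that [Negz i] is [- (i + 1)], so the left half starts at
    -1. *)
Definition valley : seq int :=
  [seq Posz i | i <- iota 0 b.+1] ++ [seq Negz i | i <- iota 0 a].

Lemma valley_uniq : uniq valley.
Proof.
rewrite cat_uniq !map_inj_uniq ?iota_uniq/= ?andbT; last 2 first.
- by move=> x y [].
- by move=> x y [].
by apply/hasPn => x /mapP[i _ ->]; apply/negP => /mapP[j].
Qed.

Lemma Posz_in_valley n : (Posz n \in valley) = (n <= b)%N.
Proof.
rewrite mem_cat mem_map; last by move=> x y [].
rewrite mem_iota/= add0n ltnS orbC.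
by case: mapP => // -[].
Qed.

Lemma Negz_in_valley n : (Negz n \in valley) = (n < a)%N.
Proof.
rewrite mem_cat (_ : Negz n \in map Posz _ = false); last first.
  by apply/negP => /mapP[j].
by rewrite mem_map ?mem_iota//; move=> x y [].
Qed.

Let Sb := \sum_(i < b.+1) (c (Posz i))^-1.
Let Sa := \sum_(i < a.+1) (c (Negz i))^-1.

Let Sb_ge : (c (Posz b))^-1 <= Sb.
Proof.
rewrite /Sb big_ord_recr/= lerDr; apply: sumr_ge0 => i _.
by rewrite invr_ge0 ltW.
Qed.

Let Sa_ge : (c (Negz a))^-1 <= Sa.
Proof.
rewrite /Sa big_ord_recr/= lerDr; apply: sumr_ge0 => i _.
by rewrite invr_ge0 ltW.
Qed.

Let Sb_gt0 : 0 < Sb.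
Proof. by apply: lt_le_trans Sb_ge; rewrite invr_gt0. Qed.

Let Sa_gt0 : 0 < Sa.
Proof. by apply: lt_le_trans Sa_ge; rewrite invr_gt0. Qed.

(* Normalized resistance between [0] and [x]: harmonic off [0], and at least
   [1] outside the valley. *)
Let u (x : int) : R := match x with
  | Posz n => (\sum_(i < n) (c (Posz i))^-1) / Sb
  | Negz n => (\sum_(i < n.+1) (c (Negz i))^-1) / Sa
  end.

Let u_ge0 x : 0 <= u x.
Proof.
by case: x => n; (apply: divr_ge0; last exact: ltW);
  apply: sumr_ge0 => i _; rewrite invr_ge0 ltW.
Qed.

Let sum_mono (f : nat -> R) n m : (forall i, 0 <= f i) -> (n <= m)%N ->
  \sum_(i < n) f i <= \sum_(i < m) f i.
Proof.
move=> f0 /subnK <-; rewrite addnC big_split_ord/= lerDl.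
by apply: sumr_ge0.
Qed.

Let u_ge1 x : x \notin valley -> 1 <= u x.
Proof.
have c'0 x' : 0 <= (c x')^-1 by rewrite invr_ge0 ltW.
case: x => n; rewrite ?Posz_in_valley ?Negz_in_valley -?ltnNge -?leqNgt => h.
  rewrite ler_pdivlMr// mul1r.
  exact: (@sum_mono (fun i => (c (Posz i))^-1)).
rewrite ler_pdivlMr// mul1r.
exact: (@sum_mono (fun i => (c (Negz i))^-1)).
Qed.

Let w0 := vertex_weight c 0.
(** Bound on the drift of [u] at 0, which equals [(Sb^-1 + Sa^-1) / w0]. Each total resistance is at
    least that of its last edge, the one through which the walk leaves the valley. *)
Let delta : R := (c (Posz b) + c (Negz a)) / w0.

Let delta_ge0 : 0 <= delta.
Proof. by rewrite divr_ge0 ?ltW ?addr_gt0// vertex_weight_gt0. Qed.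

Let ec' x : e x / c x = (1 - e x) / c (x - 1).
Proof.
have c1 : c x != 0 by rewrite gt_eqF.
have c2 : c (x - 1) != 0 by rewrite gt_eqF.
by apply/eqP; rewrite eqr_div// ec.
Qed.

Let u0 : u 0 = 0.
Proof.
have -> : u 0 = (\sum_(i < 0) (c (Posz i))^-1) / Sb by [].
by rewrite big_ord0 mul0r.
Qed.

Let u_harmonic x : e x * u (x + 1) + (1 - e x) * u (x - 1) <= u x + delta.
Proof.
case: x => [[|n]|n].
- have -> : u 0 = 0 by exact: u0.
  have -> : u (0 + 1) = (\sum_(i < 1) (c (Posz i))^-1) / Sb by [].
  have -> : u (0 - 1) = (\sum_(i < 1) (c (Negz i))^-1) / Sa by [].
  rewrite !big_ord1.
  rewrite add0r !mulrA ec' -mulrDr.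
  have -> : (1 - e 0) / c (0 - 1) = w0^-1.
    have w00 : w0 != 0 by rewrite gt_eqF// vertex_weight_gt0.
    apply: (mulfI w00); rewrite mulrA vertex_weight_left// !divff// gt_eqF//.
  rewrite /delta mulrC; apply: ler_wpM2r.
    by rewrite invr_ge0 ltW// vertex_weight_gt0.
  by apply: lerD; rewrite -[leRHS]invrK lef_pV2 ?posrE ?invr_gt0.
- rewrite -[leLHS]addr0 lerD// (_ : Posz n.+1 + 1 = Posz n.+2); last by lia.
  rewrite (_ : Posz n.+1 - 1 = Posz n); last by lia.
  rewrite /u !big_ord_recr/=.
  have := ec' (Posz n.+1); rewrite (_ : Posz n.+1 - 1 = Posz n); last by lia.
  set A := \sum_(i < n) _; set p := e _; set q := (c (Posz n))^-1; set r := (c _)^-1.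
  move=> h; rewrite !mulrA -mulrDl ler_wpM2r ?invr_ge0 ?(ltW Sb_gt0)//.
  have -> : p * (A + q + r) + (1 - p) * A = A + q + (p * r - (1 - p) * q) by ring.
  by rewrite h subrr addr0.
- rewrite -[leLHS]addr0 lerD// (_ : Negz n - 1 = Negz n.+1); last by lia.
  have := ec' (Negz n); rewrite (_ : Negz n - 1 = Negz n.+1); last by lia.
  have -> : u (Negz n + 1) = (\sum_(i < n) (c (Negz i))^-1) / Sa.
    case: n => [|n]; first by rewrite (_ : Negz 0 + 1 = 0)// /u !big_ord0 !mul0r.
    by rewrite (_ : Negz n.+1 + 1 = Negz n)//; lia.
  rewrite /u !big_ord_recr/=.
  set A := \sum_(i < n) _; set p := e _; set q := (c (Negz n))^-1; set r := (c _)^-1.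
  move=> h; rewrite !mulrA -mulrDl ler_wpM2r ?invr_ge0 ?(ltW Sa_gt0)//.
  have -> : p * A + (1 - p) * (A + q + r) = A + q + ((1 - p) * r - p * q) by ring.
  by rewrite h subrr addr0.
Qed.

(** The hypothesis gives an exit probability of at most 1/2 from 0 within [n] steps; the square of
    the survival probability in [killed_return] produces the factor 4. *)
Lemma valley_return n : n%:R * (c (Posz b) + c (Negz a)) <= w0 / 2 ->
  w0 / (4 * \sum_(z <- valley) vertex_weight c z) <= killed e valley (n + n) 0 0.
Proof.
move=> hn.
have w00 : 0 < w0 by exact: vertex_weight_gt0.
have v0 : 0 \in valley by rewrite Posz_in_valley.
have uniqv := valley_uniq.
apply: le_trans (killed_return c_gt0 ec uniqv n v0).
have W0 : 0 < \sum_(z <- valley) vertex_weight c z.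
  rewrite (bigD1_seq 0)//= ltr_pwDl ?vertex_weight_gt0//.
  by apply: sumr_ge0 => z _; exact/ltW/vertex_weight_gt0.
have := killed_survival e01 uniqv u_ge0 u_ge1 delta_ge0 u_harmonic n 0.
rewrite u0.
have : n%:R * delta <= 1 / 2.
  by rewrite /delta mulrA ler_pdivrMr// mulrC; lra.
set S := \sum_(z <- valley) killed _ _ _ _ _ => h1 h2.
have S2 : 1 / 4 <= S ^+ 2.
  by have : 1 / 2 <= S by [lra]; nra.
rewrite invfM mulrA -/w0; apply: ler_wpM2r; first by rewrite invr_ge0 ltW.
by apply: ler_wpM2l; [exact: ltW|lra].
Qed.

End valley.

(** * Comparison of the killed kernel with the quenched walk *)

Section walk_in_environment.
Context d (T : measurableType d) (R : realType) (P : probability T R).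
Variables (X : nat -> T -> int) (e : int -> R).
Hypothesis mX : forall n, measurable_fun [set: T] (X n).
Hypothesis e01 : forall x, 0 < e x < 1.

Lemma env_kernel_ge0 x y : 0 <= env_kernel e x y.
Proof.
have /andP[e0 e1] := e01 x.
by rewrite /env_kernel; case: ifP => _; [exact: ltW|case: ifP => // _; rewrite subr_ge0 ltW].
Qed.

Lemma walk_in_env_path_law : walk_in_env P X e -> path_law P X (env_kernel e).
Proof.
move=> [X0 Xn]; split=> // n x.
have mh m : measurable (history X m x) by exact: measurable_history.
have mf : measurable [set t | X n.+1 t = x n.+1] by exact: measurable_fiber.
have hE : history X n.+1 x = [set t | X n.+1 t = x n.+1] `&` history X n x.
  apply/seteqP; split => t /=.
    by move=> h; split; [exact: h|move=> i iln; apply: h; exact: leqW].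
  by move=> [h h'] i; rewrite leq_eqVlt => /predU1P[->//|]; exact: h'.
have [h0|h0] := ltP 0%E (P (history X n x)); last first.
  have P0 : P (history X n x) = 0%E by apply/eqP; rewrite eq_le h0 measure_ge0.
  rewrite P0 mul0e; apply/eqP; rewrite eq_le measure_ge0 andbT -P0 hE.
  by apply: le_measure; rewrite ?inE//; exact: measurableI.
rewrite -(Xn n x (x n.+1) h0) /cond_prob -hE.
rewrite -[in RHS](fineK_prob P (mh n)) -EFinM mulrCA divff ?mulr1 ?fineK_prob//.
by rewrite gt_eqF// fine_gt0// h0/= ltey_eq fin_prob.
Qed.

(** Induction on the last step, whereas [killed] recurses on the first one; [killed_add] makes the
    change. The arrivals at [y] from its two neighbours are disjoint events. *)
Lemma killed_le_prob (I : seq int) n y : uniq I -> path_law P X (env_kernel e) ->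
  killed e I n 0 y <= fine (P [set t | X n t = y]).
Proof.
move=> uI Xe.
have mf k z : measurable [set t | X k t = z] by exact: measurable_fiber.
elim: n y => [|n IH] y.
  rewrite /=; case: ifP => _; last exact: fine_prob_ge0.
  case: eqVneq => [<-|_]; last exact: fine_prob_ge0.
  by rewrite Xe.1.
rewrite -addn1 killed_add//.
have sum1 (g : int -> R) w : (forall z, 0 <= g z) ->
    \sum_(z <- I) g z * (z == w)%:R <= g w.
  move=> g0; have [wI|wI] := boolP (w \in I).
    rewrite (bigD1_seq w)//= eqxx mulr1 big1 ?addr0// => z /negbTE ->.
    by rewrite mulr0.
  rewrite big_seq big1 // => z zI; case: eqP => [zw|]; last by rewrite mulr0.
  by rewrite -zw zI in wI.
have e0 z : 0 <= e z by have /andP[/ltW] := e01 z.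
have e1 z : 0 <= 1 - e z by have /andP[_ /ltW] := e01 z; rewrite subr_ge0.
apply: (@le_trans _ _ (killed e I n 0 (y - 1) * e (y - 1) +
                       killed e I n 0 (y + 1) * (1 - e (y + 1)))).
  apply: le_trans (lerD (sum1 (fun z => killed e I n 0 z * e z) (y - 1) _)
    (sum1 (fun z => killed e I n 0 z * (1 - e z)) (y + 1) _)); last 2 first.
  - by move=> z; rewrite mulr_ge0// killed_ge0.
  - by move=> z; rewrite mulr_ge0// killed_ge0.
  rewrite -big_split/=; apply: ler_sum => z _.
  rewrite -!mulrA -mulrDr; apply: ler_wpM2l; first exact: killed_ge0.
  rewrite -[leLHS]/(killed e I 1 z y) killed1.
  rewrite (_ : (z == y - 1) = (z + 1 == y)); last by apply/eqP/eqP; lia.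
  rewrite (_ : (z == y + 1) = (z - 1 == y)); last by apply/eqP/eqP; lia.
  by case: ifP => // _; rewrite addr_ge0// mulr_ge0.
have step x := path_law_step mX env_kernel_ge0 Xe n x y.
pose E x := [set t | X n t = x /\ X n.+1 t = y].
have mE x : measurable (E x).
  rewrite (_ : E x = [set t | X n t = x] `&` [set t | X n.+1 t = y])//.
  exact: measurableI.
have PE x : fine (P (E x)) = fine (P [set t | X n t = x]) * env_kernel e x y.
  by rewrite /E step fineM ?fin_prob.
apply: (@le_trans _ _ (fine (P (E (y - 1))) + fine (P (E (y + 1))))).
  rewrite !PE /env_kernel subrK eqxx addrK eqxx.
  rewrite (_ : (y == y + 1 + 1) = false); last by apply/negP => /eqP; lia.
  by apply: lerD; apply: ler_wpM2r.
rewrite -fineD ?fin_prob// -measureU//; last first.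
  by apply/seteqP; split => t //= [[h _] [h' _]]; lia.
rewrite addn1; apply: le_fine_prob => //; first exact: measurableU.
by move=> t [[_ h]|[_ h]].
Qed.

End walk_in_environment.

(** * Characteristic functions of stable laws and the growth of the normalization *)

Section char_fun_modulus.
Context d (T : measurableType d) (R : realType).
Variables (P : probability T R) (U : T -> R).
Hypothesis mU : measurable_fun [set: T] U.

(* Squared modulus of the characteristic function of [U]. *)
Definition char2 (t : R) : R :=
  (\int[P]_x cos (t * U x)) ^+ 2 + (\int[P]_x sin (t * U x)) ^+ 2.

Lemma bounded_mfun_cos (t : R) : bounded_mfun (fun x => cos (t * U x)).
Proof.
split; last by exists 1 => x; exact: cos_max.
apply: (@measurableT_comp _ _ _ _ _ _ (fun y : R => cos y)).
  by apply: continuous_measurable_fun; exact: continuous_cos.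
exact: measurable_funM.
Qed.

Lemma bounded_mfun_sin (t : R) : bounded_mfun (fun x => sin (t * U x)).
Proof.
split; last by exists 1 => x; exact: sin_max.
apply: (@measurableT_comp _ _ _ _ _ _ (fun y : R => sin y)).
  by apply: continuous_measurable_fun; exact: continuous_sin.
exact: measurable_funM.
Qed.

Lemma char2_ge0 t : 0 <= char2 t.
Proof. by rewrite addr_ge0// sqr_ge0. Qed.

Lemma char2_0 : char2 0 = 1.
Proof.
rewrite /char2; under eq_Rintegral do rewrite mul0r cos0.
under [in X in _ + X]eq_Rintegral do rewrite mul0r sin0.
by rewrite !mean_cst expr1n expr0n addr0.
Qed.

(** Squared distance of exp(i t U) from its mean. Its expectation is the variance [1 - char2 t], so
    modulus 1 forces exp(i t U) to be almost surely constant. *)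
Let dist t x := (cos (t * U x) - \int[P]_y cos (t * U y)) ^+ 2 +
  (sin (t * U x) - \int[P]_y sin (t * U y)) ^+ 2.

Let bounded_dist t : bounded_mfun (dist t).
Proof.
apply: bounded_mfunD.
  apply: (@bounded_mfunM _ _ _ (fun x => _ - _) (fun x => _ - _));
    by apply: bounded_mfunB; [exact: bounded_mfun_cos|exact: bounded_mfun_cst].
apply: (@bounded_mfunM _ _ _ (fun x => _ - _) (fun x => _ - _));
  by apply: bounded_mfunB; [exact: bounded_mfun_sin|exact: bounded_mfun_cst].
Qed.

Let mean_dist t : \int[P]_x dist t x = 1 - char2 t.
Proof.
pose C := \int[P]_x cos (t * U x); pose S := \int[P]_x sin (t * U x).
transitivity (\int[P]_x (1 + C ^+ 2 + S ^+ 2 -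
    (2 * C * cos (t * U x) + 2 * S * sin (t * U x)))).
  apply: eq_Rintegral => x _; rewrite /dist -/C -/S.
  by have := cos2Dsin2 (t * U x); set c := cos _; set s := sin _ => h; nra.
have bc := bounded_mfun_cos t; have bs := bounded_mfun_sin t.
have bC : bounded_mfun (fun x => 2 * C * cos (t * U x)).
  by apply: bounded_mfunM => //; exact: bounded_mfun_cst.
have bS : bounded_mfun (fun x => 2 * S * sin (t * U x)).
  by apply: bounded_mfunM => //; exact: bounded_mfun_cst.
rewrite (meanB _ (bounded_mfun_cst _) (bounded_mfunD bC bS)) (meanD _ bC bS).
rewrite !meanZl// mean_cst.
by rewrite /char2 -/C -/S; ring.
Qed.

Lemma char2_le1 t : char2 t <= 1.
Proof.
rewrite -subr_ge0 -mean_dist; apply: Rintegral_ge0 => x _.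
by rewrite addr_ge0// sqr_ge0.
Qed.

Lemma char2_eq1 t : char2 t = 1 ->
  P [set x | cos (t * U x) = \int[P]_y cos (t * U y) /\
             sin (t * U x) = \int[P]_y sin (t * U y)] = 1%E.
Proof.
move=> t1; set E := mkset _.
have Edist : E = dist t @^-1` [set 0].
  apply/seteqP; split => x /=; rewrite /dist.
    by move=> [-> ->]; rewrite !subrr expr0n addr0.
  move=> /eqP; rewrite paddr_eq0 ?sqr_ge0// !sqrf_eq0 !subr_eq0.
  by move=> /andP[/eqP ? /eqP ?].
have mE : measurable E.
  by rewrite Edist -[X in measurable X]setTI; apply: (bounded_dist t).1.
have := mean_dist t; rewrite t1 subrr => m0.
have d0 : (\int[P]_x `|(dist t x)%:E| = 0)%E.
  rewrite -[RHS](congr1 EFin m0) EFin_mean//; apply: eq_integral => x _.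
  by rewrite abse_EFin ger0_norm// addr_ge0// sqr_ge0.
have mdist : measurable_fun [set: T] (EFin \o dist t).
  by apply/measurable_EFinP; case: (bounded_dist t).
have [+ _] := ae_eq_integral_abs P measurableT mdist.
move=> /(_ d0) [N [mN N0 sN]].
have EC0 : P (~` E) = 0%E.
  apply/eqP; rewrite eq_le measure_ge0 andbT -N0; apply: le_measure; rewrite ?inE//.
    exact: measurableC.
  by move=> x xE; apply: sN => /= /(_ I) [h]; apply: xE; rewrite Edist.
have := probability_setC P (measurableC mE); rewrite setCK EC0 sube0.
exact.
Qed.

(** No moment of [U] is assumed, hence the cutoff: the Lipschitz bound where [U] is at most [K] in
    modulus, the trivial bound 2 elsewhere. *)
Lemma lipschitz_mean (f : R -> R) (K : R) s t :
  (forall x, `|f x| <= 1) -> (forall x y, `|f x - f y| <= `|x - y|) ->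
  measurable_fun [set: R] f -> 0 <= K ->
  `|\int[P]_x f (t * U x) - \int[P]_x f (s * U x)| <=
  `|t - s| * K + 2 * fine (P [set x | K < `|U x|]).
Proof.
move=> f1 fl mf K0.
have bf r : bounded_mfun (fun x => f (r * U x)).
  split; last by exists 1.
  by apply: measurableT_comp => //; exact: measurable_funM.
have mA : measurable [set x | K < `|U x|].
  rewrite (_ : mkset _ = (fun x => `|U x|) @^-1` `]K, +oo[%classic).
    rewrite -[X in measurable X]setTI.
    exact: (measurableT_comp (@normr_measurable R setT) mU).
  by apply/seteqP; split => x /=; rewrite in_itv/= andbT.
rewrite -meanB//.
have bA : bounded_mfun (\1_[set x | K < `|U x|] : T -> R) by exact: bounded_mfun_indic.
have bA2 : bounded_mfun (fun x => 2 * \1_[set x | K < `|U x|] x : R).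
  by apply: bounded_mfunM => //; exact: bounded_mfun_cst.
apply: (@le_trans _ _ (\int[P]_x `|f (t * U x) - f (s * U x)|)).
  by apply: le_normr_Rintegral => //; apply: bounded_mfun_integrable; exact: bounded_mfunB.
apply: (@le_trans _ _ (\int[P]_x (`|t - s| * K + 2 * \1_[set x | K < `|U x|] x))).
  apply: le_mean.
  - have [m [M hM]] := bounded_mfunB (bf t) (bf s); split.
      exact: measurableT_comp.
    by exists M => x; rewrite normr_id.
  - by apply: bounded_mfunD => //; exact: bounded_mfun_cst.
  move=> x; rewrite indicE; case: (boolP (_ \in _)) => /= [_|xK].
    rewrite mulr1 (le_trans (ler_normB _ _))//.
    have := f1 (t * U x); have := f1 (s * U x).
    have : 0 <= `|t - s| * K by rewrite mulr_ge0.
    lra.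
  rewrite mulr0 addr0 (le_trans (fl _ _))// -mulrBl normrM ler_wpM2l//.
  by move: xK; rewrite notin_setE/= => /negP; rewrite -leNgt.
rewrite meanD ?mean_cst ?meanZl ?mean_indic//; exact: bounded_mfun_cst.
Qed.

End char_fun_modulus.

Lemma lipschitz_of_is_derive (R : realType) (f g : R -> R) :
  (forall x : R, is_derive x 1 f (g x)) -> (forall x, `|g x| <= 1) ->
  forall x y, `|f x - f y| <= `|x - y|.
Proof.
move=> fg g1 x y; wlog xy : x y / x <= y => [h|].
  have [?|/ltW ?] := leP x y; first exact: h.
  by rewrite distrC (distrC x); exact: h.
have cf : {within `[x, y], continuous f}.
  apply: continuous_subspaceT => z; apply/differentiable_continuous/derivable1_diffP.
  by have [] := fg z.
have [c _ hc] := MVT_segment xy (fun z _ => fg z) cf.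
rewrite distrC hc normrM -(distrC y) ler_piMl//.
Qed.

Lemma cos_lipschitz (R : realType) (x y : R) : `|cos x - cos y| <= `|x - y|.
Proof.
apply: (@lipschitz_of_is_derive _ _ (fun x => - sin x)) => z.
by rewrite normrN sin_max.
Qed.

Lemma sin_lipschitz (R : realType) (x y : R) : `|sin x - sin y| <= `|x - y|.
Proof. by apply: (@lipschitz_of_is_derive _ _ cos) => // z; exact: cos_max. Qed.

Lemma char2_lipschitz d (T : measurableType d) (R : realType)
    (P : probability T R) (U : T -> R) (K s t : R) :
  measurable_fun [set: T] U -> 0 <= K ->
  `|char2 P U t - char2 P U s| <=
  4 * (`|t - s| * K + 2 * fine (P [set x | K < `|U x|])).
Proof.
move=> mU K0.
have mc := @continuous_measurable_fun R _ (@continuous_cos R).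
have ms := @continuous_measurable_fun R _ (@continuous_sin R).
have := lipschitz_mean P mU s t (@cos_max R) (@cos_lipschitz R) mc K0.
have := lipschitz_mean P mU s t (@sin_max R) (@sin_lipschitz R) ms K0.
rewrite /char2.
have c1 r : `|\int[P]_x cos (r * U x)| <= 1.
  by apply: le_norm_mean; [exact: bounded_mfun_cos|move=> x; exact: cos_max].
have s1 r : `|\int[P]_x sin (r * U x)| <= 1.
  by apply: le_norm_mean; [exact: bounded_mfun_sin|move=> x; exact: sin_max].
move: (c1 s) (c1 t) (s1 s) (s1 t).
set a := Rintegral _ _ _; set b := Rintegral _ _ _; set a' := Rintegral _ _ _.
set b' := Rintegral _ _ _; set D := `|t - s| * K + _ => ha hb ha' hb' hs hc.
(* Each square doubles the error, and there are two of them: this is the factor 4. *)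
have sq (x y : R) : `|x| <= 1 -> `|y| <= 1 -> `|x - y| <= D -> `|x ^+ 2 - y ^+ 2| <= 2 * D.
  move=> x1 y1 xy; rewrite subr_sqr normrM mulrC ler_pM//.
  by rewrite (le_trans (ler_normD _ _))//; lra.
rewrite (_ : _ - _ = (b ^+ 2 - a ^+ 2) + (b' ^+ 2 - a' ^+ 2)); last by ring.
rewrite (le_trans (ler_normD _ _))//.
have := sq _ _ hb ha hc; have := sq _ _ hb' ha' hs; lra.
Qed.

Lemma mean_eq_law d1 d2 d3 (T1 : measurableType d1) (T2 : measurableType d2)
    (T3 : measurableType d3) (R : realType) (P : probability T1 R)
    (Q : probability T2 R) (U : T1 -> T3) (V : T2 -> T3) (f : T3 -> R) :
  measurable_fun [set: T1] U -> measurable_fun [set: T2] V ->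
  (forall B, measurable B -> P (U @^-1` B) = Q (V @^-1` B)) ->
  bounded_mfun f -> \int[P]_x f (U x) = \int[Q]_x f (V x).
Proof.
move=> mU mV UV bf.
pose U' : {mfun T1 >-> T3} := HB.pack U (isMeasurableFun.Build _ _ _ _ _ mU).
pose V' : {mfun T2 >-> T3} := HB.pack V (isMeasurableFun.Build _ _ _ _ _ mV).
have mf : measurable_fun [set: T3] (EFin \o f) by apply/measurable_EFinP; case: bf.
rewrite /Rintegral.
have -> : (\int[P]_x (f (U x))%:E = \int[distribution P U']_y (EFin \o f) y)%E.
  rewrite integral_distribution//.
  exact/bounded_mfun_integrable/(bounded_mfun_comp bf mU).
have -> : (\int[Q]_x (f (V x))%:E = \int[distribution Q V']_y (EFin \o f) y)%E.
  rewrite integral_distribution//.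
  exact/bounded_mfun_integrable/(bounded_mfun_comp bf mV).
congr fine; apply: eq_measure_integral => B mB _.
exact: UV.
Qed.

Lemma prob_norm_gt_small (R : realType) (nu : probability R R) (eps : R) :
  0 < eps -> exists2 K : R, 0 <= K & fine (nu [set x | K < `|x|]) <= eps.
Proof.
move=> eps0; pose F (k : nat) := [set x : R | k%:R < `|x|].
have mF k : measurable (F k).
  rewrite (_ : F k = (fun x : R => `|x|) @^-1` `]k%:R, +oo[%classic).
    by rewrite -[X in measurable X]setTI; exact: normr_measurable.
  by apply/seteqP; split => x /=; rewrite in_itv/= andbT.
have F0 : \bigcap_k F k = set0.
  apply/seteqP; split => x // h.
  have := h (Num.trunc `|x|).+1 I; rewrite /F /= => /ltW.
  by rewrite leNgt truncnS_gt.
have : nu (F k) @[k --> \oo] --> nu (\bigcap_k F k).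
  apply: nonincreasing_cvg_mu => //.
  - by rewrite ltey_eq fin_prob.
  - by rewrite F0.
  - move=> m n mn; apply/subsetPset => x; apply: le_lt_trans.
    by rewrite ler_nat.
rewrite F0 measure0 => /fine_cvg h.
have := cvgr_lt _ h _ eps0 => -[n _ hn].
exists n%:R => //; apply: ltW; exact: (hn n (leqnn n)).
Qed.

Lemma bernoulli_ineq (R : realType) (x : R) n : 0 <= x -> 1 + n%:R * x <= (1 + x) ^+ n.
Proof.
move=> x0; elim: n => [|n IH]; first by rewrite mul0r addr0 expr0.
rewrite exprS -(natr1 n); have : 0 <= n%:R :> R by [].
set a : R := n%:R => a0; move: IH; rewrite -/a; set p := _ ^+ n => IH.
have : 0 <= x * x by rewrite mulr_ge0.
nra.
Qed.

Lemma expr_unbounded (R : realType) (k M : R) : 1 < k -> exists n, M <= k ^+ n.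
Proof.
move=> k1; have k0 : 0 < k - 1 by rewrite subr_gt0.
exists (Num.trunc (`|M| / (k - 1))).+1.
have := bernoulli_ineq (Num.trunc (`|M| / (k - 1))).+1 (ltW k0).
rewrite (subrKC 1 k); apply: le_trans.
have := truncnS_gt (`|M| / (k - 1)); rewrite ltr_pdivrMr// => h.
by have := ler_norm M; lra.
Qed.

(** * Modulus of the characteristic function of a stable law *)

Section stable_law.
Context (R : realType) (beta : R) (nu : probability R R).
Hypotheses (beta_gt0 : 0 < beta) (nu_stable : stable beta nu).

Let psi : R -> R := char2 nu (fun x => x).

Let bcos (a : R) : bounded_mfun (fun x : R => cos (a * x)).
Proof. exact: bounded_mfun_cos. Qed.

Let bsin (a : R) : bounded_mfun (fun x : R => sin (a * x)).
Proof. exact: bounded_mfun_sin. Qed.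

Let mean_prod (f g : R -> R) : bounded_mfun f -> bounded_mfun g ->
  \int[(nu \x nu)%E]_z (f z.1 * g z.2) = \int[nu]_x f x * \int[nu]_x g x.
Proof.
move=> bf bg.
have b1 : bounded_mfun (fun z : R * R => f z.1).
  exact: (bounded_mfun_comp bf (@measurable_fst _ _ _ _)).
have b2 : bounded_mfun (fun z : R * R => g z.2).
  exact: (bounded_mfun_comp bg (@measurable_snd _ _ _ _)).
have fstE (B : set R) : measurable B ->
    (nu \x nu)%E ((fun z : R * R => z.1) @^-1` B) = nu B.
  move=> mB; rewrite (_ : _ @^-1` _ = B `*` setT); last first.
    by apply/seteqP; split => z //= -[].
  by rewrite product_measure1E//= probability_setT mule1.
have sndE (B : set R) : measurable B ->
    (nu \x nu)%E ((fun z : R * R => z.2) @^-1` B) = nu B.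
  move=> mB; rewrite (_ : _ @^-1` _ = setT `*` B); last first.
    by apply/seteqP; split => z //= -[].
  by rewrite product_measure1E//= probability_setT mul1e.
rewrite (mean_independentM b1 b2).
  congr (_ * _).
    exact: (mean_eq_law (V := fun x => x) (@measurable_fst _ _ R R)).
  exact: (mean_eq_law (V := fun x => x) (@measurable_snd _ _ R R)).
move=> A B mA mB.
have mfA : measurable (f @^-1` A) by rewrite -[X in measurable X]setTI; exact: bf.1.
have mgB : measurable (g @^-1` B) by rewrite -[X in measurable X]setTI; exact: bg.1.
transitivity (nu (f @^-1` A) * nu (g @^-1` B))%E.
  exact: (product_measure1E nu nu mfA mgB).
by apply/esym; congr (_ * _)%E; [exact: fstE|exact: sndE].
Qed.

(** The shift [e] of the stability relation only rotates the characteristic function, so it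
    disappears from the modulus. *)
Lemma stable_char2 (a b : R) : 0 < a -> 0 < b ->
  psi a * psi b = psi ((a `^ beta + b `^ beta) `^ beta^-1).
Proof.
move=> a0 b0; have [c [e [c0 cE law]]] := nu_stable.2 a b a0 b0.
have -> : (a `^ beta + b `^ beta) `^ beta^-1 = c.
  by rewrite -cE -powRrM mulfV ?gt_eqF// powRr1// ltW.
have mU : measurable_fun [set: R * R] (fun z : R * R => a * z.1 + b * z.2).
  by apply: measurable_funD; apply: measurable_funM => //.
have mV : measurable_fun [set: R] (fun z : R => c * z + e).
  by apply: measurable_funD => //; apply: measurable_funM.
have eqm := mean_eq_law mU mV law.
pose C t := \int[nu]_x cos (t * x); pose S t := \int[nu]_x sin (t * x).
have bM (f g : R -> R) : bounded_mfun f -> bounded_mfun g ->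
    bounded_mfun (fun z : R * R => f z.1 * g z.2).
  move=> bf bg; apply: bounded_mfunM.
    exact: (bounded_mfun_comp bf (@measurable_fst _ _ _ _)).
  exact: (bounded_mfun_comp bg (@measurable_snd _ _ _ _)).
have bZ (r : R) (f : R -> R) : bounded_mfun f -> bounded_mfun (fun x => r * f x).
  by move=> bf; apply: bounded_mfunM => //; exact: bounded_mfun_cst.
have hcos : C a * C b - S a * S b = cos e * C c - sin e * S c.
  have /eqm : bounded_mfun (fun y : R => cos (1 * y)) by exact: bcos.
  under eq_Rintegral do rewrite mul1r cosD.
  under [in RHS]eq_Rintegral do rewrite mul1r cosD mulrC (mulrC (sin _)).
  rewrite (meanB _ (bM _ _ (bcos a) (bcos b)) (bM _ _ (bsin a) (bsin b))).
  rewrite (meanB _ (bZ _ _ (bcos c)) (bZ _ _ (bsin c))) !meanZl//.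
  by rewrite (mean_prod (bcos a) (bcos b)) (mean_prod (bsin a) (bsin b)).
have hsin : S a * C b + C a * S b = cos e * S c + sin e * C c.
  have /eqm : bounded_mfun (fun y : R => sin (1 * y)) by exact: bsin.
  under eq_Rintegral do rewrite mul1r sinD.
  under [in RHS]eq_Rintegral do rewrite mul1r sinD mulrC (mulrC (cos (c * _))).
  rewrite (meanD _ (bM _ _ (bsin a) (bcos b)) (bM _ _ (bcos a) (bsin b))).
  rewrite (meanD _ (bZ _ _ (bsin c)) (bZ _ _ (bcos c))) !meanZl//.
  by rewrite (mean_prod (bsin a) (bcos b)) (mean_prod (bcos a) (bsin b)).
rewrite /psi /char2 -/(C a) -/(C b) -/(C c) -/(S a) -/(S b) -/(S c).
transitivity ((C a * C b - S a * S b) ^+ 2 + (S a * C b + C a * S b) ^+ 2).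
  by ring.
rewrite hcos hsin.
transitivity ((cos e ^+ 2 + sin e ^+ 2) * (C c ^+ 2 + S c ^+ 2)); first by ring.
by rewrite cos2Dsin2 mul1r.
Qed.

Let psi_le1 t : psi t <= 1. Proof. exact: char2_le1. Qed.
Let psi_ge0 t : 0 <= psi t. Proof. exact: char2_ge0. Qed.

(** Solving t^beta = s^beta + b^beta for [b]. As [psi b <= 1], this is where monotonicity of [psi]
    comes from. *)
Let psi_split (s t : R) : 0 < s -> s < t -> exists2 b, 0 < b & psi t = psi s * psi b.
Proof.
move=> s0 st.
have d0 : 0 < t `^ beta - s `^ beta.
  by rewrite subr_gt0 gt0_ltr_powR// nnegrE ltW// (lt_trans s0).
exists ((t `^ beta - s `^ beta) `^ beta^-1); first exact: powR_gt0.
rewrite stable_char2 ?powR_gt0//; congr psi.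
rewrite -[X in _ + X]powRrM mulVf ?gt_eqF// (powRr1 (ltW d0)) subrKC.
by rewrite -powRrM mulfV ?gt_eqF// powRr1// ltW// (lt_trans s0).
Qed.

Let kappa : R := 2 `^ beta^-1.

Let kappa_gt1 : 1 < kappa.
Proof.
have : 1 `^ beta^-1 < 2 `^ beta^-1 :> R.
  by rewrite gt0_ltr_powR ?invr_gt0 ?nnegrE// ltrDl.
by rewrite powR1.
Qed.

Lemma stable_char2_double t : 0 < t -> psi (kappa * t) = psi t ^+ 2.
Proof.
move=> t0; rewrite expr2 stable_char2//; congr psi.
rewrite -mulr2n -mulr_natl powRM ?powR_ge0//.
by rewrite -powRrM mulfV ?gt_eqF// powRr1 // ltW.
Qed.

(** By the doubling relation a zero at [t] propagates to all [t / kappa ^+ k], against continuity at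
    0, where [psi] is 1. *)
Lemma stable_char2_gt0 t : 0 < t -> 0 < psi t.
Proof.
move=> t0; rewrite lt_neqAle psi_ge0 andbT eq_sym; apply/negP => /eqP psit.
have iterz k : psi (t / kappa ^+ k) = 0.
  elim: k => [|k IH]; first by rewrite expr0 divr1.
  apply/eqP; rewrite -sqrf_eq0 -stable_char2_double; last first.
    by rewrite divr_gt0// exprn_gt0// (lt_trans _ kappa_gt1).
  rewrite (_ : kappa * _ = t / kappa ^+ k) ?IH//.
  by rewrite exprS; field; rewrite expf_neq0 ?gt_eqF// (lt_trans _ kappa_gt1).
(* With these constants [psi] varies by at most 4 * (1/16 + 2/32) = 1/2 between 0 and
   [t / kappa ^+ n]. *)
have [K K0 hK] : exists2 K : R, 0 <= K & fine (nu [set x | K < `|x|]) <= 1 / 32.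
  by apply: prob_norm_gt_small; lra.
have [n hn] := expr_unbounded (16 * (t * K)) kappa_gt1.
have kn0 : 0 < kappa ^+ n by rewrite exprn_gt0// (lt_trans _ kappa_gt1).
have := char2_lipschitz nu 0 (t / kappa ^+ n) (@measurable_id _ R setT) K0.
rewrite -/psi iterz (_ : psi 0 = 1); last exact: char2_0.
rewrite sub0r normrN1 subr0 ger0_norm ?divr_ge0 ?(ltW t0) ?(ltW kn0)// mulrAC.
have : t * K / kappa ^+ n <= 1 / 16 by rewrite ler_pdivrMr//; lra.
lra.
Qed.

(** The value 1 at [t] propagates to all [kappa ^+ k * t], then to every positive argument by
    [psi_split]. Then exp(i x / (k + 1)) is almost surely constant for all [k], which makes [nu] a
    point mass. *)
Lemma stable_char2_lt1 t : 0 < t -> psi t < 1.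
Proof.
move=> t0; rewrite lt_neqAle psi_le1 andbT; apply/negP => /eqP psit.
have psi1 s : 0 < s -> psi s = 1.
  move=> s0; have [n hn] := expr_unbounded (2 * (s / t)) kappa_gt1.
  have kn0 m : 0 < kappa ^+ m by rewrite exprn_gt0// (lt_trans _ kappa_gt1).
  have iter1 k : psi (kappa ^+ k * t) = 1.
    elim: k => [|k IH]; first by rewrite expr0 mul1r.
    by rewrite exprS -mulrA stable_char2_double ?IH ?expr1n// mulr_gt0.
  have st : s < kappa ^+ n * t.
    have := ler_wpM2r (ltW t0) hn; rewrite -mulrA divfK ?gt_eqF//.
    lra.
  have [b b0 hb] := psi_split s0 st.
  apply/eqP; rewrite eq_le psi_le1/= -(iter1 n) hb.
  by rewrite ler_piMr.
pose E k := [set x : R | cos (k.+1%:R^-1 * x) = \int[nu]_y cos (k.+1%:R^-1 * y) /\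
  sin (k.+1%:R^-1 * x) = \int[nu]_y sin (k.+1%:R^-1 * y)].
have PE k : nu (E k) = 1%E.
  by apply: (@char2_eq1 _ _ _ nu (fun x => x)) => //; exact: psi1.
have mE k : measurable (E k).
  rewrite (_ : E k = [set x | cos (k.+1%:R^-1 * x) = \int[nu]_y cos (k.+1%:R^-1 * y)] `&`
    [set x | sin (k.+1%:R^-1 * x) = \int[nu]_y sin (k.+1%:R^-1 * y)])//.
  apply: measurableI.
    rewrite (_ : mkset _ = (fun x => cos (k.+1%:R^-1 * x)) @^-1` [set \int[nu]_y cos (k.+1%:R^-1 * y)])//.
    by rewrite -[X in measurable X]setTI; apply: (bcos k.+1%:R^-1).1.
  rewrite (_ : mkset _ = (fun x => sin (k.+1%:R^-1 * x)) @^-1` [set \int[nu]_y sin (k.+1%:R^-1 * y)])//.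
  by rewrite -[X in measurable X]setTI; apply: (bsin k.+1%:R^-1).1.
have mI : measurable (\bigcap_k E k) by exact: bigcapT_measurable.
have PI : nu (\bigcap_k E k) = 1%E.
  have : nu (~` (\bigcap_k E k)) = 0%E.
    rewrite setC_bigcap; apply/negligibleP.
      by apply: bigcupT_measurable => k; exact: measurableC.
    apply: negligible_bigcup => k; apply/negligibleP; first exact: measurableC.
    exact: prob1_setC.
  rewrite probability_setC// => h.
  by rewrite -[RHS](sube0) -h oppeB ?fin_num_adde_defr// addeA subee// add0e.
have [x Ex] : exists x, (\bigcap_k E k) x.
  apply/set0P/eqP => E0; move: PI; rewrite E0 measure0 => /eqP.
  by rewrite eqe eq_sym oner_eq0.
apply: (nu_stable.1 x); rewrite -PI; congr (nu _); apply/seteqP; split => y.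
  by move=> ->.
move=> Ey; apply/eqP; rewrite -subr_eq0; apply/negPn/negP => xy0.
(* This brings the angle [(y - x) / k.+1] into [-1, 1], where a cosine equal to 1 forces it to
   vanish. *)
pose k := Num.trunc `|y - x|.
have [h1 h2] := Ex k I; have [h3 h4] := Ey k I.
have : cos (k.+1%:R^-1 * (y - x)) = 1.
  by rewrite mulrBr cosB h3 h4 h1 h2 -h1 -h2 -!expr2 cos2Dsin2.
move=> cos1; have /cos_inj : cos `|k.+1%:R^-1 * (y - x)| = cos 0.
  by rewrite cos_norm cos0.
have z1 : `|k.+1%:R^-1 * (y - x)| <= 1.
  rewrite normrM ger0_norm ?invr_ge0// mulrC ler_pdivrMr// mul1r.
  exact/ltW/truncnS_gt.
rewrite !in_itv/= normr_ge0 lexx pi_ge0 (le_trans z1)/=; last first.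
  by have := @pi_ge2 R; lra.
by move=> /(_ isT isT)/eqP; rewrite normr_eq0 mulf_eq0 invr_eq0 pnatr_eq0 (negbTE xy0).
Qed.

Lemma stable_char2_decr s t : 0 < s -> s < t -> psi t < psi s.
Proof.
move=> s0 st; have [b b0 ->] := psi_split s0 st.
by rewrite gtr_pMr ?stable_char2_gt0// stable_char2_lt1.
Qed.

End stable_law.

(** * Polynomial growth of the normalization *)

Section normalization_growth.
Context d (T : measurableType d) (R : realType) (P : probability T R).
Variables (S : nat -> T -> int) (g : R -> R) (A : nat -> R).
Variables (beta : R) (nu : probability R R).
Hypothesis mS : forall n, measurable_fun [set: T] (S n).
Hypothesis char2_S : forall n s, char2 P (fun t => (S n t)%:~R) s = g s ^+ n.
Hypothesis A_gt0 : forall n, 0 < A n.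
Hypothesis beta_gt0 : 0 < beta.
Hypothesis nu_stable : stable beta nu.
Hypothesis S_cvg : cvg_in_distribution P (fun n t => (S n t)%:~R / A n) nu.

Let Z n t : R := (S n t)%:~R / A n.

Let mSR n : measurable_fun [set: T] (fun t => (S n t)%:~R : R).
Proof. exact: (@measurableT_comp _ _ _ _ _ _ (fun k : int => k%:~R : R)). Qed.

Let mZ n : measurable_fun [set: T] (Z n).
Proof. exact: measurable_funM. Qed.

Let normZ n t : `|Z n t| = `|(S n t)%:~R| / A n.
Proof. by rewrite /Z normrM normfV (gtr0_norm (A_gt0 n)). Qed.

Let mean_cvg (f : R -> R) (M : R) : continuous f -> (forall x, `|f x| <= M) ->
  (\int[P]_t f (Z n t)) @[n --> \oo] --> \int[nu]_x f x.
Proof.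
move=> cf fM; have bf : bounded_mfun f.
  by split; [exact: continuous_measurable_fun|exists M].
have := S_cvg cf (ex_intro _ M fM).
by rewrite -(EFin_mean nu bf) => /fine_cvg.
Qed.

Let char2_Z n s : char2 P (Z n) s = g (s / A n) ^+ n.
Proof.
rewrite -char2_S /char2 /Z.
by congr (_ ^+ 2 + _ ^+ 2); apply: eq_Rintegral => t _; congr (_ _);
  rewrite mulrCA mulrC.
Qed.

Let psi := char2 nu (fun x => x).

Let char2_cvg s : char2 P (Z n) s @[n --> \oo] --> psi s.
Proof.
have cs : continuous (fun x : R => s * x).
  by move=> x; apply: cvgM; [exact: cvg_cst|exact: cvg_id].
apply: cvgD; rewrite expr2; under eq_fun do rewrite expr2; apply: cvgM;
  apply: (mean_cvg (M := 1)) => [x|x]; rewrite ?cos_max ?sin_max//;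
  apply: continuous_comp; [exact: cs|exact: continuous_cos
    |exact: cs|exact: continuous_cos|exact: cs|exact: continuous_sin
    |exact: cs|exact: continuous_sin].
Qed.

Lemma tight eps : 0 < eps -> exists2 K : R, 0 <= K &
  exists n0, forall n, (n0 <= n)%N ->
    fine (P [set t | K * A n < `|(S n t)%:~R|]) <= eps.
Proof.
move=> eps0.
have [K K0 hK] : exists2 K : R, 0 <= K & fine (nu [set x | K < `|x|]) <= eps / 2.
  by apply: prob_norm_gt_small; rewrite divr_gt0.
(* Convergence in distribution is tested on continuous functions: this ramp, from 0 at modulus [K]
   to 1 at [K + 1], lies between the two tail indicators. *)
pose f (x : R) := Num.min 1 (Num.max 0 (`|x| - K)).
have f0 x : 0 <= f x by rewrite /f le_min ler01 le_max lexx.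
have f1 x : f x <= 1 by rewrite /f ge_min lexx.
have fb x : `|f x| <= 1 by rewrite ger0_norm.
have cf : continuous f.
  move=> x; apply: (continuous_min (f := cst 1) (g := fun y : R => Num.max 0 (`|y| - K))).
    exact: cvg_cst.
  apply: (continuous_max (f := cst 0) (g := fun y : R => `|y| - K)).
    exact: cvg_cst.
  by apply: cvgB; [exact: norm_continuous|exact: cvg_cst].
have bf : bounded_mfun f.
  by split; [exact: continuous_measurable_fun|exists 1].
have mK (L : R) : measurable [set x : R | L < `|x|].
  rewrite (_ : mkset _ = (fun x : R => `|x|) @^-1` `]L, +oo[%classic).
    by rewrite -[X in measurable X]setTI; exact: normr_measurable.
  by apply/seteqP; split => x /=; rewrite in_itv/= andbT.
have nuf : \int[nu]_x f x <= eps / 2.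
  apply: le_trans hK; rewrite -mean_indic//; apply: le_mean => //.
    exact: bounded_mfun_indic.
  move=> x; rewrite indicE; case: (boolP (_ \in _)) => //=.
  rewrite notin_setE/= => /negP; rewrite -leNgt => xK.
  by rewrite /f ge_min ge_max lexx subr_le0 xK orbT.
have h := mean_cvg cf fb.
have [n0 _ hn0] : \forall n \near \oo, \int[P]_t f (Z n t) < eps.
  by apply: (cvgr_lt _ h); lra.
exists (K + 1); first by rewrite addr_ge0.
exists n0 => n n0n; apply: le_trans (ltW (hn0 n n0n)).
have mE : measurable [set t | (K + 1) * A n < `|(S n t)%:~R|].
  rewrite (_ : mkset _ = Z n @^-1` [set x | K + 1 < `|x|]).
    by rewrite -[X in measurable X]setTI; apply: mZ.
  by apply/seteqP; split => t /=; rewrite normZ ltr_pdivlMr.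
rewrite -mean_indic//; apply: le_mean; first exact: bounded_mfun_indic.
  exact: bounded_mfun_comp bf (mZ n).
move=> t; rewrite indicE; case: (boolP (_ \in _)) => //=.
rewrite inE/= -ltr_pdivlMr// -normZ => h1.
rewrite /f le_min lexx/= le_max; apply/orP; right.
by rewrite lerBrDr addrC ltW.
Qed.

Let kappa : R := 2 `^ beta^-1.

(* By equicontinuity the squared moduli [g (s / A n) ^+ n] converge to [psi s]
   uniformly for bounded [s].  If [kappa' * A n./2 < A n], then [g (1 / A n) ^+ n./2]
   is at least about [psi (1 / kappa')], so [g (1 / A n) ^+ n] is at least about
   [psi (1 / kappa') ^+ 2], which exceeds [psi (1 / kappa) ^+ 2 = psi 1]. *)
Lemma normalization_halving (kappa' : R) : kappa < kappa' ->
  exists n0, forall n, (n0 <= n)%N -> A n <= kappa' * A n./2.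
Proof.
move=> kk'.
have k0 : 0 < kappa by exact: powR_gt0.
have k'0 : 0 < kappa' by exact: lt_trans kk'.
pose b0 := psi kappa^-1; pose b1 := psi kappa'^-1.
have b00 : 0 < b0 by apply: (stable_char2_gt0 beta_gt0) => //; rewrite invr_gt0.
have b01 : b0 < b1.
  apply: (stable_char2_decr beta_gt0) => //; rewrite ?invr_gt0//.
  by rewrite ltf_pV2.
have psi1 : psi 1 = b0 ^+ 2.
  by rewrite -(stable_char2_double beta_gt0) ?invr_gt0// -/kappa divff// gt_eqF.
have psi0 : psi 0 = 1 by exact: char2_0.
have b1psi s : 0 <= s -> s <= kappa'^-1 -> b1 <= psi s.
  rewrite le_eqVlt => /predU1P[<- _|s0].
    by rewrite psi0; exact: char2_le1.
  rewrite le_eqVlt => /predU1P[->//|sk]; apply: ltW.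
  exact: (stable_char2_decr beta_gt0).
(* Two errors [eta] are allowed, one for convergence on a finite grid and one for passing from the
   grid to other points; [b1 - 2 * eta] is the midpoint [b] below. *)
pose eta := (b1 - b0) / 4; have eta0 : 0 < eta by rewrite divr_gt0// subr_gt0.
pose b := (b1 + b0) / 2.
have bb0 : b0 < b by rewrite /b; lra.
have b_gt0 : 0 < b by exact: lt_trans bb0.
have [K K0 [n1 hK]] : exists2 K : R, 0 <= K & exists n0, forall n, (n0 <= n)%N ->
    fine (P [set t | K * A n < `|(S n t)%:~R|]) <= eta / 16.
  by apply: tight; rewrite divr_gt0.
(* On a grid of mesh 1/M the two terms of [char2_lipschitz] are at most [eta / 2] each. *)
pose M := (Num.trunc (8 * K / eta)).+1.
have M0 : 0 < M%:R :> R by rewrite ltr0n.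
have KM : 4 * (M%:R^-1 * K) <= eta / 2.
  have : 8 * K / eta < M%:R by exact: truncnS_gt.
  by rewrite ltr_pdivrMr// => h; rewrite mulrCA ler_pdivrMl//; lra.
have near_psi s : \forall n \near \oo, psi s - eta < char2 P (Z n) s.
  by apply: (cvgr_gt _ (@char2_cvg s)); rewrite ltrBlDr ltrDl.
have [n2 _ hn2] : \forall n \near \oo, forall i : 'I_M.+1,
    psi (i%:R / M%:R) - eta < char2 P (Z n) (i%:R / M%:R).
  by apply: filter_forall => i; exact: near_psi.
have lower n s : (n1 <= n)%N -> (n2 <= n)%N -> 0 < s -> s <= kappa'^-1 ->
    s <= 1 -> b <= char2 P (Z n) s.
  move=> n1n n2n s0 sk s1.
  pose i := Num.trunc (s * M%:R).
  have sM0 : 0 <= s * M%:R by rewrite mulr_ge0// ltW.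
  have /andP[i1 i2] := truncn_itv sM0.
  have iM : (i < M.+1)%N.
    rewrite -(ltr_nat R); apply: le_lt_trans i1 _.
    by rewrite -natr1 ltr_pwDr// ler_piMl.
  have := hn2 n n2n (Ordinal iM) => /=; set u := i%:R / M%:R => hu.
  have u0 : 0 <= u by rewrite divr_ge0.
  have us : u <= s by rewrite ler_pdivrMr.
  have su : `|s - u| <= M%:R^-1.
    rewrite ger0_norm ?subr_ge0// lerBlDr (_ : _ + u = (1 + i%:R) / M%:R).
      by rewrite ler_pdivlMr// nat1r ltW.
    by rewrite mulrDl div1r.
  have pu := b1psi u u0 (le_trans us sk).
  have := char2_lipschitz P u s (mZ n) K0.
  have -> : [set t | K < `|Z n t|] = [set t | K * A n < `|(S n t)%:~R|].
    by apply/seteqP; split => t /=; rewrite normZ ltr_pdivlMr.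
  have := hK n n1n; set p := fine _ => hp hl.
  have : `|s - u| * K <= M%:R^-1 * K by rewrite ler_wpM2r.
  move: hl; rewrite ler_norml => /andP[hl _].
  have -> : b = b1 - 2 * eta by rewrite /b /eta; lra.
  lra.
have [n3 _ hn3] : \forall n \near \oo, char2 P (Z n) 1 < (b ^+ 2 + b0 ^+ 2) / 2.
  apply: (cvgr_lt _ (@char2_cvg 1)).
  have : b0 ^+ 2 < b ^+ 2 by rewrite ltr_pXn2r// nnegrE ltW.
  by rewrite psi1; lra.
pose gap := (b ^+ 2 - b0 ^+ 2) / 2.
have gap0 : 0 < gap by rewrite divr_gt0// subr_gt0 ltr_pXn2r// nnegrE ltW.
pose n4 := (Num.trunc (b / gap)).+1.
have g01 s : 0 <= g s <= 1.
  by have := char2_S 1 s; rewrite expr1 => <-; rewrite char2_ge0 char2_le1//; exact: mSR.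
exists (n3 + (n1 + n2 + n4).*2)%N => n hn; rewrite leNgt; apply/negP => AA.
pose m := n./2.
have hm : (n1 + n2 + n4 <= m)%N.
  by rewrite /m geq_half_double (leq_trans _ hn)// leq_addl.
have m0 : 0 < m%:R :> R.
  by rewrite ltr0n; apply: leq_trans hm; rewrite /n4 addnS.
pose x := g (A n)^-1.
have /andP[x0 x1] : 0 <= x <= 1 by exact: g01.
have sm : A m / A n < kappa'^-1.
  by rewrite ltr_pdivrMr// mulrC ltr_pdivlMr// mulrC.
have xm : b <= x ^+ m.
  have sm1 : A m / A n <= 1.
    apply: ltW; apply: lt_le_trans sm _; rewrite invf_le1//.
    apply/ltW/lt_trans; last exact: kk'.
    have : 1 `^ beta^-1 < 2 `^ beta^-1 :> R.
      by rewrite gt0_ltr_powR ?invr_gt0 ?nnegrE// ltrDl.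
    by rewrite powR1.
  have := lower m (A m / A n) _ _ _ (ltW sm) sm1; rewrite char2_Z.
  rewrite mulrAC divff ?gt_eqF// mul1r; apply.
  - by apply: leq_trans hm; rewrite -addnA leq_addr.
  - by apply: leq_trans hm; rewrite addnAC leq_addl.
  - exact: divr_gt0.
(* When [n] is odd, [x ^+ n] has one factor [x] more than the square of [x ^+ m]. Bernoulli's
   inequality and x(2 - x) <= 1 show that this factor is close to 1. *)
have xlow : 1 - (b * m%:R)^-1 <= x.
  have y0 : 0 <= 1 - x by rewrite subr_ge0.
  have h1 : x ^+ m * (1 + m%:R * (1 - x)) <= 1.
    apply: (@le_trans _ _ ((x * (1 + (1 - x))) ^+ m)).
      rewrite exprMn; apply: ler_wpM2l; first exact: exprn_ge0.
      exact: bernoulli_ineq.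
    by apply: exprn_ile1; nra.
  have h2 : b * (1 + m%:R * (1 - x)) <= 1.
    apply: le_trans h1; apply: ler_wpM2r => //.
    by rewrite addr_ge0// mulr_ge0.
  have bm0 : 0 < b * m%:R by exact: mulr_gt0.
  rewrite lerBlDr -lerBlDl -[leRHS]mul1r ler_pdivlMr//.
  by move: h2; rewrite mulrDr mulr1 mulrA (mulrC (1 - x)); move: b_gt0; lra.
have xn : b ^+ 2 * x <= x ^+ n.
  apply: (@le_trans _ _ (x ^+ m.*2.+1)).
    rewrite (exprSr x) ler_wpM2r// -mul2n mulnC exprM.
    by rewrite ler_pXn2r// nnegrE ?exprn_ge0// ltW.
  apply: ler_wiXn2l => //.
  by rewrite -(odd_double_half n) -/m -add1n leq_add2r; case: (odd n).
have := hn3 n; rewrite /= char2_Z div1r -/x => /(_ _) hx.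
have {}hx := hx (leq_trans (leq_addr _ _) hn).
have bm : b / m%:R <= gap.
  rewrite ler_pdivrMr// mulrC -ler_pdivrMr//.
  apply: (@le_trans _ _ n4%:R); first exact/ltW/truncnS_gt.
  by rewrite ler_nat; apply: leq_trans hm; rewrite leq_addl.
have h3 : b ^+ 2 * (1 - (b * m%:R)^-1) <= b ^+ 2 * x.
  by apply: ler_wpM2l => //; exact: sqr_ge0.
have h4 : b ^+ 2 * (1 - (b * m%:R)^-1) = b ^+ 2 - b / m%:R.
  by field; rewrite !gt_eqF.
move: bm hx; rewrite /gap; lra.
Qed.

(** Since a > 1/beta, 2^a exceeds [kappa]; halving [n] repeatedly with this ratio reaches the
    initial segment absorbed by the constant. *)
Lemma normalization_power (a : R) : beta^-1 < a ->
  exists2 C : R, 0 < C & forall n, (0 < n)%N -> A n <= C * n%:R `^ a.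
Proof.
move=> ba.
have a0 : 0 < a by apply: lt_trans ba; rewrite invr_gt0.
have kk' : kappa < 2 `^ a.
  rewrite /kappa /powR pnatr_eq0/= ltr_expR ltr_pM2r// ln_gt0//.
  by rewrite ltrDl.
have [n0 hn0] := normalization_halving kk'.
(* With [n0.+2] terms, any index left over is at least 2, so its half is still positive. *)
pose C : R := \sum_(i < n0.+2) A i.
have C0 : 0 < C.
  by rewrite /C big_ord_recr/= ltr_pwDr// sumr_ge0// => i _; exact: ltW.
exists C => // n; have [k] := ubnP n; elim: k n => // k IH n nk n_gt0.
have n1 : 1 <= n%:R :> R by rewrite ler1n.
have [nn0|nn0] := ltnP n n0.+2.
  apply: (@le_trans _ _ C).
    rewrite /C (bigD1 (Ordinal nn0))//= lerDl sumr_ge0// => i _; exact: ltW.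
  by rewrite ler_pMr//; have := ler_powR n1 (ltW a0); rewrite powRr0.
apply: le_trans (hn0 n _) _; first by apply: leq_trans nn0; lia.
have h2 : (0 < n./2)%N by rewrite half_gt0; lia.
have h2n : (n./2 < k)%N by have := odd_double_half n; lia.
apply: (@le_trans _ _ (2 `^ a * (C * (n./2)%:R `^ a))).
  by apply: ler_wpM2l; [exact: powR_ge0|exact: IH].
rewrite mulrCA -powRM// ler_wpM2l ?(ltW C0)// ge0_ler_powR ?(ltW a0)// ?nnegrE//.
- by rewrite -natrM ler_nat; have := odd_double_half n; lia.
Qed.

End normalization_growth.

(** * The Green function of the centered walk *)

Lemma measurable_int_pair (A : set (int * int)) : measurable A.
Proof.
pose F k : set (int * int) := A `&` [set z | choice.pickle z = k].
have -> : A = \bigcup_k F k.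
  by apply/seteqP; split => [z Az|z [k _ []]//]; exists (choice.pickle z).
apply: bigcupT_measurable => k.
have [[[x y] [Az zk]]|no] := pselect (exists z, F k z).
  rewrite (_ : F k = [set x] `*` [set y]); first exact: measurableX.
  apply/seteqP; split => -[x' y'] /=.
    move=> [_ h]; have : (x', y') = (x, y).
      by apply: (@pcan_inj _ _ _ _ (@choice.pickleK (int * int)%type)); rewrite h zk.
    by case=> -> ->.
  by case=> -> ->.
by rewrite (_ : F k = set0)//; apply/seteqP; split => // z Fz; apply: no; exists z.
Qed.

Lemma measurable_fun_int2 d d' (T : measurableType d) (T' : measurableType d')
    (U V : T -> int) (h : int -> int -> T') :
  measurable_fun [set: T] U -> measurable_fun [set: T] V ->
  measurable_fun [set: T] (fun t => h (U t) (V t)).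
Proof.
move=> mU mV.
apply: (@measurableT_comp _ _ _ _ _ _ (fun z : int * int => h z.1 z.2) setT
  (fun t => (U t, V t))); last exact/measurable_fun_pair.
by move=> _ B mB; exact: measurable_int_pair.
Qed.

Lemma int_segment_index (w : int) (L : nat) : (absz w <= L)%N ->
  exists j : 'I_(L + L.+1), j%:Z - L%:Z = w.
Proof.
move=> wL; have jlt : (absz (w + L%:Z)%R < L + L.+1)%N by lia.
by exists (Ordinal jlt) => /=; lia.
Qed.

Lemma leq_half_subn (m n : nat) : (n + n <= m)%N -> (m <= (m - n) * 2)%N.
Proof. lia. Qed.

Section random_walk_sums.
Context d (T : measurableType d) (R : realType) (P : probability T R).
Variables (Y : nat -> T -> int) (mu : probability int R).
Hypothesis mY : forall n, measurable_fun [set: T] (Y n).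
Hypothesis Y_walk : random_walk P Y mu.

(** [Y] starts at 0 almost surely only. This version starts at 0 everywhere and depends on the first
    [n] increments alone, which is what the independence arguments require. *)
Definition walk_sum n t := \sum_(i < n) increment Y i t.

Lemma walk_sumE n t : walk_sum n t = Y n t - Y 0%N t.
Proof.
rewrite /walk_sum; elim: n => [|n IH]; first by rewrite big_ord0 subrr.
by rewrite big_ord_recr/= IH /increment addrC subrKA.
Qed.

Let minc i : measurable_fun [set: T] (increment Y i).
Proof. exact: (measurable_fun_int2 (fun x y => x - y)). Qed.

Let walk_sum_past k n : (k <= n)%N -> measurable_fun
  [set: g_sigma_algebraType (events_in (increment Y) [set i | (i < n)%N])] (walk_sum k).
Proof.
elim: k => [_|k IH kn].
  rewrite (_ : walk_sum 0 = fun=> 0); first exact: measurable_cst.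
  by apply/funext => t; rewrite /walk_sum big_ord0.
rewrite (_ : walk_sum k.+1 = fun t => walk_sum k t + increment Y k t); last first.
  by apply/funext => t; rewrite /walk_sum big_ord_recr.
apply: (measurable_fun_int2 (fun x y => x + y)); first exact: IH (ltnW kn).
exact: measurable_fun_events_in.
Qed.

Lemma measurable_walk_sum n : measurable_fun [set: T] (walk_sum n).
Proof. exact: measurable_fun_of_events_in (walk_sum_past (leqnn n)). Qed.

Lemma bounded_mfun_int (f : int -> R) (M : R) : (forall k, `|f k| <= M) ->
  bounded_mfun f.
Proof. by move=> fM; split => //; exists M. Qed.

Lemma mean_walk_sumS n (f : int -> R) (M : R) : (forall k, `|f k| <= M) ->
  \int[P]_t f (walk_sum n.+1 t) = \int[mu]_l \int[P]_t f (walk_sum n t + l).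
Proof.
move=> fM.
have bf2 : bounded_mfun (fun z : int * int => f (z.2 + z.1)).
  split; last by exists M => z; exact: fM.
  by move=> _ B mB; exact: measurable_int_pair.
have ind : forall A B : set int, measurable A -> measurable B ->
    P (increment Y n @^-1` A `&` walk_sum n @^-1` B) =
    (P (increment Y n @^-1` A) * P (walk_sum n @^-1` B))%E.
  have [_ indY _] := Y_walk.
  apply: (independent_functions minc indY (J := [set n]) (K := [set i | (i < n)%N])).
  - by apply/seteqP; split => i //= [->]; rewrite ltnn.
  - exact: measurable_fun_events_in.
  - exact: walk_sum_past (leqnn n).
transitivity (\int[P]_t f (walk_sum n t + increment Y n t)).
  by apply: eq_Rintegral => t _; rewrite /walk_sum big_ord_recr.
rewrite (mean_independent_pair (minc n) (@measurable_walk_sum n) ind bf2)/=.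
apply: (mean_eq_law (V := fun x => x) (f := fun l => \int[P]_s f (walk_sum n s + l)) (minc n)) => //.
- by have [_ _ h] := Y_walk.
- apply: (@bounded_mfun_int _ M) => l; apply: le_norm_mean => //.
  have b : bounded_mfun (fun k : int => f (k + l)).
    by apply: (@bounded_mfun_int _ M) => k; exact: fM.
  exact: (bounded_mfun_comp b (@measurable_walk_sum n)).
Qed.

Let gY s := char2 mu (fun k => k%:~R : R) s.

(** [C n] and [D n] are the real and imaginary parts of the characteristic function; [CS] and [DS]
    spell out complex multiplication by that of one increment. *)
Lemma char2_walk_sum n s : char2 P (fun t => (walk_sum n t)%:~R) s = gY s ^+ n.
Proof.
pose C n := \int[P]_t cos (s * (walk_sum n t)%:~R).
pose D n := \int[P]_t sin (s * (walk_sum n t)%:~R).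
pose c := \int[mu]_l cos (s * l%:~R); pose e := \int[mu]_l sin (s * l%:~R).
rewrite -[LHS]/(C n ^+ 2 + D n ^+ 2) -[gY s]/(c ^+ 2 + e ^+ 2).
have bc m : bounded_mfun (fun t => cos (s * (walk_sum m t)%:~R)).
  apply: (bounded_mfun_comp (U := fun k : int => cos (s * k%:~R))); last exact: measurable_walk_sum.
  by apply: (@bounded_mfun_int _ 1) => k; exact: cos_max.
have bs m : bounded_mfun (fun t => sin (s * (walk_sum m t)%:~R)).
  apply: (bounded_mfun_comp (U := fun k : int => sin (s * k%:~R))); last exact: measurable_walk_sum.
  by apply: (@bounded_mfun_int _ 1) => k; exact: sin_max.
have bc1 : bounded_mfun (fun l : int => cos (s * l%:~R)).
  by apply: (@bounded_mfun_int _ 1) => k; exact: cos_max.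
have bs1 : bounded_mfun (fun l : int => sin (s * l%:~R)).
  by apply: (@bounded_mfun_int _ 1) => k; exact: sin_max.
have bZ d1 (T1 : measurableType d1) r (f : T1 -> R) : bounded_mfun f -> bounded_mfun (fun t => r * f t).
  by move=> bf; apply: bounded_mfunM => //; exact: bounded_mfun_cst.
have CS m : C m.+1 = C m * c - D m * e.
  rewrite /C (@mean_walk_sumS _ (fun k => cos (s * k%:~R)) 1); last by move=> k; exact: cos_max.
  transitivity (\int[mu]_l (C m * cos (s * l%:~R) - D m * sin (s * l%:~R))).
    apply: eq_Rintegral => l _; rewrite mulrC (mulrC (D m)).
    rewrite /C /D -!meanZl// -(meanB _ (bZ _ _ _ _ (bc m)) (bZ _ _ _ _ (bs m))).
    by apply: eq_Rintegral => t _; rewrite intrD mulrDr cosD; ring.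
  by rewrite (meanB _ (bZ _ _ _ _ bc1) (bZ _ _ _ _ bs1)) !meanZl.
have DS m : D m.+1 = D m * c + C m * e.
  rewrite /D (@mean_walk_sumS _ (fun k => sin (s * k%:~R)) 1); last by move=> k; exact: sin_max.
  transitivity (\int[mu]_l (D m * cos (s * l%:~R) + C m * sin (s * l%:~R))).
    apply: eq_Rintegral => l _; rewrite mulrC (mulrC (C m)).
    rewrite /C /D -!meanZl// -(meanD _ (bZ _ _ _ _ (bs m)) (bZ _ _ _ _ (bc m))).
    by apply: eq_Rintegral => t _; rewrite intrD mulrDr sinD; ring.
  by rewrite (meanD _ (bZ _ _ _ _ bc1) (bZ _ _ _ _ bs1)) !meanZl.
elim: n => [|n IH].
  rewrite /C /D expr0; under eq_Rintegral do rewrite /walk_sum big_ord0 mulr0 cos0.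
  under [in X in _ + X]eq_Rintegral do rewrite /walk_sum big_ord0 mulr0 sin0.
  by rewrite !mean_cst expr1n expr0n addr0.
by rewrite CS DS (exprS (c ^+ 2 + e ^+ 2)) -IH; ring.
Qed.

Lemma prob_walk_sum n (B : set int) : P [set t | B (Y n t)] = P [set t | B (walk_sum n t)].
Proof.
have [Y0 _ _] := Y_walk.
have m0 : measurable [set t | Y 0%N t = 0] by exact: measurable_fiber.
have mB : measurable [set t | B (Y n t)].
  by rewrite -[X in measurable X]setTI; exact: mY.
have mB' : measurable [set t | B (walk_sum n t)].
  by rewrite -[X in measurable X]setTI; exact: measurable_walk_sum.
rewrite -(prob1_setIr m0 mB Y0) -(prob1_setIr m0 mB' Y0); congr (P _).
by apply/seteqP; split => t /= [h]; rewrite walk_sumE h subr0.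
Qed.

Lemma random_walk_path_law : path_law P Y (fun x y => fine (mu [set y - x])).
Proof.
have [Y0 indY lawY] := Y_walk.
split=> // n x.
have m0 : measurable [set t | Y 0%N t = 0] by exact: measurable_fiber.
have mh m : measurable (history Y m x) by exact: measurable_history.
pose H := [set t | forall i, (i <= n)%N -> walk_sum i t = x i].
pose E := increment Y n @^-1` [set x n.+1 - x n].
have sH : <<s events_in (increment Y) [set i | (i < n)%N] >> H.
  rewrite (_ : H = \bigcap_(i in [set i | (i <= n)%N]) walk_sum i @^-1` [set x i]).
    apply: (@bigcap_measurableType _ (g_sigma_algebraType
      (events_in (increment Y) [set i | (i < n)%N]))) => i iln.
    by have := walk_sum_past iln; move=> /(_ measurableT [set x i] I); rewrite setTI.
  by apply/seteqP; split => t.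
have sE : <<s events_in (increment Y) [set n] >> E.
  by apply: sub_sigma_algebra; exists n, [set x n.+1 - x n].
have mH : measurable H := sigma_events_in_measurable minc sH.
have mE : measurable E := sigma_events_in_measurable minc sE.
have histE : [set t | Y 0%N t = 0] `&` history Y n x = [set t | Y 0%N t = 0] `&` H.
  by apply/seteqP; split => t [/= h0 h]; split => // i iln; have := h i iln;
    rewrite walk_sumE h0 subr0.
have histS : history Y n.+1 x = history Y n x `&` E.
  apply/seteqP; split => t /=.
    move=> h; split; first by move=> i iln; apply: h; exact: leqW.
    by rewrite /E/= /increment h// h.
  move=> [h hE] i; rewrite leq_eqVlt => /predU1P[->|]; last exact: h.
  by move: hE; rewrite /E/= /increment (h n)// => /addIr.
rewrite histS -(prob1_setIr m0 _ Y0) ?setIA; last exact: measurableI.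
rewrite histE -setIA (prob1_setIr m0 _ Y0); last exact: measurableI.
rewrite (independent_sigma_algebras minc indY _ sH sE); last first.
  by apply/seteqP; split => i //= [h e]; move: h; rewrite e ltnn.
by rewrite -(prob1_setIr m0 mH Y0) -histE (prob1_setIr m0 (mh n) Y0) lawY fineK_prob.
Qed.

Lemma cvg_walk_sum (A : nat -> R) (nu : probability R R) :
  cvg_in_distribution P (fun n t => (Y n t)%:~R / A n) nu ->
  cvg_in_distribution P (fun n t => (walk_sum n t)%:~R / A n) nu.
Proof.
move=> h f cf bf; have [M fM] := bf.
have bf' n : bounded_mfun (fun k : int => f (k%:~R / A n)).
  by apply: (@bounded_mfun_int _ M) => k; exact: fM.
have E n : (\int[P]_t (f ((walk_sum n t)%:~R / A n))%:E =
            \int[P]_t (f ((Y n t)%:~R / A n))%:E)%E.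
  have b1 := bounded_mfun_comp (bf' n) (mY n).
  have b2 := bounded_mfun_comp (bf' n) (@measurable_walk_sum n).
  rewrite -(EFin_mean P b1) -(EFin_mean P b2); congr (_%:E).
  apply: (mean_eq_law (U := walk_sum n) (V := Y n) (f := fun k : int => f (k%:~R / A n))) => //.
    exact: measurable_walk_sum.
  by move=> B _; apply/esym; exact: prob_walk_sum.
under eq_fun do rewrite E.
exact: h.
Qed.

Let y n x := fine (P [set t | walk_sum n t = x]).

Let mws n (B : set int) : measurable [set t | B (walk_sum n t)].
Proof. by rewrite -[X in measurable X]setTI; exact: measurable_walk_sum. Qed.

Let yE n x : y n x = \int[P]_t (walk_sum n t == x)%:R.
Proof.
rewrite /y -mean_indic//; last exact: (@mws n [set x]).
apply: eq_Rintegral => t _; rewrite indicE.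
rewrite (_ : (t \in _) = (walk_sum n t == x))//.
by apply/idP/eqP => h; rewrite inE in h *.
Qed.

Let y0 x : y 0 x = (x == 0)%:R.
Proof.
rewrite yE; under eq_Rintegral do rewrite /walk_sum big_ord0.
by rewrite mean_cst eq_sym.
Qed.

Let y01 n x : 0 <= y n x <= 1.
Proof. by rewrite fine_prob_ge0/= fine_prob_le1//; exact: (@mws n [set x]). Qed.

Let yS n x : y n.+1 x = \int[mu]_l y n (x - l).
Proof.
rewrite yE (@mean_walk_sumS _ (fun k => (k == x)%:R) 1); last first.
  by move=> k; case: (k == x); rewrite ?normr1 ?normr0.
apply: eq_Rintegral => l _; rewrite yE; apply: eq_Rintegral => t _.
rewrite (_ : (walk_sum n t + l == x) = (walk_sum n t == x - l))//.
by rewrite [RHS]eq_sym subr_eq eq_sym.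
Qed.

Let G N x := \sum_(n < N) y n.*2 x.

(* For [x != 0] the term of time 0 vanishes, so two steps of the walk make
   [G N.+1 x] an average of values of [G N]. *)
Lemma green_max N x : G N x <= G N 0.
Proof.
elim: N x => [|N IH] x; first by rewrite /G !big_ord0.
have G1 m z : G m.+1 z = (z == 0)%:R + \sum_(n < m) y n.*2.+2 z.
  by rewrite /G big_ord_recl/= y0.
have [->//|x0] := eqVneq x 0.
rewrite G1 (negbTE x0) add0r.
have bG M z : bounded_mfun (fun l : int => G M (z - l)).
  apply: (@bounded_mfun_int _ M%:R) => l; rewrite ger0_norm; last first.
    by apply: sumr_ge0 => i _; have /andP[] := y01 i.*2 (z - l).
  rewrite /G -[leRHS]mulr1 -[M in M%:R]card_ord mulr_natl -sumr_const.
  by apply: ler_sum => i _; have /andP[] := y01 i.*2 (z - l).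
have by_ n z : bounded_mfun (fun l : int => y n (z - l)).
  by apply: (@bounded_mfun_int _ 1) => l; have /andP[h1 h2] := y01 n (z - l); rewrite ger0_norm.
have -> : \sum_(n < N) y n.*2.+2 x = \int[mu]_l \int[mu]_l' G N (x - l - l').
  rewrite (eq_bigr (fun n : 'I_N => \int[mu]_l y n.*2.+1 (x - l))); last by move=> n _; rewrite yS.
  rewrite -(mean_sum mu _ (fun n : 'I_N => by_ n.*2.+1 x)).
  apply: eq_Rintegral => l _.
  rewrite /G mean_sum//; apply: eq_bigr => n _; exact: yS.
rewrite -[leRHS](mean_cst mu); apply: le_mean.
- apply: (@bounded_mfun_int _ N%:R) => l; apply: le_norm_mean => // l'.
  rewrite ger0_norm; last first.
    by apply: sumr_ge0 => i _; have /andP[] := y01 i.*2 (x - l - l').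
  rewrite /G -[leRHS]mulr1 -[N in N%:R]card_ord mulr_natl -sumr_const.
  by apply: ler_sum => i _; have /andP[] := y01 i.*2 (x - l - l').
- exact: bounded_mfun_cst.
move=> l; rewrite -[leRHS](mean_cst mu); apply: le_mean => //.
  exact: bounded_mfun_cst.
move=> l'; apply: le_trans (IH _) _.
rewrite /G big_ord_recr/= lerDl; by have /andP[] := y01 N.*2 0.
Qed.

(** The expected time spent in a window of width of order N^a is at least of order N by tightness,
    and at most the width times the Green function at 0 by [green_max]. *)
Lemma green_lower (A : nat -> R) (beta a : R) (nu : probability R R) :
  (forall n, 0 < A n) -> 0 < beta -> stable beta nu -> beta^-1 < a -> a < 1 ->
  cvg_in_distribution P (fun n t => (Y n t)%:~R / A n) nu ->
  exists2 c : R, 0 < c & exists N0, forall N, (N0 <= N)%N ->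
    c * N%:R `^ (1 - a) <= \sum_(n < N) fine (P [set t | Y n.*2 t = 0]).
Proof.
move=> A0 beta0 nus ba a1 Ycvg.
have a0 : 0 < a by apply: lt_trans ba; rewrite invr_gt0.
have Scvg := cvg_walk_sum Ycvg.
have [C C0 hC] := normalization_power measurable_walk_sum char2_walk_sum A0 beta0 nus Scvg ba.
have half0 : 0 < 1 / 2 :> R by lra.
have [K K0 [n0 hK]] := tight measurable_walk_sum A0 Scvg half0.
(* [D] times N^a bounds the window size 2L + 1 <= 2B + 1, using 2^a <= 2 and N^a >= 1. *)
pose D := 4 * (K * C) + 1.
have KC0 : 0 <= K * C by rewrite mulr_ge0// ltW.
have D0 : 0 < D by rewrite /D; lra.
exists (4 * D)^-1; first by rewrite invr_gt0 mulr_gt0.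
(* At least half of the indices below [N] then exceed [n0], where tightness holds. *)
exists (n0.+1 + n0.+1)%N => N hN.
have N0 : 0 < N%:R :> R by rewrite ltr0n; apply: leq_trans hN; rewrite addSn.
have Na1 : 1 <= N%:R `^ a.
  have N1 : 1 <= N%:R :> R by rewrite ler1n; apply: leq_trans hN; rewrite addSn.
  by have := ler_powR N1 (ltW a0); rewrite powRr0.
have -> : \sum_(n < N) fine (P [set t | Y n.*2 t = 0]) = G N 0.
  by apply: eq_bigr => n _; rewrite (prob_walk_sum n.*2 [set 0]).
pose B := K * C * (2 * N%:R) `^ a.
have B0 : 0 <= B by rewrite mulr_ge0// powR_ge0.
pose L := Num.trunc B.
have LB : L%:R <= B by have /andP[] := truncn_itv B0.
have BL : B < L.+1%:R by have /andP[] := truncn_itv B0.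
have half_le n : (n0 < n)%N -> (n < N)%N ->
    1 / 2 <= \sum_(i < L + L.+1) y n.*2 (i%:Z - L%:Z).
  move=> n0n nN.
  have n2 : (n0 <= n.*2)%N by rewrite -addnn; apply: (leq_trans (ltnW n0n)); rewrite leq_addr.
  have A_le : A n.*2 <= C * (2 * N%:R) `^ a.
    apply: le_trans (hC n.*2 _) _; first by rewrite double_gt0; exact: leq_ltn_trans n0n.
    rewrite ler_wpM2l ?(ltW C0)// ge0_ler_powR ?(ltW a0)// ?nnegrE ?mulr_ge0//.
    by rewrite -natrM ler_nat -mul2n leq_mul2l ltnW.
  have mE : measurable [set t | K * A n.*2 < `|(walk_sum n.*2 t)%:~R : R|].
    exact: (@mws n.*2 [set k | K * A n.*2 < `|k%:~R : R|]).
  have : 1 / 2 <= fine (P (~` [set t | K * A n.*2 < `|(walk_sum n.*2 t)%:~R : R|])).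
    by rewrite fine_probC//; have := hK n.*2 n2; lra.
  move=> /le_trans; apply.
  rewrite -mean_indic; last exact: measurableC.
  rewrite (eq_bigr (fun i : 'I_(L + L.+1) =>
    \int[P]_t (walk_sum n.*2 t == i%:Z - L%:Z)%:R)); last by move=> i _; rewrite yE.
  have be k z : bounded_mfun (fun t => (walk_sum k t == z)%:R : R).
    have b : bounded_mfun (fun k : int => (k == z)%:R : R).
      by apply: (@bounded_mfun_int _ 1) => k'; case: (k' == z); rewrite ?normr1 ?normr0.
    exact: (bounded_mfun_comp b (@measurable_walk_sum k)).
  rewrite -(mean_sum P _ (fun i : 'I_(L + L.+1) => be n.*2 (i%:Z - L%:Z))).
  apply: le_mean.
  - by apply: bounded_mfun_indic; exact: measurableC.
  - by apply: bounded_mfun_sum => i; exact: be.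
  move=> t; rewrite indicE; case: (boolP (_ \in _)) => [|_]; last exact: sumr_ge0.
  rewrite inE/= => /negP; rewrite -leNgt => Wt.
  have absW : (absz (walk_sum n.*2 t) <= L)%N.
    rewrite -ltnS -(ltr_nat R); apply: le_lt_trans BL.
    rewrite natr_absz intr_norm; apply: (le_trans Wt).
    by rewrite /B -mulrA ler_wpM2l.
  have [j <-] := int_segment_index absW.
  rewrite (bigD1 j)//= eqxx lerDl.
  exact: sumr_ge0.
pose k := (N - n0.+1)%N.
have kN : N = (n0.+1 + k)%N by rewrite /k subnKC//; apply: leq_trans hN; rewrite leq_addr.
have lower : k%:R / 2 <= \sum_(n < N) \sum_(i < L + L.+1) y n.*2 (i%:Z - L%:Z).
  rewrite [in leRHS]kN big_split_ord/= ler_wpDl//.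
    by apply: sumr_ge0 => n _; apply: sumr_ge0 => i _; have /andP[] := y01 n.*2 (i%:Z - L%:Z).
  rewrite -[k in k%:R]card_ord mulr_natl -(sumr_const _ (2^-1)); apply: ler_sum => n _.
  rewrite -div1r; apply: half_le; first by rewrite addSn ltnS leq_addr.
  by rewrite kN ltn_add2l.
have upper : \sum_(n < N) \sum_(i < L + L.+1) y n.*2 (i%:Z - L%:Z) <= (L + L.+1)%:R * G N 0.
  rewrite exchange_big/= mulr_natl -[X in _ *+ X]card_ord -sumr_const.
  by apply: ler_sum => i _; exact: green_max.
have Nk : N%:R / 2 <= k%:R :> R.
  by rewrite ler_pdivrMr// -natrM ler_nat leq_half_subn.
have LD : (L + L.+1)%:R <= D * N%:R `^ a.
  have B2 : B <= 2 * (K * C) * N%:R `^ a.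
    rewrite /B powRM// mulrA ler_wpM2r ?powR_ge0// mulrC ler_wpM2r//.
    by apply: ler1_powR; [rewrite ler1n|exact: ltW].
  rewrite natrD -natr1 /D mulrDl mul1r; lra.
have G0 : 0 <= G N 0 by apply: sumr_ge0 => n _; have /andP[] := y01 n.*2 0.
have main : N%:R / 4 <= D * N%:R `^ a * G N 0.
  apply: (@le_trans _ _ ((L + L.+1)%:R * G N 0)); last by apply: ler_wpM2r.
  by apply: le_trans upper; apply: le_trans lower; lra.
rewrite powRB ?gt_eqF ?implybT// powRr1 ?(ltW N0)// mulrA ler_pdivrMr ?powR_gt0//.
rewrite invfM -mulrA mulrCA mulrC -ler_pdivlMr ?invr_gt0// invrK.
by move: main; rewrite mulrAC mulrC; lra.
Qed.

End random_walk_sums.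

(** * Gambler's ruin for the potential *)

Section gambler_ruin.
Context d (T : measurableType d) (R : realType) (P : probability T R).
Variables (I : choiceType) (X : I -> T -> R) (iota_ : nat -> I) (phi : R -> R).
Variables (C s2 g h : R).
Hypothesis mX : forall i, measurable_fun [set: T] (X i).
Hypothesis indX : mutually_independent P X.
Hypothesis iota_inj : injective iota_.
Hypothesis mphi : measurable_fun [set: R] phi.
Hypothesis phiC : forall x, `|phi x| <= C.
Hypothesis phi_mean : forall i, \int[P]_t phi (X i t) = 0.
Hypothesis phi_var : forall i, \int[P]_t (phi (X i t) ^+ 2) = s2.
Hypotheses (g_gt0 : 0 < g) (h_gt0 : 0 < h).

Definition env_sum n t := \sum_(i < n) phi (X (iota_ i) t).

Definition hits (N : nat) := [set t | exists j, [/\ (j <= N)%N, h <= env_sum j t &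
  forall i, (i < j)%N -> - g < env_sum i t]].

Let past n := events_in X [set i | exists2 j, (j < n)%N & i = iota_ j].

Let sumS n t : env_sum n.+1 t = env_sum n t + phi (X (iota_ n) t).
Proof. by rewrite /env_sum big_ord_recr. Qed.

Let sum0 t : env_sum 0 t = 0. Proof. by rewrite /env_sum big_ord0. Qed.

Let env_sum_past k n : (k <= n)%N ->
  measurable_fun [set: g_sigma_algebraType (past n)] (env_sum k).
Proof.
elim: k => [_|k IH kn].
  rewrite (_ : env_sum 0 = fun=> 0); first exact: measurable_cst.
  by apply/funext => t; exact: sum0.
rewrite (_ : env_sum k.+1 = fun t => env_sum k t + phi (X (iota_ k) t)); last first.
  by apply/funext => t; exact: sumS.
apply: measurable_funD; first exact: IH (ltnW kn).
apply: measurableT_comp => //; apply: measurable_fun_events_in.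
by exists k.
Qed.

Let measurable_ge (d' : measure_display) (T' : measurableType d') (f : T' -> R) r :
  measurable_fun [set: T'] f -> measurable [set t | r <= f t].
Proof.
move=> mf; rewrite (_ : mkset _ = f @^-1` `[r, +oo[%classic).
  by rewrite -[X in measurable X]setTI; exact: mf.
by apply/seteqP; split => t /=; rewrite in_itv/= andbT.
Qed.

Let measurable_gt (d' : measure_display) (T' : measurableType d') (f : T' -> R) r :
  measurable_fun [set: T'] f -> measurable [set t | r < f t].
Proof.
move=> mf; rewrite (_ : mkset _ = f @^-1` `]r, +oo[%classic).
  by rewrite -[X in measurable X]setTI; exact: mf.
by apply/seteqP; split => t /=; rewrite in_itv/= andbT.
Qed.

Let measurable_lt (d' : measure_display) (T' : measurableType d') (f : T' -> R) r :
  measurable_fun [set: T'] f -> measurable [set t | f t < r].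
Proof.
move=> mf; rewrite (_ : mkset _ = f @^-1` `]-oo, r[%classic).
  by rewrite -[X in measurable X]setTI; exact: mf.
by apply/seteqP; split => t /=; rewrite in_itv.
Qed.

Lemma hits_past N : <<s past N >> (hits N).
Proof.
pose PT := g_sigma_algebraType (past N).
rewrite (_ : hits N = \bigcup_(j in [set j | (j <= N)%N])
  ([set t : PT | h <= env_sum j t] `&`
   \bigcap_(i in [set i | (i < j)%N]) [set t : PT | - g < env_sum i t])).
  apply: (@bigcup_measurable _ PT) => j /= jN; apply: (@measurableI _ PT).
    by apply: (@measurable_ge _ PT); exact: env_sum_past.
  apply: (@bigcap_measurableType _ PT) => i /= ij.
  by apply: (@measurable_gt _ PT); apply: env_sum_past; exact: ltnW (leq_trans ij jN).
by apply/seteqP; split => t [j]; [move=> [h1 h2 h3]|move=> /= h1 [h2 h3]]; exists j.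
Qed.

Lemma measurable_hits N : measurable (hits N).
Proof. exact: (sigma_events_in_measurable mX (@hits_past N)). Qed.

Let inside n : set T := [set t | forall j, (j <= n)%N -> - g < env_sum j t < h].

Let inside_past n : <<s past n >> (inside n).
Proof.
pose PT := g_sigma_algebraType (past n).
rewrite (_ : inside n = \bigcap_(j in [set j | (j <= n)%N])
  ([set t : PT | - g < env_sum j t] `&` [set t : PT | env_sum j t < h])).
  apply: (@bigcap_measurableType _ PT) => j /= jn; apply: (@measurableI _ PT).
    by apply: (@measurable_gt _ PT); exact: env_sum_past.
  by apply: (@measurable_lt _ PT); exact: env_sum_past.
apply/seteqP; split => t hh j jn; have := hh j jn => /=; first by move=> /andP.
by move=> [-> ->].
Qed.

Let measurable_inside n : measurable (inside n).
Proof. exact: (sigma_events_in_measurable mX (@inside_past n)). Qed.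

Let a n : T -> R := \1_(inside n).

Let a_past n : measurable_fun [set: g_sigma_algebraType (past n)] (a n).
Proof.
by apply: (@measurable_indic _ (g_sigma_algebraType (past n)) R setT (inside n)); exact: inside_past.
Qed.

Let z n t := phi (X (iota_ n) t).

(* The walk stopped when it leaves the interval between [- g] and [h]. *)
Let M n t := \sum_(k < n) z k t * a k t.

Let M_past n : measurable_fun [set: g_sigma_algebraType (past n)] (M n).
Proof.
suff : forall k, (k <= n)%N -> measurable_fun [set: g_sigma_algebraType (past n)] (M k).
  exact.
have past_sub k : (k <= n)%N -> past k `<=` past n.
  move=> kn E [i [B [[j jk ->] mB ->]]]; exists (iota_ j), B; split => //.
  by exists j => //; exact: leq_trans kn.
elim=> [_|k IH kn].
  rewrite (_ : M 0 = fun=> 0); first exact: measurable_cst.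
  by apply/funext => t; rewrite /M big_ord0.
rewrite (_ : M k.+1 = fun t => M k t + z k t * a k t); last first.
  by apply/funext => t; rewrite /M big_ord_recr.
apply: measurable_funD; first exact: IH (ltnW kn).
apply: measurable_funM.
  by apply: measurableT_comp => //; apply: measurable_fun_events_in; exists k.
move=> _ B mB; have := a_past (n := k) measurableT mB.
exact: (sub_sigma_algebra2 (past_sub _ (ltnW kn))).
Qed.

Let C0 : 0 <= C := le_trans (normr_ge0 _) (phiC 0).

Let bz n : bounded_mfun (z n).
Proof. by split; [exact: measurableT_comp|exists C => t; exact: phiC]. Qed.

Let ba n : bounded_mfun (a n).
Proof. exact: bounded_mfun_indic. Qed.

Let bM n : bounded_mfun (M n).
Proof. by apply: bounded_mfun_sum => k; exact: bounded_mfunM. Qed.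

Let mean_next n (U : T -> R) (psi : R -> R) : bounded_mfun U ->
  measurable_fun [set: g_sigma_algebraType (past n)] U ->
  bounded_mfun psi ->
  \int[P]_t (psi (X (iota_ n) t) * U t) =
  \int[P]_t psi (X (iota_ n) t) * \int[P]_t U t.
Proof.
move=> bU mU bpsi; apply: mean_independentM => //; first exact: bounded_mfun_comp.
apply: (independent_functions mX indX (J := [set iota_ n])
  (K := [set i | exists2 j, (j < n)%N & i = iota_ j])) => //.
- apply/seteqP; split => i // [-> [j jn /iota_inj e]].
  by move: jn; rewrite -e ltnn.
- by apply: measurableT_comp => //; [exact: bpsi.1|exact: measurable_fun_events_in].
Qed.

Let bphi : bounded_mfun phi.
Proof. by split => //; exists C. Qed.

Let mean_M n : \int[P]_t M n t = 0.
Proof.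
rewrite /M mean_sum; last by move=> k; exact: bounded_mfunM.
by apply: big1 => k _; rewrite (mean_next (ba k) (a_past (n := k)) bphi) phi_mean mul0r.
Qed.

(** Orthogonality of martingale increments: the cross term is a centered step times a function of
    the past. *)
Let mean_M2 n : \int[P]_t (M n t ^+ 2) = s2 * \sum_(k < n) \int[P]_t a k t.
Proof.
have bM2 k : bounded_mfun (fun t => M k t ^+ 2) by exact: (bounded_mfunM (bM k) (bM k)).
have bphi2 : bounded_mfun (fun x => phi x ^+ 2) by exact: (bounded_mfunM bphi bphi).
elim: n => [|n IH].
  rewrite big_ord0 mulr0; under eq_Rintegral do rewrite /M big_ord0 expr0n.
  by rewrite mean_cst.
have baM : bounded_mfun (fun t => 2 * M n t * a n t).
  by apply: bounded_mfunM => //; apply: bounded_mfunM => //; exact: bounded_mfun_cst.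
have b1 : bounded_mfun (fun t => z n t * (2 * M n t * a n t)) by exact: bounded_mfunM.
have b2 : bounded_mfun (fun t => z n t ^+ 2 * a n t).
  by apply: bounded_mfunM => //; exact: (bounded_mfunM (bz n) (bz n)).
transitivity (\int[P]_t (M n t ^+ 2 + (z n t * (2 * M n t * a n t) + z n t ^+ 2 * a n t))).
  apply: eq_Rintegral => t _; rewrite {1}/M big_ord_recr/= -/(M n t).
  have aa : a n t * a n t = a n t.
    by rewrite /a indicE; case: (_ \in _); rewrite ?mulr1 ?mulr0.
  by rewrite sqrrD exprMn [a n t ^+ 2]expr2 aa; ring.
rewrite (meanD _ (bM2 n) (bounded_mfunD b1 b2)) (meanD _ b1 b2).
rewrite (@mean_next n (fun t => 2 * M n t * a n t) phi)//; last first.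
  apply: measurable_funM => //; apply: measurable_funM => //; exact: measurable_cst.
rewrite (@mean_next n (a n) (fun x => phi x ^+ 2))// phi_mean phi_var mul0r add0r IH.
by rewrite big_ord_recr/= mulrDr.
Qed.

Let M_cases n t : [\/ inside n t /\ M n t = env_sum n t,
  exists j, [/\ (j <= n)%N, h <= env_sum j t,
    (forall i, (i < j)%N -> - g < env_sum i t < h) & M n t = env_sum j t] |
  exists j, [/\ (j <= n)%N, env_sum j t <= - g,
    (forall i, (i < j)%N -> - g < env_sum i t < h) & M n t = env_sum j t]].
Proof.
have MS k : M k.+1 t = M k t + z k t * a k t by rewrite /M big_ord_recr.
elim: n => [|n [[hin hM]|[j [jn hj hi hM]]|[j [jn hj hi hM]]]].
- constructor 1; split; last by rewrite sum0 /M big_ord0.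
  by move=> j; rewrite leqn0 => /eqP ->; rewrite sum0 h_gt0 oppr_lt0 g_gt0.
- have MSE : M n.+1 t = env_sum n.+1 t.
    by rewrite MS hM sumS /a indicE (mem_set hin) mulr1.
  have [hS|hS] := leP h (env_sum n.+1 t); first by constructor 2; exists n.+1.
  have [hS'|hS'] := leP (env_sum n.+1 t) (- g); first by constructor 3; exists n.+1.
  constructor 1; split => // j; rewrite leq_eqVlt => /predU1P[->|].
    by rewrite hS hS'.
  exact: hin.
- constructor 2; exists j; split => //; first exact: leqW.
  rewrite MS /a indicE memNset ?mulr0 ?addr0// => /(_ j jn) /andP[_].
  by rewrite ltNge hj.
- constructor 3; exists j; split => //; first exact: leqW.
  rewrite MS /a indicE memNset ?mulr0 ?addr0// => /(_ j jn) /andP[+ _].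
  by rewrite ltNge hj.
Qed.

Let step_le n t : `|env_sum n.+1 t - env_sum n t| <= C.
Proof. by rewrite sumS addrC addKr. Qed.

(** One line for the three cases of [M_cases], with [C] bounding the overshoot above [h]; as [M N]
    is centered, taking means gives the ruin estimate. *)
Let M_upper N t : M N t <= (h + C + g) * \1_(hits N) t + (g + h) * a N t - g.
Proof.
have i0 (A : set T) : 0 <= \1_A t :> R by rewrite indicE.
have c0 : 0 <= (h + C + g) * \1_(hits N) t.
  by rewrite mulr_ge0// !addr_ge0// ltW.
have c1 : 0 <= (g + h) * a N t by rewrite mulr_ge0// addr_ge0// ltW.
have [[hin ->]|[j [jn hj hi ->]]|[j [jn hj hi ->]]] := M_cases N t.
- have -> : a N t = 1 by rewrite /a indicE mem_set.
  by have /andP[_ /ltW] := hin N (leqnn N); lra.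
- have -> : \1_(hits N) t = 1 :> R.
    by rewrite indicE mem_set//; exists j; split => // i /hi /andP[].
  case: j hj hi {jn} => [|j hj hi]; first by rewrite sum0 leNgt h_gt0.
  have /andP[_ hj'] := hi j (ltnSn j).
  have := step_le j t; rewrite ler_norml => /andP[_]; lra.
- lra.
Qed.

Let M_bound N t : M N t ^+ 2 <= (h + C + g) ^+ 2.
Proof.
suff : `|M N t| <= h + C + g.
  by move=> hM; rewrite -real_normK ?num_real// ler_pXn2r// nnegrE !addr_ge0// ltW.
rewrite ler_norml; move: C0 g_gt0 h_gt0 => Cge0 g0 h0.
have [[hin ->]|[j [jn hj hi ->]]|[j [jn hj hi ->]]] := M_cases N t.
- by have /andP[h1 h2] := hin N (leqnn N); apply/andP; split; lra.
- case: j hj hi {jn} => [|j hj hi]; first by rewrite sum0 leNgt h_gt0.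
  have /andP[h1 h2] := hi j (ltnSn j).
  by have := step_le j t; rewrite ler_norml => /andP[h3 h4]; apply/andP; split; lra.
- case: j hj hi {jn} => [|j hj hi]; first by rewrite sum0 lerNr oppr0 leNgt g_gt0.
  have /andP[h1 h2] := hi j (ltnSn j).
  by have := step_le j t; rewrite ler_norml => /andP[h3 h4]; apply/andP; split; lra.
Qed.

Lemma gambler_ruin N :
  g - (g + h) * fine (P (inside N)) <= (h + C + g) * fine (P (hits N)).
Proof.
have bh : bounded_mfun (\1_(hits N) : T -> R) by apply: bounded_mfun_indic; exact: measurable_hits.
have bhZ : bounded_mfun (fun t => (h + C + g) * \1_(hits N) t).
  by apply: bounded_mfunM => //; exact: bounded_mfun_cst.
have baZ : bounded_mfun (fun t => (g + h) * a N t).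
  by apply: bounded_mfunM => //; exact: bounded_mfun_cst.
have : \int[P]_t M N t <= \int[P]_t ((h + C + g) * \1_(hits N) t + (g + h) * a N t - g).
  apply: (le_mean P (bM N) (bounded_mfunB (bounded_mfunD bhZ baZ) (bounded_mfun_cst g))).
  by move=> t; exact: M_upper.
rewrite mean_M (meanB _ (bounded_mfunD bhZ baZ) (bounded_mfun_cst g)) (meanD _ bhZ baZ).
rewrite !meanZl// mean_cst !mean_indic//; last exact: measurable_hits.
lra.
Qed.

(** The stopped walk is bounded, while its variance gains at least [s2 * P (inside N)] at each of
    the [N] steps, the events [inside] being decreasing. *)
Lemma exit_time N : s2 * (N%:R * fine (P (inside N))) <= (h + C + g) ^+ 2.
Proof.
have s20 : 0 <= s2.
  by rewrite -(phi_var (iota_ 0)); apply: Rintegral_ge0 => t _; exact: sqr_ge0.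
apply: (@le_trans _ _ (\int[P]_t (M N t ^+ 2))).
  rewrite mean_M2 ler_wpM2l// mulr_natl -[N in _ *+ N]card_ord -sumr_const.
  apply: ler_sum => k _; rewrite -(mean_indic P (measurable_inside N)).
  apply: (le_mean P (ba N) (ba k)) => t.
  rewrite /a !indicE; case: (boolP (_ \in inside N)) => // tN.
  rewrite mem_set// => j jk; move: tN; rewrite inE; apply.
  exact: leq_trans jk (ltnW (ltn_ord k)).
rewrite -[leRHS](mean_cst P); apply: le_mean.
- exact: (bounded_mfunM (bM N) (bM N)).
- exact: bounded_mfun_cst.
- by move=> t; exact: M_bound.
Qed.

(** Diffusive scaling makes the bound free of [h]: with [N] of order h^2 the walk is still inside
    with probability at most [gamma / 4], which costs at most half of [g] in [gambler_ruin]. *)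
Lemma hits_prob_ge (gamma : R) N : 0 < gamma -> gamma <= 1 -> 0 < s2 -> 1 <= h ->
  g = gamma * h -> 4 * (2 + C) ^+ 2 / (s2 * gamma) * h ^+ 2 <= N%:R ->
  gamma / (2 * (2 + C)) <= fine (P (hits N)).
Proof.
move=> gamma0 gamma1 s20 h1 gE hN.
have C2 : 0 < 2 + C by rewrite ltr_wpDr.
have hCg : h + C + g <= (2 + C) * h.
  have : C * 1 <= C * h by rewrite ler_wpM2l.
  have : gamma * h <= 1 * h by rewrite ler_wpM2r// ltW.
  by rewrite gE; lra.
set p := fine (P (inside N)).
have p0 : 0 <= p by exact: fine_prob_ge0.
have ple : p <= gamma / 4.
  have k0 : 0 < 4 * (2 + C) ^+ 2 / gamma * h ^+ 2.
    by rewrite mulr_gt0 ?exprn_gt0// divr_gt0// mulr_gt0// exprn_gt0.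
  rewrite -(ler_pM2l k0); apply: (@le_trans _ _ (s2 * (N%:R * p))).
    rewrite [leRHS]mulrA; apply: ler_wpM2r => //.
    rewrite -(ler_pM2l (x := s2^-1)) ?invr_gt0// mulKf ?gt_eqF//.
    by apply: le_trans hN; rewrite invfM le_eqVlt; apply/orP; left; apply/eqP; ring.
  apply: le_trans (exit_time N) _; apply: (@le_trans _ _ (((2 + C) * h) ^+ 2)).
    by rewrite ler_pXn2r// nnegrE ?mulr_ge0// ?addr_ge0// ltW.
  by rewrite exprMn le_eqVlt; apply/orP; left; apply/eqP; field; rewrite gt_eqF.
have := gambler_ruin N; rewrite -/p => ruin.
rewrite ler_pdivrMr ?mulr_gt0// -(ler_pM2r h_gt0).
have q0 : 0 <= fine (P (hits N)) by exact: fine_prob_ge0.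
have e1 : (h + C + g) * fine (P (hits N)) <= (2 + C) * h * fine (P (hits N)).
  by rewrite ler_wpM2r.
have e2 : (g + h) * p <= 2 * h * (gamma / 4).
  apply: ler_pM => //; first by rewrite addr_ge0// ltW.
  have : gamma * h <= 1 * h by rewrite ler_wpM2r// ltW.
  by rewrite gE; lra.
by move: ruin e1 e2; rewrite gE; lra.
Qed.

End gambler_ruin.

(** * Independent blocks of environment *)

(** With a uniform lower bound on the probabilities, [n] consecutive failures have probability at
    most [(1 - c) ^+ n]. *)
Lemma independent_events_io d d' (T : measurableType d) (T' : measurableType d')
    (R : realType) (P : probability T R) (I : choiceType) (X : I -> T -> T')
    (J : nat -> set I) (E : nat -> set T) (c : R) :
  (forall i, measurable_fun [set: T] (X i)) -> mutually_independent P X ->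
  (forall i k, (i < k)%N -> J i `&` J k = set0) ->
  (forall k, <<s events_in X (J k) >> (E k)) ->
  0 < c -> (forall k, c <= fine (P (E k))) ->
  {ae P, forall t, forall m, exists2 k, (m <= k)%N & E k t}.
Proof.
move=> mX indX JJ sE c0 Ec; apply/ae_foralln => m.
have mE k : measurable (E k) by exact: (sigma_events_in_measurable mX (@sE k)).
pose F n := \bigcap_(i in `I_n) ~` E (m + i)%N.
pose JF n := \bigcup_(i in `I_n) J (m + i)%N.
have FS n : F n.+1 = F n `&` ~` E (m + n)%N.
  by rewrite /F IIS bigcap_setU bigcap_set1.
have sF n : <<s events_in X (JF n) >> (F n).
  apply: (@bigcap_measurableType _ (g_sigma_algebraType (events_in X (JF n)))) => i ni.
  apply: (@measurableC _ (g_sigma_algebraType (events_in X (JF n)))).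
  apply: (sub_sigma_algebra2 _ (@sE (m + i)%N)) => _ [x [B [Jx mB ->]]].
  by exists x, B; split => //; exists i.
have mF n : measurable (F n) by exact: (sigma_events_in_measurable mX (@sF n)).
have PF n : fine (P (F n)) <= (1 - c) ^+ n.
  elim: n => [|n IH]; first by rewrite expr0; exact: fine_prob_le1.
  have disj : JF n `&` J (m + n)%N = set0.
    apply/seteqP; split => x // [[i /= ni Ji] Jn].
    have im : (m + i < m + n)%N by rewrite ltn_add2l.
    by have := JJ _ _ im; rewrite -subset0 => /(_ x); apply.
  have sEC : <<s events_in X (J (m + n)%N) >> (~` E (m + n)%N).
    by apply: (@measurableC _ (g_sigma_algebraType (events_in X (J (m + n)%N)))); exact: sE.
  rewrite FS (independent_sigma_algebras mX indX disj (@sF n) sEC).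
  rewrite fineM ?fin_prob//; last exact: measurableC.
  rewrite exprSr; apply: ler_pM; rewrite ?fine_prob_ge0//.
  by rewrite fine_probC// lerD2l lerN2.
have cle1 : c <= 1 by apply: le_trans (Ec 0%N) _; exact: fine_prob_le1.
have mFoo : measurable (\bigcap_n F n) by exact: bigcap_measurableType.
exists (\bigcap_n F n); split => //; last first.
  move=> t /= ht n _ i ni Ei; apply: ht; exists (m + i)%N => //.
  exact: leq_addr.
suff e : fine (P (\bigcap_n F n)) = 0 by rewrite -[LHS](fineK_prob P mFoo) e.
apply/eqP; rewrite eq_le fine_prob_ge0 andbT.
have Foo n : fine (P (\bigcap_n F n)) <= (1 - c) ^+ n.
  by apply: le_trans (PF n); apply: le_fine_prob => // t; apply.
rewrite leNgt; apply/negP => p0; set p := fine _ in Foo p0.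
(* The powers of the inverse of [1 - c] are used next, so [c = 1] is treated apart. *)
have [c1|c1] := eqVneq c 1; first by have := Foo 1%N; rewrite c1 subrr expr1 leNgt p0.
have q0 : 0 < 1 - c by rewrite subr_gt0 lt_neqAle c1.
have [n hn] : exists n, p^-1 + 1 <= (1 - c)^-1 ^+ n.
  by apply: expr_unbounded; rewrite invf_gt1// ltrBlDr ltrDl.
have := Foo n; rewrite leNgt => /negP; apply.
rewrite -[ltRHS]invrK -[ltLHS]invrK -exprVn ltf_pV2 ?posrE ?exprn_gt0 ?invr_gt0//.
by apply: lt_le_trans hn; rewrite ltrDl.
Qed.

Section blocks.
Variables D q : nat.

(* The block of index [k] covers the distances from [block_start k] to
   [block_start k.+1].  The factor [q] makes the potential accumulated on the
   earlier blocks, at most [C * block_start k], negligible against the height;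
   the length is diffusive, so that the height is reached within the block with
   probability bounded below. *)
Fixpoint block_start k : nat :=
  if k is k'.+1 then block_start k' + D * (q * (block_start k' + k').+1) ^ 2 else 0.

(** The summand [k] makes the heights at least [k] when [q] is positive, hence unbounded; the
    successor keeps them positive. *)
Definition block_height k : nat := q * (block_start k + k).+1.

Definition block_length k : nat := D * block_height k ^ 2.

Lemma block_startS k : block_start k.+1 = (block_start k + block_length k)%N.
Proof. by []. Qed.

Lemma leq_block_start i k : (i <= k)%N -> (block_start i <= block_start k)%N.
Proof.
move=> /subnK <-; elim: (k - i)%N => // n IH.
by rewrite addSn block_startS; exact: leq_trans IH (leq_addr _ _).
Qed.

(** The potential lives on edges and is 0 on {0, 1}: from there the first site crossed is 1 towards
    the right and 0 towards the left, whence the shift by one. *)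
Definition right_block k j : int := Posz (block_start k + j).+1.
Definition left_block k j : int := - Posz (block_start k + j).

Lemma right_block_inj k : injective (right_block k).
Proof. by move=> i j [] /addnI. Qed.

Lemma left_block_inj k : injective (left_block k).
Proof. by move=> i j /oppr_inj [] /addnI. Qed.

Let J k := [set i | exists2 j, (j < block_length k)%N & i = right_block k j] `|`
           [set i | exists2 j, (j < block_length k)%N & i = left_block k j].

(** Rank of a site on its side, equal to [block_start k + j] on both blocks; the sites 0 and 1 both
    have rank 0. *)
Let dist (x : int) : nat := match x with Posz n => n.-1 | Negz n => n.+1 end.

Let dist_block k x : J k x -> (block_start k <= dist x < block_start k.+1)%N.
Proof.
rewrite block_startS => -[] [j jN ->]; first by rewrite /= leq_addr ltn_add2l.
suff -> : dist (left_block k j) = (block_start k + j)%N by rewrite leq_addr ltn_add2l.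
by rewrite /left_block; case: (block_start k + j)%N.
Qed.

Lemma disjoint_blocks i k : (i < k)%N -> J i `&` J k = set0.
Proof.
move=> ik; apply/seteqP; split => x // [/dist_block /andP[_ h1] /dist_block /andP[h2 _]].
by have := leq_trans (leq_ltn_trans h2 h1) (leq_block_start ik); rewrite ltnn.
Qed.

Context d (T : measurableType d) (R : realType) (P : probability T R).
Variables (X : int -> T -> R) (phi : R -> R) (C s2 gamma : R).
Hypothesis mX : forall i, measurable_fun [set: T] (X i).
Hypothesis indX : mutually_independent P X.
Hypothesis mphi : measurable_fun [set: R] phi.
Hypothesis phiC : forall x, `|phi x| <= C.
Hypothesis phi_mean : forall i, \int[P]_t phi (X i t) = 0.
Hypothesis phi_var : forall i, \int[P]_t (phi (X i t) ^+ 2) = s2.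
Hypotheses (gamma0 : 0 < gamma) (gamma1 : gamma <= 1) (s20 : 0 < s2).
Hypotheses (q0 : (0 < q)%N) (hD : 4 * (2 + C) ^+ 2 / (s2 * gamma) <= D%:R).

Definition right_hits k : set T :=
  hits X (right_block k) phi (gamma * (block_height k)%:R) (block_height k)%:R (block_length k).

(** Crossing a site from right to left reverses the increment of the potential, hence [- phi]. *)
Definition left_hits k : set T :=
  hits X (left_block k) (fun x => - phi x) (gamma * (block_height k)%:R) (block_height k)%:R
    (block_length k).

Let height_ge1 k : (1 : R) <= (block_height k)%:R.
Proof. by rewrite -[1]/(1%:R) ler_nat muln_gt0 q0. Qed.

Let height_gt0 k : (0 : R) < (block_height k)%:R.
Proof. exact: lt_le_trans (height_ge1 k). Qed.

Let length_ge k : 4 * (2 + C) ^+ 2 / (s2 * gamma) * (block_height k)%:R ^+ 2 <= (block_length k)%:R.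
Proof. by rewrite /block_length natrM natrX ler_wpM2r// exprn_ge0// ltW. Qed.

Lemma valley_io :
  {ae P, forall t, forall m, exists2 k, (m <= k)%N & (right_hits k `&` left_hits k) t}.
Proof.
pose c := gamma / (2 * (2 + C)).
have C0 : 0 <= C := le_trans (normr_ge0 _) (phiC 0).
have c0 : 0 < c by rewrite divr_gt0// mulr_gt0// ltr_wpDr.
have mNphi : measurable_fun [set: R] (fun x => - phi x) by exact: measurableT_comp.
have disj k : [set i | exists2 j, (j < block_length k)%N & i = right_block k j] `&`
    [set i | exists2 j, (j < block_length k)%N & i = left_block k j] = set0.
  apply/seteqP; split => x // [[j _ ->] [j' _]].
  by rewrite /right_block /left_block; case: (block_start k + j')%N.
have sR k := @hits_past _ T R _ X (right_block k) phi (gamma * (block_height k)%:R)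
  (block_height k)%:R mphi (block_length k).
have sL k := @hits_past _ T R _ X (left_block k) _ (gamma * (block_height k)%:R)
  (block_height k)%:R mNphi (block_length k).
apply: (independent_events_io mX indX disjoint_blocks _ (mulr_gt0 c0 c0)) => k.
  apply: (@measurableI _ (g_sigma_algebraType (events_in X (J k)))).
    apply: sub_sigma_algebra2 (sR k) => _ [x [B [Jx mB ->]]].
    by exists x, B; split => //; left.
  apply: sub_sigma_algebra2 (sL k) => _ [x [B [Jx mB ->]]].
  by exists x, B; split => //; right.
have -> : P (right_hits k `&` left_hits k) = (P (right_hits k) * P (left_hits k))%E.
  exact: (independent_sigma_algebras mX indX (disj k) (sR k) (sL k)).
have mR : measurable (right_hits k) by exact: measurable_hits.
have mL : measurable (left_hits k) by exact: measurable_hits.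
rewrite fineM ?fin_prob//; apply: ler_pM; rewrite ?(ltW c0)//.
  apply: (hits_prob_ge mX indX (@right_block_inj k) mphi phiC phi_mean phi_var) => //.
  exact: mulr_gt0.
apply: (hits_prob_ge (C := C) (s2 := s2) mX indX (@left_block_inj k) mNphi) => //.
- by move=> x; rewrite normrN.
- move=> i; under eq_Rintegral do rewrite -mulN1r.
  by rewrite meanZl ?phi_mean ?mulr0//; apply: bounded_mfun_comp => //; split => //; exists C.
- by move=> i; under eq_Rintegral do rewrite sqrrN.
- exact: mulr_gt0.
Qed.

End blocks.

(** * Moments of the increments of the potential *)

Section log_ratio.
Context {R : realType}.
Variable eps : R.

(** The logarithm of [rho], cut off outside the ellipticity interval so as to be bounded everywhere
    and not only almost surely. *)
Definition log_ratio (p : R) : R := (ln (1 - p) - ln p) * \1_(`[eps, 1 - eps]%classic) p.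

Lemma measurable_log_ratio : measurable_fun [set: R] log_ratio.
Proof.
apply: measurable_funM; last exact: measurable_indic.
apply: measurable_funB; last exact: measurable_ln.
apply: measurableT_comp; first exact: measurable_ln.
by apply: measurable_funB => //; exact: measurable_cst.
Qed.

Lemma log_ratio_bound p : 0 < eps -> eps < 1 / 2 -> `|log_ratio p| <= - ln eps.
Proof.
move=> e0 e1; have le0 : 0 <= - ln eps by rewrite oppr_ge0 ln_le0//; lra.
rewrite /log_ratio indicE; case: (boolP (p \in _)); last by rewrite mulr0 normr0.
rewrite inE /= in_itv/= => /andP[p1 p2]; rewrite mulr1.
have h1 : ln eps <= ln p by rewrite ler_ln ?posrE//; lra.
have h2 : ln eps <= ln (1 - p) by rewrite ler_ln ?posrE//; lra.
have h3 : ln p <= 0 by rewrite ln_le0//; lra.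
have h4 : ln (1 - p) <= 0 by rewrite ln_le0//; lra.
by rewrite ler_norml; apply/andP; split; lra.
Qed.

Lemma log_ratioE p : 0 < eps -> eps <= p <= 1 - eps -> log_ratio p = ln (1 - p) - ln p.
Proof. by move=> e0 h; rewrite /log_ratio indicE mem_set ?mulr1//= in_itv. Qed.

Lemma ln_rho (p : R) : 0 < p < 1 -> ln (rho p) = ln (1 - p) - ln p.
Proof. by move=> /andP[p0 p1]; rewrite /rho ln_div ?posrE// subr_gt0. Qed.

End log_ratio.

Section environment.
Context d (T : measurableType d) (R : realType) (P : probability T R).
Variables (omega : int -> {RV P >-> R}) (eps : R).
Hypothesis omega01 : forall x w, 0 < omega x w < 1.
Hypothesis omega_id : identically_distributed P (fun x => omega x : T -> R).
Hypothesis Elogrho : ('E_P[fun w => ln (rho (omega 0%R w))] = 0)%E.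
Hypothesis Vlogrho : (0 < 'V_P[fun w => ln (rho (omega 0%R w))])%E.
Hypothesis eps0 : 0 < eps.
Hypothesis eps1 : eps < 1 / 2.
Hypothesis elliptic : P [set w | eps <= omega 0 w <= 1 - eps] = 1%E.

Lemma ae_elliptic : {ae P, forall w, forall x, eps <= omega x w <= 1 - eps}.
Proof.
have mI : measurable (`[eps, 1 - eps]%classic : set R) by [].
have pre x : [set w | eps <= omega x w <= 1 - eps] = omega x @^-1` `[eps, 1 - eps]%classic.
  by apply/seteqP; split => w /=; rewrite in_itv.
have mE x : measurable [set w | eps <= omega x w <= 1 - eps].
  by rewrite pre -[X in measurable X]setTI; exact: measurable_funP.
have ae1 x : {ae P, forall w, eps <= omega x w <= 1 - eps}.
  apply/negligibleP; first exact: measurableC.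
  by apply: prob1_setC => //; rewrite -elliptic 2!pre; exact: omega_id.
have aen : {ae P, forall w, forall n : nat,
    eps <= omega (Posz n) w <= 1 - eps /\ eps <= omega (Negz n) w <= 1 - eps}.
  apply/ae_foralln => n; move: (ae1 (Posz n)) (ae1 (Negz n)).
  by apply: filterS2.
by apply: filterS aen => w h [] n; have [] := h n.
Qed.

Let mlogrho : measurable_fun [set: T] (fun w => ln (rho (omega 0 w))).
Proof.
rewrite (_ : (fun w => _) = fun w => ln (1 - omega 0 w) - ln (omega 0 w)); last first.
  by apply/funext => w; exact: ln_rho.
apply: measurable_funB; apply: measurableT_comp => //; try exact: measurable_ln.
by apply: measurable_funB => //; exact: measurable_cst.
Qed.

Let blr : bounded_mfun (log_ratio eps).
Proof.
split; first exact: measurable_log_ratio.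
by exists (- ln eps) => p; exact: log_ratio_bound.
Qed.

Let blr2 : bounded_mfun (fun p => log_ratio eps p ^+ 2).
Proof. exact: (bounded_mfunM blr blr). Qed.

Let bo (f : R -> R) x : bounded_mfun f -> bounded_mfun (fun w => f (omega x w)).
Proof. by move=> bf; apply: (bounded_mfun_comp bf); exact: measurable_funP. Qed.

Let law (f : R -> R) x : bounded_mfun f ->
  \int[P]_w f (omega x w) = \int[P]_w f (omega 0 w).
Proof.
by move=> bf; apply: mean_eq_law => // B mB; exact: omega_id.
Qed.

Lemma mean_log_ratio x : \int[P]_w log_ratio eps (omega x w) = 0.
Proof.
rewrite (law _ blr); apply: EFin_inj; rewrite EFin_mean; last exact: bo.
rewrite -[RHS]Elogrho unlock; apply: ae_eq_integral => //.
- by apply/measurable_EFinP; exact: (bo 0 blr).1.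
- exact/measurable_EFinP.
- by apply: filterS ae_elliptic => w h _; rewrite log_ratioE// ln_rho.
Qed.

Definition log_ratio_var : R := \int[P]_w (log_ratio eps (omega 0 w) ^+ 2).

Lemma mean_log_ratio2 x : \int[P]_w (log_ratio eps (omega x w) ^+ 2) = log_ratio_var.
Proof. exact: (law x blr2). Qed.

Lemma log_ratio_var_gt0 : 0 < log_ratio_var.
Proof.
rewrite -lte_fin EFin_mean; last exact: (bo 0 blr2).
move: Vlogrho; rewrite /variance unlock Elogrho/= unlock => /lt_le_trans; apply.
rewrite le_eqVlt; apply/orP; left; apply/eqP; apply: ae_eq_integral => //.
- apply/measurable_EFinP; apply: measurable_funM; apply: measurable_funB => //; exact: measurable_cst.
- by apply/measurable_EFinP; exact: (bo 0 blr2).1.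
- apply: filterS ae_elliptic => w h _; rewrite log_ratioE// -ln_rho//.
  by transitivity (((ln (rho (omega 0 w)) - 0) ^+ 2)%:E); last by rewrite subr0.
Qed.

End environment.

(** * The quenched walk in a deep valley *)

(** The first [L] terms, those of the earlier blocks, add up to at most [g] in modulus; this is the
    [g] lost in both conclusions. *)
Lemma partial_sums_after_hit (R : realType) (x : nat -> R) (C g h : R) L j :
  (forall i, `|x i| <= C) -> C * L%:R <= g -> 0 <= g -> 0 < h ->
  h <= \sum_(i < j) x (L + i)%N ->
  (forall k, (k < j)%N -> - g < \sum_(i < k) x (L + i)%N) ->
  [/\ (0 < j)%N, h - g <= \sum_(i < L + j) x i &
   forall n, (n <= L + j)%N -> - (2 * g) <= \sum_(i < n) x i].
Proof.
move=> xC CL g0 h0 hj hk.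
have C0 : 0 <= C := le_trans (normr_ge0 _) (xC 0%N).
have small n : (n <= L)%N -> `|\sum_(i < n) x i| <= g.
  move=> nL; apply: le_trans CL; apply: le_trans (ler_norm_sum _ _ _) _.
  apply: (@le_trans _ _ (\sum_(i < n) C)); first exact: ler_sum.
  by rewrite sumr_const card_ord -[C *+ n]mulr_natr ler_wpM2l// ler_nat.
have split k : \sum_(i < L + k) x i = \sum_(i < L) x i + \sum_(i < k) x (L + i)%N.
  by rewrite big_split_ord.
have /andP[sL _] : - g <= \sum_(i < L) x i <= g by rewrite -ler_norml; exact: small.
split; first by case: j hj {hk} => // ; rewrite big_ord0 leNgt h0.
- by rewrite split; lra.
- move=> n nj; have [nL|Ln] := leqP n L.
    by have := small n nL; rewrite ler_norml => /andP[]; lra.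
  rewrite -(subnKC (ltnW Ln)) split.
  have : (n - L <= j)%N by rewrite leq_subLR.
  rewrite leq_eqVlt => /predU1P[->|/hk]; lra.
Qed.

Section potential.
Context (R : realType).
Variables (e xi : int -> R) (C : R).
Hypothesis e01 : forall x, 0 < e x < 1.
Hypothesis exi : forall x, e x * expR (xi x) = 1 - e x.
Hypothesis xiC : forall x, `|xi x| <= C.

Let rsum n := \sum_(i < n) xi (Posz i.+1).
Let lsum n := \sum_(i < n) - xi (- Posz i).

(** Sinai's potential, indexed by edges: [potential x] sits on {x, x + 1}, and passing the site [x]
    from left to right adds [xi x]. *)
Definition potential (x : int) : R :=
  match x with Posz n => rsum n | Negz n => lsum n.+1 end.

Definition conductance x := expR (- potential x).

Let c_gt0 x : 0 < conductance x. Proof. exact: expR_gt0. Qed.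

Lemma conductance_balance x :
  e x * conductance (x - 1) = (1 - e x) * conductance x.
Proof.
suff /eqP : potential x - potential (x - 1) = xi x.
  rewrite subr_eq => /eqP xE.
  rewrite -exi /conductance -mulrA -expRD xE.
  by congr (_ * expR _); ring.
case: x => [[|n]|n].
- by rewrite sub0r /= /rsum /lsum big_ord0 big_ord1 opprK oppr0 add0r.
- have -> : Posz n.+1 - 1 = Posz n by lia.
  by rewrite /= /rsum big_ord_recr/= addrAC subrr add0r.
- have -> : Negz n - 1 = Negz n.+1 by lia.
  by rewrite /= /lsum [in X in _ - X]big_ord_recr/= opprD addrA subrr sub0r opprK NegzE.
Qed.

(** The two exit edges have conductance at most e^(g - h), all edges met by the valley at most
    e^(2g), and the edge {0, 1} exactly 1. The 8 is the 4 of [valley_return] times two edges per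
    site. *)
Lemma valley_return_hit L j j' (g h : R) n : C * L%:R <= g -> 0 <= g -> 0 < h ->
  h <= \sum_(i < j) xi (Posz (L + i).+1) ->
  (forall k, (k < j)%N -> - g < \sum_(i < k) xi (Posz (L + i).+1)) ->
  h <= \sum_(i < j') - xi (- Posz (L + i)) ->
  (forall k, (k < j')%N -> - g < \sum_(i < k) - xi (- Posz (L + i))) ->
  n%:R <= expR (h - g) / 4 ->
  exists2 I : seq int, uniq I &
    (8 * (L + L + (j + j'))%:R * expR (2 * g))^-1 <= killed e I (n + n) 0 0.
Proof.
move=> CL g0 h0 hr hr' hl hl' hn.
have [j0 rh rlow] := partial_sums_after_hit (x := fun i => xi (Posz i.+1))
  (fun i => xiC _) CL g0 h0 hr hr'.
have xiNC i : `|- xi (- Posz i)| <= C by rewrite normrN.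
have [j'0 lh llow] := partial_sums_after_hit (x := fun i => - xi (- Posz i))
  xiNC CL g0 h0 hl hl'.
(* [potential (Negz a)] is a sum of [a.+1] terms, so the left barrier, met after [L + j'] terms, is
   the edge of index [Negz a]. *)
have [a aE] : exists a, a.+1 = (L + j')%N.
  by exists (L + j').-1; rewrite prednK// addn_gt0 j'0 orbT.
pose b := (L + j)%N.
exists (valley a b); first exact: valley_uniq.
have cge (x : int) : - (2 * g) <= potential x -> conductance x <= expR (2 * g).
  by move=> hx; rewrite ler_expR; lra.
have pr m : (m <= b)%N -> - (2 * g) <= potential (Posz m) by exact: rlow.
have pl m : (m <= a)%N -> - (2 * g) <= potential (Negz m).
  by move=> ma; apply: llow; rewrite -aE ltnS.
have wle z : z \in valley a b -> vertex_weight conductance z <= 2 * expR (2 * g).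
  move=> zv; rewrite /vertex_weight mulr_natl mulr2n; apply: lerD; apply: cge.
    by case: z zv => m; [rewrite Posz_in_valley => /pr|rewrite Negz_in_valley => /ltnW /pl].
  case: z zv => [[|m]|m].
  - by move=> _; rewrite sub0r; exact: (pl 0%N).
  - by rewrite Posz_in_valley => /ltnW /pr; rewrite (_ : Posz m.+1 - 1 = Posz m)//; lia.
  - by rewrite Negz_in_valley => /pl; rewrite (_ : Negz m - 1 = Negz m.+1)//; lia.
have w0ge : 1 <= vertex_weight conductance 0.
  rewrite /vertex_weight {1}/conductance /= /rsum big_ord0 oppr0 expR0 lerDl.
  exact/ltW/c_gt0.
have cb : conductance (Posz b) <= expR (- (h - g)) by rewrite ler_expR lerN2.
have ca : conductance (Negz a) <= expR (- (h - g)).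
  by rewrite ler_expR lerN2 /= aE.
have hn' : n%:R * (conductance (Posz b) + conductance (Negz a)) <= vertex_weight conductance 0 / 2.
  apply: (@le_trans _ _ (expR (h - g) / 4 * (2 * expR (- (h - g))))).
    apply: ler_pM => //; first by rewrite addr_ge0// ltW.
    by rewrite mulr_natl mulr2n lerD.
  have -> : expR (h - g) / 4 * (2 * expR (- (h - g))) = expR (h - g) * expR (- (h - g)) / 2.
    by field.
  by rewrite expRxMexpNx_1 ler_pM2r.
apply: le_trans (valley_return e01 c_gt0 conductance_balance hn').
have sz : size (valley a b) = (L + L + (j + j'))%N.
  by rewrite size_cat !size_map !size_iota addSnnS aE addnACA.
have W : \sum_(z <- valley a b) vertex_weight conductance z <=
    (L + L + (j + j'))%:R * (2 * expR (2 * g)).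
  apply: (@le_trans _ _ (\sum_(z <- valley a b) 2 * expR (2 * g))).
    by rewrite big_seq [leRHS]big_seq; exact: ler_sum.
  by rewrite big_const_seq count_predT iter_addr_0 sz [leRHS]mulr_natl.
have W0 : 0 < \sum_(z <- valley a b) vertex_weight conductance z.
  rewrite (bigD1_seq 0) ?valley_uniq ?Posz_in_valley//= ltr_pwDl ?(lt_le_trans _ w0ge)//.
  by apply: sumr_ge0 => z _; rewrite addr_ge0// ltW.
rewrite -[leLHS]mul1r; apply: ler_pM => //.
rewrite lef_pV2 ?posrE ?mulr_gt0 ?expR_gt0 ?ltr0n//; first by move: W; lra.
by rewrite addnC addn_gt0 addn_gt0 j0.
Qed.

End potential.

(** Nothing is known of [p] between the good scales, so one scale has to supply all of [M]: on its
    window [p] is bounded below by a constant, and the sum of [q] there is at least of order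
    e^(theta h / 2). *)
Lemma divergent_product_series (R : realType) (p q : nat -> R) (theta K c : R) N0 :
  (forall n, 0 <= p n) -> (forall n, 0 <= q n) ->
  0 < theta -> 0 < K -> 0 < c ->
  (forall N, (N0 <= N)%N -> c * N%:R `^ theta <= \sum_(n < N) q n.*2) ->
  (forall B : nat, exists2 h : R, B%:R <= h & forall n, n%:R <= expR (h / 2) / 4 ->
    K / h ^+ 2 * expR (- (theta / 4 * h)) <= p n.*2) ->
  forall M : R, exists N, M <= \sum_(n < N) p n * q n.
Proof.
move=> p0 q0 theta0 K0 c0 hq hp M.
(* The inequality e^(theta h / 4) >= (theta h / 12)^3 beats the denominator h^2 by one power, so the
   sum is at least [k * h]. The 8 comes from N >= e^(h/2) / 8. *)
pose k := K * c * expR (- (theta * ln 8)) * (theta / 12) ^+ 3.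
have k0 : 0 < k.
  by rewrite !mulr_gt0// ?expR_gt0// exprn_gt0// divr_gt0.
(* The three terms ensure in turn that [N] is at least [N0], that it is at least 1, and that [k * h]
   is at least [M]. *)
pose B := (16 * N0 + 8 + (Num.trunc (M / k)).+1)%N.
have [h hB hn] := hp B.
have [hN0 h8 hM] : [/\ 16 * N0%:R <= h, 8 <= h & M / k <= h].
  have BE : B%:R = 16 * N0%:R + 8 + (Num.trunc (M / k)).+1%:R :> R.
    by rewrite /B natrD natrD natrM.
  have := hB; rewrite BE => hB'.
  have t0 : 0 <= (Num.trunc (M / k)).+1%:R :> R by [].
  have n0 : 0 <= N0%:R :> R by [].
  by have := truncnS_gt (M / k); split; lra.
have h0 : 0 < h by lra.
set y := expR (h / 2).
have y1 : 1 + h / 2 <= y by exact: expR_ge1Dx.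
pose N := Num.trunc (y / 4).
have /andP[Nle Ngt] : N%:R <= y / 4 < N.+1%:R by apply: truncn_itv; lra.
have N1 : (1 : R) <= N%:R.
  rewrite -[1]/(1%:R) ler_nat lt0n; apply/eqP => N00.
  by move: Ngt; rewrite N00; lra.
have Nge : y / 8 <= N%:R by move: Ngt; rewrite -(natr1 N); lra.
have N0N : (N0 <= N)%N by rewrite -(ler_nat R); lra.
exists N.*2.
have dbl n : \sum_(i < n) p i.*2 * q i.*2 <= \sum_(i < n.*2) p i * q i.
  elim: n => [|n IH]; first by rewrite !big_ord0.
  rewrite doubleS !big_ord_recr/= -addrA lerD// lerDl mulr_ge0//.
apply: le_trans (dbl N).
set a := K / h ^+ 2 * expR (- (theta / 4 * h)).
have a0 : 0 <= a by rewrite mulr_ge0 ?expR_ge0// divr_ge0 ?exprn_ge0 ?ltW.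
apply: (@le_trans _ _ (a * (c * N%:R `^ theta))); last first.
  apply: (@le_trans _ _ (a * \sum_(i < N) q i.*2)); first by rewrite ler_wpM2l// hq.
  rewrite mulr_sumr; apply: ler_sum => i _; apply: ler_wpM2r => //; apply: hn.
  by apply: le_trans Nle; rewrite ler_nat ltnW.
apply: (@le_trans _ _ (a * (c * expR (theta * (h / 2) - theta * ln 8)))); last first.
  apply: ler_wpM2l => //; apply: ler_wpM2l; first exact: ltW.
  rewrite -mulrBr mulrC expRM; apply: ge0_ler_powR; rewrite ?nnegrE ?expR_ge0 ?(ltW theta0)//.
  by apply: le_trans Nge; rewrite expRB lnK ?posrE.
have -> : a * (c * expR (theta * (h / 2) - theta * ln 8)) =
    K * c * expR (- (theta * ln 8)) * (expR (theta / 4 * h) / h ^+ 2).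
  rewrite /a expRD.
  have -> : theta * (h / 2) = theta / 4 * h + theta / 4 * h by field.
  rewrite [expR (_ + _)]expRD; have e1 := expRxMexpNx_1 (theta / 4 * h).
  set u := expR (theta / 4 * h) in e1 *; set v := expR (- (theta / 4 * h)) in e1 *.
  set w := expR (- _).
  transitivity (K * c * w * (u / h ^+ 2) * (u * v)); last by rewrite e1 mulr1.
  by field; rewrite gt_eqF.
apply: (@le_trans _ _ (k * h)); first by rewrite mulrC -ler_pdivrMr.
rewrite /k -mulrA; apply: ler_wpM2l; first by rewrite !mulr_ge0 ?expR_ge0// ltW.
rewrite ler_pdivlMr ?exprn_gt0// [leLHS](_ : _ = (theta / 12 * h) ^+ 3); last by ring.
have -> : theta / 4 * h = 3%:R * (theta / 12 * h) by field.
rewrite expRM_natl; apply: lerXn2r; rewrite ?nnegrE ?expR_ge0//.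
  by rewrite mulr_ge0// ?divr_ge0 ?ltW.
by apply: le_trans (expR_ge1Dx _); rewrite lerDr.
Qed.

(** As gamma <= 1/2, barriers of height h - gamma h still exceed h/2, which gives the time window.
    The valley has at most 2h + 2Dh^2 <= (2 + 2D)h^2 sites, whence the constant. *)
Lemma return_of_hits (R : realType) d (T : measurableType d) (X : int -> T -> R)
    (phi : R -> R) (C gamma : R) (D q k : nat) (e : int -> R) (t : T) n :
  (forall x, 0 < e x < 1) -> (forall x, e x * expR (phi (X x t)) = 1 - e x) ->
  (forall p, `|phi p| <= C) -> 0 < gamma -> gamma <= 1 / 2 -> C / gamma <= q%:R ->
  (0 < q)%N ->
  (right_hits D q X phi gamma k `&` left_hits D q X phi gamma k) t ->
  n%:R <= expR ((block_height D q k)%:R / 2 : R) / 4 ->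
  exists2 I : seq int, uniq I &
    (8 * (2 + 2 * D%:R))^-1 / (block_height D q k)%:R ^+ 2 *
      expR (- (2 * gamma * (block_height D q k)%:R)) <= killed e I n.*2 0 0.
Proof.
move=> e01 ee phiC g0 g1 Cq q0 [[j [jN hj hi]] [j' [j'N hj' hi']]] hn.
have C0 : 0 <= C := le_trans (normr_ge0 _) (phiC 0).
set L := block_start D q k in hj hi hj' hi' *.
set hh := block_height D q k in hj hi hj' hi' hn jN j'N *.
have Lh : (L < hh)%N.
  by apply: (@leq_trans (L + k).+1); [rewrite ltnS leq_addr|rewrite leq_pmull].
have h1 : (1 : R) <= hh%:R by rewrite -[1]/(1%:R) ler_nat (leq_ltn_trans _ Lh).
have LhR : L%:R <= hh%:R :> R by rewrite ler_nat ltnW.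
have CL : C * L%:R <= gamma * hh%:R.
  have -> : C * L%:R = gamma * (C / gamma * L%:R) by field; rewrite gt_eqF.
  rewrite ler_pM2l// /hh /block_height natrM; apply: ler_pM => //; first by rewrite divr_ge0// ltW.
  by rewrite ler_nat ltnW// ltnS leq_addr.
move hE: (hh%:R) h1 LhR CL hj hi hj' hi' hn => h h1 LhR CL hj hi hj' hi' hn.
have h0 : 0 < h by lra.
have gh0 : 0 <= gamma * h by rewrite mulr_ge0// ltW.
have [|I uI hI] := valley_return_hit (n := n) e01 ee (fun x => phiC (X x t)) CL gh0 h0 hj hi hj' hi'.
  apply: le_trans hn _; rewrite ler_pM2r// ler_expR.
  by have : gamma * h <= 1 / 2 * h by [rewrite ler_wpM2r// ltW|]; lra.
exists I; first exact: uI.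
rewrite -addnn; apply: le_trans hI.
have NhR m : (m <= block_length D q k)%N -> m%:R <= D%:R * h ^+ 2.
  by rewrite -hE -natrX -natrM ler_nat.
have jN' := NhR _ jN; have j'N' := NhR _ j'N.
have hh2 : h <= h ^+ 2 by rewrite expr2 ler_peMl// ltW.
have W : (L + L + (j + j'))%:R <= (2 + 2 * D%:R) * h ^+ 2 by rewrite !natrD; lra.
have W0 : (0 : R) < (L + L + (j + j'))%:R.
  rewrite ltr0n addnC addn_gt0 addn_gt0; case: (j) hj => // .
  by rewrite /env_sum big_ord0 leNgt h0.
have D0 : 0 < 2 + 2 * D%:R :> R by rewrite ltr_wpDr// mulr_ge0.
rewrite expRN -!invfM mulrA lef_pV2 ?posrE ?mulr_gt0 ?expR_gt0 ?exprn_gt0//.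
by apply: ler_wpM2r; [exact: expR_ge0|lra].
Qed.

Theorem proposition4p1 (R : realType)
  (dO : measure_display) (Omega : measurableType dO) (P : probability Omega R)
  (omega : int -> {RV P >-> R}) (eps : R)
  (dT : measure_display) (T : measurableType dT)
  (Q : Omega -> probability T R) (X Y : nat -> {mfun T >-> int})
  (mu : probability int R) (A : nat -> R) (beta : R) (nu : probability R R)
  (omega01 : forall x w, 0 < omega x w < 1)
  (omega_iid : iid P (fun x => omega x : Omega -> R))
  (Elogrho : ('E_P[fun w => ln (rho (omega 0%R w))] = 0)%E)
  (Vlogrho : (0 < 'V_P[fun w => ln (rho (omega 0%R w))])%E)
  (eps_bounds : 0 < eps < 1 / 2)
  (elliptic : P [set w | eps <= omega 0 w <= 1 - eps] = 1%E)
  (XY_indep : forall w, independent_processes (Q w)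
     (fun n => X n : T -> int) (fun n => Y n : T -> int))
  (X_walk : forall w, walk_in_env (Q w)
     (fun n => X n : T -> int) (fun x => omega x w))
  (Y_walk : forall w, random_walk (Q w) (fun n => Y n : T -> int) mu)
  (mu_centered : centered mu)
  (A_gt0 : forall n, 0 < A n)
  (beta_bounds : 1 < beta <= 2)
  (nu_stable : stable beta nu)
  (Y_cvg : forall w, cvg_in_distribution (Q w)
     (fun n t => (Y n t)%:~R / A n) nu) :
  {ae P, forall w,
    recurrent (Q w) (fun n => X n : T -> int) (fun n => Y n : T -> int)}.
Proof.
move: eps_bounds beta_bounds => /andP[eps0 eps1] /andP[beta1 _].
have [indep idist] := omega_iid.
have beta0 : 0 < beta by exact: lt_trans beta1.
have ib0 : 0 < beta^-1 by rewrite invr_gt0.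
have ib1 : beta^-1 < 1 by rewrite invf_lt1.
(* The exponent a of the normalization is taken midway between 1/beta and 1, and [theta] is 1 - a.
   The valley then costs e^(- 2 gamma h) = e^(- theta h / 4). *)
pose theta := (1 - beta^-1) / 2; pose gamma := theta / 8.
have theta0 : 0 < theta by rewrite /theta; lra.
have gamma0 : 0 < gamma by rewrite /gamma; lra.
have gamma1 : gamma <= 1 / 2 by rewrite /gamma /theta; lra.
have gE : 2 * gamma = theta / 4 by rewrite /gamma; field.
have gamma_le1 : gamma <= 1 by lra.
pose s2 := log_ratio_var omega eps.
have s20 : 0 < s2 by exact: (log_ratio_var_gt0 omega01 idist Elogrho Vlogrho eps0 eps1 elliptic).
pose C := - ln eps.
have lrC p : `|log_ratio eps p| <= C by exact: log_ratio_bound.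
have [D hD] : exists D : nat, 4 * (2 + C) ^+ 2 / (s2 * gamma) <= D%:R.
  by exists (Num.trunc (4 * (2 + C) ^+ 2 / (s2 * gamma))).+1; exact/ltW/truncnS_gt.
have [q q0 hq] : exists2 q : nat, (0 < q)%N & C / gamma <= q%:R.
  by exists (Num.trunc (C / gamma)).+1 => //; exact/ltW/truncnS_gt.
have momega x : measurable_fun [set: Omega] (omega x : Omega -> R) by exact: measurable_funP.
have io := valley_io (q := q) momega indep (@measurable_log_ratio R eps) lrC
  (mean_log_ratio omega01 idist Elogrho eps0 eps1 elliptic)
  (mean_log_ratio2 idist eps0 eps1) gamma0 gamma_le1 s20 q0 hD.
(* Both almost sure properties concern the environment alone; it is fixed from here on. *)
apply: filterS2 (ae_elliptic idist elliptic) io => w ell hits_io.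
pose e x := omega x w.
have e01 x : 0 < e x < 1 by exact: omega01.
have ee x : e x * expR (log_ratio eps (e x)) = 1 - e x.
  have /andP[e0 e1] := e01 x.
  rewrite (log_ratioE eps0 (ell x)) expRB !lnK ?posrE ?subr_gt0//.
  by rewrite mulrC divfK ?gt_eqF.
have mX n : measurable_fun [set: T] (X n : T -> int) by exact: measurable_funP.
have mY n : measurable_fun [set: T] (Y n : T -> int) by exact: measurable_funP.
have pX := walk_in_env_path_law mX (X_walk w).
have pY := random_walk_path_law mY (Y_walk w).
apply: (recurrent_of_divergent_series mX mY _ _ pX pY (XY_indep w)) => //.
- exact: env_kernel_ge0.
- by move=> x y; exact: fine_prob_ge0.
have [c c0 [N0 hN0]] : exists2 c, 0 < c & exists N0, forall N, (N0 <= N)%N ->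
    c * N%:R `^ theta <= \sum_(n < N) fine (Q w [set t | Y n.*2 t = 0]).
  have -> : theta = 1 - (1 + beta^-1) / 2 by rewrite /theta; field; rewrite gt_eqF.
  by apply: (green_lower mY (Y_walk w) A_gt0 beta0 nu_stable _ _ (Y_cvg w)); lra.
have K0 : 0 < (8 * (2 + 2 * D%:R))^-1 :> R.
  by rewrite invr_gt0 mulr_gt0// ltr_wpDr// mulr_ge0.
apply: (divergent_product_series (p := fun n => fine (Q w [set t | X n t = 0]))
  (q := fun n => fine (Q w [set t | Y n t = 0])) _ _ theta0 K0 c0 hN0).
- by move=> n; exact: fine_prob_ge0.
- by move=> n; exact: fine_prob_ge0.
move=> B; have [k Bk hk] := hits_io B.
exists (block_height D q k)%:R.
  rewrite ler_nat; apply: (leq_trans Bk).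
  apply: (@leq_trans (block_start D q k + k).+1); last by rewrite leq_pmull.
  by rewrite ltnW// ltnS leq_addl.
move=> n hn.
have [I uI hI] := return_of_hits e01 ee lrC gamma0 gamma1 hq q0 hk hn.
apply: le_trans (killed_le_prob mX e01 _ 0 uI pX).
by apply: le_trans hI; rewrite gE.
Qed.
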